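(* Let $k$ and $\delta$ be integers with $k\geqslant 1$. As $n\to \infty$ (through integers), $$\frac 12 \left(\frac{p^k(n+\delta)}{p^k(n)}+ \frac{p^k(n-\delta)}{p^k(n)}\right) = 1 + \frac{\frac 1{2}a_k^2 \delta^2}{(n+h_k)^{2-2/(k+1)}} -\frac{\left(2-\frac 3{2(k+1)} \right)a_k \delta^2}{(n+h_k)^{2-1/(k+1)}}+O\left( \frac{1}{n^{2}}\right),$$ where the implied constant depends only on $k$ and $\delta$.
   Context: For a positive integer $k$, $p^k(n)$ denotes the number of partitions of the integer $n$ into (positive) $k$th powers, so $\sum_{n=0}^\infty p^k(n) q^n = \prod_{m=1}^\infty \frac 1{1-q^{m^k}}$. With $\Gamma$ the gamma function and $\zeta$ the Riemann zeta function, set $c_k:=\frac 1k \Gamma(1+\frac 1k)\zeta(1+\frac 1k)$, $a_k:=c_k^{k/(k+1)}$ and $h_k:=\frac{\zeta(-k)}2$. *)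

(* Defs.v *)
From Stdlib Require Import ZArith Reals ClassicalEpsilon.
From mathcomp Require Import all_boot.
From Coquelicot Require Import Coquelicot.

Set Implicit Arguments.
Unset Strict Implicit.
Unset Printing Implicit Defensive.

(* A partition of n into positive kth powers is encoded by its multiplicities:
   f i is the number of parts equal to (i+1)^k.  For k >= 1, n bounds both
   the bases and the multiplicities that can occur. *)
Definition power_partitions_nat (k n : nat) : nat :=
  #|[set f : {ffun 'I_n -> 'I_n.+1} | (\sum_i f i * i.+1 ^ k == n)%N]|.

Definition power_partitions (k : nat) (n : Z) : nat :=
  if (n <? 0)%Z then 0%N else power_partitions_nat k (Z.to_nat n).

Local Open Scope R_scope.

Definition Gamma (x : R) : R :=
  RInt_gen (fun t : R => Rpower t (x - 1) * exp (- t))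
           (at_right 0) (Rbar_locally p_infty).

Definition Cexp (z : C) : C :=
  (exp (Re z) * cos (Im z), exp (Re z) * sin (Im z)).

(* (n+1)^(-s) *)
Definition zeta_term (s : C) (n : nat) : C :=
  Cexp (Cmult (Copp s) (RtoC (ln (INR n.+1)))).

Definition dirichlet_zeta (s : C) : C :=
  (Series (fun n => Re (zeta_term s n)), Series (fun n => Im (zeta_term s n))).

Definition zeta_continuation (Z : C -> C) : Prop :=
  (forall s : C, s <> RtoC 1 ->
     ex_derive (K := C_AbsRing) (V := C_NormedModule) Z s) /\
  (forall s : C, 1 < Re s -> Z s = dirichlet_zeta s).

(* The Riemann zeta function: the Dirichlet series where it converges
   absolutely, and elsewhere its holomorphic continuation to C minus {1}.
   That continuation is unique by the identity theorem, so the choice operator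
   determines the value at every s <> 1; the value at the pole is junk. *)
Definition zeta (s : C) : C :=
  if Rlt_dec 1 (Re s) then dirichlet_zeta s
  else epsilon (inhabits (fun _ : C => RtoC 0)) zeta_continuation s.

(* The zeta function is real at real arguments, so Re only changes the type. *)
Definition Rzeta (x : R) : R := Re (zeta (RtoC x)).

Definition c_ (k : nat) : R :=
  1 / INR k * Gamma (1 + 1 / INR k) * Rzeta (1 + 1 / INR k).

Definition a_ (k : nat) : R := Rpower (c_ k) (INR k / (INR k + 1)).

Definition h_ (k : nat) : R := Rzeta (- INR k) / 2.

(* Main.v *)
(* Circle method on real integrals.  Put eps = (c_k / n)^(1/(k+1)) and x = eps^k,
   the main term of the saddle point.  For every M >= n, p^k(n) is a Fourier
   coefficient of the finite product F(z) of 1 / (1 - exp (- z m^k)) over m <= M, at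
   z = x - i theta, and the symmetric shift by delta multiplies the integrand by
   cosh (delta z).  So the left-hand side minus 1 is the mean of
   cosh (delta z) - 1 = delta^2 z^2 / 2 + O(z^4) for the complex weight F(z) exp (n z).

   For theta = x tau with tau small, comparing sums over m with integrals gives, with
   B = (1 + 1/k) c_k,
     log |F(z) / F(x)| = - B tau^2 / (2 eps) + O(tau^2 + tau^4 / eps),
     arg F(z) - n theta = - tau / 2 - (2 + 1/k) B tau^3 / (6 eps)
                          + O(eps tau + tau^3 + tau^5 / eps),
   where - tau / 2 is the boundary term of the trapezoidal rule, and Laplace's method
   gives the mean of z^2 with relative error O(eps^2).  For larger theta, the k-th
   difference of m^k theta is k! theta; when this is close to 0 modulo 2 pi, the
   progression m = 1 (mod k!) or the small m are used instead.  Either way |F(z) / F(x)|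
   is smaller than every power of eps.

   The shift h_k only contributes O(n^(-2)), so no value of zeta(-k) is needed. *)
Require Import Defs.
From Stdlib Require Import ZArith Reals Lra Lia Classical.
From mathcomp Require Import all_boot.
From mathcomp Require ssralg poly ssrint zify.
From Coquelicot Require Import Coquelicot.

Local Open Scope R_scope.

(** * Counting partitions by a recurrence over the bases *)

(** The stated error amounts to relative precision eps^2 in the mean of z^2, as x^2 eps^2 = (c_k /
    n)^2; the correction of relative size eps must therefore be found exactly. Since x solves only
    the leading saddle equation, the phase keeps a linear term. On the Gaussian scale tau =
    sqrt(eps) s that term has the same size as the cubic one, and both enter the second coefficient.
    One function carries all sums over m: [bern], which is v / (exp v - 1). The sums of j^s exp(- j
    v) that arise from Taylor expansion in tau are combinations of its derivatives once multiplied
    by v^(s+1), hence smooth at v = 0, and the integral of bern(u^k) over u >= 0 is c_k. The product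
    is finite and M may be taken as large as desired for each eps, with constants that do not depend
    on M; no infinite product or complex logarithm is formed. The Fourier formula itself comes from
    a recurrence in M, not from multiplying series. *)

Section PartitionPolynomial.
Import ssralg poly ssrint GRing.Theory.

(** The bound [B] on multiplicities is separate from the number [M] of bases: [power_partitions_nat]
    sets both to [n], but the recurrence must change [M] alone. Integer coefficients make room for
    the factor 1 - X^b. *)
Definition partition_poly (k B M : nat) : {poly int} :=
  (\prod_(i < M) \sum_(j < B.+1) 'X^(j * i.+1 ^ k))%R.

(** Expanding the product picks one exponent for each base, so the monomials are indexed by the
    multiplicity functions. *)
Lemma coef_partition_poly (k B M n : nat) :
  ((partition_poly k B M)`_n)%R =
  Posz #|[set f : {ffun 'I_M -> 'I_B.+1} | (\sum_i f i * i.+1 ^ k == n)%N]|.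
Proof.
rewrite /partition_poly bigA_distr_bigA coef_sum -sum1dep_card -natz natr_sum.
rewrite [RHS]big_mkcond /=; apply: eq_bigr => f _.
rewrite prodrXr coefXn eq_sym; by case: eqP.
Qed.

Lemma partition_poly_rec (k B M : nat) :
  (partition_poly k B M.+1 * (1 - 'X^(M.+1 ^ k)) =
   partition_poly k B M * (1 - 'X^(B.+1 * M.+1 ^ k)))%R.
Proof.
rewrite /partition_poly big_ord_recr /= -mulrA; congr GRing.mul.
rewrite -[RHS]opprB mulnC exprM subrX1 -mulNr opprB mulrC; congr GRing.mul.
by apply: eq_bigr => j _; rewrite -exprM mulnC.
Qed.

Lemma coef_partition_poly_rec (k B M n : nat) : (n <= B)%N ->
  ((partition_poly k B M.+1)`_n = (partition_poly k B M)`_n +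
    (if (n < M.+1 ^ k)%N then 0 else (partition_poly k B M.+1)`_(n - M.+1 ^ k)))%R.
Proof.
move=> nB; have /(congr1 (fun p : {poly int} => (p`_n)%R)) := partition_poly_rec k B M.
rewrite !mulrBr !mulr1 !coefB !coefMXn.
(* The truncation of the geometric series is invisible in degrees up to [B]. *)
have -> : (n < B.+1 * M.+1 ^ k)%N.
  by apply: (leq_trans (n:=B.+1)); rewrite ?ltnS // leq_pmulr // expn_gt0.
by rewrite subr0 => <-; rewrite subrK.
Qed.



Definition bounded_partitions (k B M n : nat) : nat :=
  #|[set f : {ffun 'I_M -> 'I_B.+1} | (\sum_i f i * i.+1 ^ k == n)%N]|.

Lemma bounded_partitions0 (k B n : nat) : bounded_partitions k B 0 n = (n == 0%N).
Proof.
have := coef_partition_poly k B 0 n.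
rewrite /partition_poly big_ord0 coef1 -/(bounded_partitions k B 0 n) => /eqP.
by rewrite natz eqz_nat => /eqP.
Qed.

Lemma bounded_partitions_rec (k B M n : nat) : (n <= B)%N ->
  bounded_partitions k B M.+1 n = (bounded_partitions k B M n +
    (if (n < M.+1 ^ k)%N then 0 else bounded_partitions k B M.+1 (n - M.+1 ^ k)))%N.
Proof.
move=> nB; have := coef_partition_poly_rec k _ M _ nB; rewrite !coef_partition_poly.
rewrite /bounded_partitions; by case: ifP => _; rewrite ?addr0 ?addn0 => [[->]].
Qed.

End PartitionPolynomial.

Section PartitionCount.
Import zify.

(** A characterisation of the counts by initial values and a recurrence in the number of bases. It
    is what identifies the Fourier integrals with partition numbers. *)
Lemma power_partitions_unique (k : nat) (q : nat -> Z -> R) : (0 < k)%N ->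
  (forall n, q 0%N n = if (n =? 0)%Z then 1 else 0) ->
  (forall M n, (n < 0)%Z -> q M n = 0) ->
  (forall M n, q M.+1 n = q M n + q M.+1 (n - Z.of_nat (M.+1 ^ k)%N)%Z) ->
  forall M n, (n <= Z.of_nat M)%Z -> INR (power_partitions k n) = q M n.
Proof.
move=> k0 q0 qneg qrec.
(* [B] stays fixed while [n] decreases in the inner induction, so the statement is for every
   [B >= n]. *)
have key B M n : (n <= B)%N ->
  q M (Z.of_nat n) = INR (bounded_partitions k B M n).
  elim: M n => [|M IHM] n.
    by rewrite q0 bounded_partitions0 => _; case: n.
  elim/ltn_ind: n => n IHn nB.
  rewrite qrec bounded_partitions_rec // IHM //.
  have b0 : (0 < M.+1 ^ k)%N by rewrite expn_gt0.
  case: ltnP => hb.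
    by rewrite (qneg M.+1) ?addn0 ?Rplus_0_r //; lia.
  have -> : (Z.of_nat n - Z.of_nat (M.+1 ^ k) = Z.of_nat (n - M.+1 ^ k))%Z by lia.
  rewrite IHn; try lia.
  by rewrite plus_INR.
(* A base above [n] cannot occur: as k >= 1, its k-th power exceeds [n] as well. *)
have stab n M : (n <= M)%N -> q M (Z.of_nat n) = q n (Z.of_nat n).
  elim: M => [|M IHM]; first by case: n.
  rewrite leq_eqVlt => /orP[/eqP -> //|]; rewrite ltnS => nM.
  rewrite qrec IHM // (qneg M.+1) ?Rplus_0_r //.
  have : (M.+1 <= M.+1 ^ k)%N by rewrite -{1}(expn1 M.+1) leq_pexp2l.
  move: (M.+1 ^ k)%N => b; lia.
move=> M n nM; rewrite /power_partitions; case: Z.ltb_spec => n0.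
  by rewrite qneg.
have -> : n = Z.of_nat (Z.to_nat n) by lia.
rewrite Nat2Z.id stab; last by lia.
by rewrite (key (Z.to_nat n)).
Qed.

End PartitionCount.

(** * The logarithm of a geometric factor *)

Lemma INR_S_pos (n : nat) : 0 < INR (S n).
Proof. exact: lt_0_INR (Nat.lt_0_succ n). Qed.

Lemma Rabs_cos_le_1 (x : R) : Rabs (cos x) <= 1.
Proof. by apply: Rabs_le; exact: COS_bound. Qed.

Lemma Rabs_sin_le_1 (x : R) : Rabs (sin x) <= 1.
Proof. by apply: Rabs_le; exact: SIN_bound. Qed.

Lemma Series_nonneg (a : nat -> R) :
  (forall j, 0 <= a j) -> ex_series a -> 0 <= Series a.
Proof.
move=> a0 exa; rewrite -(PSeries_const_0 1) PSeries_1.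
by apply: Series_le => // j; split; [lra | exact: a0].
Qed.

(** The index runs over 1 <= m <= M, like the bases of the parts. The value [f 0] never enters,
    which is why hypotheses below concern [f (S m)]. *)
Fixpoint psum (f : nat -> R) (M : nat) : R :=
  match M with O => 0 | S M' => psum f M' + f M end.

Lemma psum_le (f g : nat -> R) M :
  (forall m, f (S m) <= g (S m)) -> psum f M <= psum g M.
Proof. by move=> fg; elim: M => /= [|M IH]; [lra | have := fg M; lra]. Qed.

Lemma psum_plus (f g : nat -> R) M :
  psum (fun m => f m + g m) M = psum f M + psum g M.
Proof. by elim: M => /= [|M ->]; lra. Qed.

Lemma psum_scal (a : R) (f : nat -> R) M :
  psum (fun m => a * f m) M = a * psum f M.
Proof. by elim: M => /= [|M ->]; lra. Qed.

Lemma psum_abs_le (f g : nat -> R) M :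
  (forall m, Rabs (f (S m)) <= g (S m)) -> Rabs (psum f M) <= psum g M.
Proof.
move=> fg; elim: M => /= [|M IH]; first by rewrite Rabs_R0; lra.
have := Rabs_triang (psum f M) (f M.+1); have := fg M; lra.
Qed.

Lemma psum_nonneg (f : nat -> R) M : (forall m, 0 <= f (S m)) -> 0 <= psum f M.
Proof. by move=> f0; elim: M => /= [|M IH]; [lra | have := f0 M; lra]. Qed.

Lemma psum_le_length (f : nat -> R) M N : (forall m, 0 <= f (S m)) ->
  le M N -> psum f M <= psum f N.
Proof.
move=> f0; elim=> [|N' _ IH] /=; first lra.
by have := f0 N'; lra.
Qed.

(** * Power series on the unit interval and polylogarithms *)

Lemma CV_radius_dominated (a b : nat -> R) :
  (forall j, Rabs (a j) <= Rabs (b j)) -> Rbar_le (CV_radius b) (CV_radius a).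
Proof.
move=> ab; have [_ lubb] := CV_radius_bounded b; have [uba _] := CV_radius_bounded a.
apply: lubb => r [M hM]; apply: uba; exists M => n.
apply: Rle_trans (hM n); rewrite !Rabs_mult.
by apply: Rmult_le_compat_r; [exact: Rabs_pos | exact: ab].
Qed.

Lemma CV_radius_bounded_coef (a : nat -> R) (C : R) :
  (forall j, Rabs (a j) <= C) -> Rbar_le 1 (CV_radius a).
Proof.
move=> aC; have [uba _] := CV_radius_bounded a.
by apply: uba; exists C => n; rewrite pow1 Rmult_1_r.
Qed.

Lemma lt_CV_radius (a : nat -> R) (r : R) :
  Rbar_le 1 (CV_radius a) -> 0 <= r < 1 -> Rbar_lt (Rabs r) (CV_radius a).
Proof.
move=> a1 r01; apply: Rbar_lt_le_trans a1.
by rewrite /= Rabs_pos_eq; lra.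
Qed.

Lemma ex_pseries_unit (a : nat -> R) (r : R) :
  Rbar_le 1 (CV_radius a) -> 0 <= r < 1 -> ex_pseries a r.
Proof. by move=> a1 r01; apply: CV_radius_inside; exact: lt_CV_radius. Qed.

Lemma PSeries_abs_le (a b : nat -> R) (r : R) : 0 <= r < 1 ->
  Rbar_le 1 (CV_radius b) -> (forall j, Rabs (a j) <= b j) ->
  Rabs (PSeries a r) <= PSeries b r.
Proof.
move=> r01 b1 ab.
have exb : ex_series (fun j => b j * r ^ j).
  by apply/ex_pseries_R; exact: ex_pseries_unit.
have pos j : 0 <= r ^ j by apply: pow_le; lra.
have le j : 0 <= Rabs (a j * r ^ j) <= b j * r ^ j.
  split; first exact: Rabs_pos.
  rewrite Rabs_mult (Rabs_pos_eq _ (pos j)).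
  by apply: Rmult_le_compat_r.
rewrite /PSeries; apply: Rle_trans (Series_le _ _ le exb).
apply: Series_Rabs; apply: ex_series_le exb => j.
by rewrite /norm /= /abs /= Rabs_Rabsolu; have := le j; lra.
Qed.

Definition power_coef (s j : nat) : R := INR j ^ s.

(** Going from j^s to j^(s+1) is differentiation followed by a shift, and both keep the radius of
    convergence. *)
Lemma CV_radius_power_coef s : Rbar_le 1 (CV_radius (power_coef s)).
Proof.
elim: s => [|s IHs].
  by apply: (CV_radius_bounded_coef _ 1) => j; rewrite /power_coef /= Rabs_R1; lra.
rewrite -CV_radius_derive -CV_radius_incr_1 in IHs.
rewrite (CV_radius_ext _ (PS_incr_1 (PS_derive (power_coef s)))) // => -[|j].
  by rewrite /power_coef /= Rmult_0_l.
by rewrite /PS_incr_1 /PS_derive /power_coef.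
Qed.

Lemma CV_radius_scal_power_coef c s : Rbar_le 1 (CV_radius (PS_scal c (power_coef s))).
Proof.
case: (Req_dec c 0) => [->|c0].
  apply: (CV_radius_bounded_coef _ 0) => j.
  by rewrite /PS_scal /scal /= /mult /= Rmult_0_l Rabs_R0; lra.
by rewrite CV_radius_scal //; exact: CV_radius_power_coef.
Qed.

(* [polylog s r] is the polylogarithm of order [-s] at [r], except that the
   convention [0 ^ 0 = 1] adds the term [j = 0] when [s = 0]. *)
Definition polylog (s : nat) (r : R) : R := PSeries (power_coef s) r.

Lemma polylog0 r : 0 <= r < 1 -> polylog 0 r = / (1 - r).
Proof.
move=> r01; rewrite /polylog /PSeries.
rewrite (Series_ext _ (fun j => r ^ j)); last by move=> j; rewrite /power_coef /=; lra.
by apply: is_series_unique; apply: is_series_geom; rewrite Rabs_pos_eq; lra.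
Qed.

Lemma is_derive_polylog s r : 0 < r < 1 ->
  is_derive (polylog s) r (polylog (S s) r / r).
Proof.
move=> r01.
have -> : polylog (S s) r / r = PSeries (PS_derive (power_coef s)) r.
  rewrite /polylog (PSeries_ext _ (PS_incr_1 (PS_derive (power_coef s)))).
    by rewrite PSeries_incr_1; field; lra.
  move=> [|j]; first by rewrite /power_coef /= Rmult_0_l.
  by rewrite /PS_incr_1 /PS_derive /power_coef.
apply: is_derive_PSeries; apply: lt_CV_radius; last lra.
exact: CV_radius_power_coef.
Qed.

Lemma mean_value (f df : R -> R) (a b : R) : a <= b ->
  (forall t, a <= t <= b -> is_derive f t (df t)) ->
  exists t, a <= t <= b /\ f b - f a = df t * (b - a).
Proof.
move=> ab der.
have [||t [ht e]] := MVT_gen f a b df; rewrite ?Rmin_left ?Rmax_right //.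
- by move=> t ht; apply: der; lra.
- move=> t ht; apply: derivable_continuous_pt; exists (df t).
  by apply/is_derive_Reals; exact: der.
by exists t; rewrite Rmin_left // Rmax_right // in ht.
Qed.

(** A mean value substitute for integration: the gain 1 / (n + 1) is given up, so that one constant
    [C] serves along a whole chain of Taylor bounds. *)
Lemma abs_le_of_derive (f df : R -> R) (C : R) (n : nat) (x : R) : 0 <= x -> 0 <= C ->
  (forall t, 0 <= t <= x -> is_derive f t (df t)) -> f 0 = 0 ->
  (forall t, 0 <= t <= x -> Rabs (df t) <= C * t ^ n) -> Rabs (f x) <= C * x ^ S n.
Proof.
move=> x0 C0 der f0 bd; have [t [ht e]] := mean_value f df 0 x x0 der.
rewrite f0 !Rminus_0_r in e; rewrite e Rabs_mult (Rabs_pos_eq x) //=.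
rewrite (Rmult_comm x) -Rmult_assoc; apply: Rmult_le_compat_r => //.
apply: Rle_trans (bd t ht) _.
by apply: Rmult_le_compat_l => //; apply: pow_incr; lra.
Qed.

(** Each bound integrates the preceding one. *)
Lemma cos_sin_taylor (x : R) : 0 <= x ->
  [/\ Rabs (sin x) <= x, Rabs (cos x - 1) <= x ^ 2, Rabs (sin x - x) <= x ^ 3,
      Rabs (cos x - 1 + x ^ 2 / 2) <= x ^ 4 & Rabs (sin x - x + x ^ 3 / 6) <= x ^ 5].
Proof.
move=> x0.
have b1 t : 0 <= t -> Rabs (sin t) <= 1 * t ^ 1.
  move=> t0; apply: (abs_le_of_derive sin cos) => //; try lra.
  - by move=> u _; auto_derive; [|ring].
  - exact: sin_0.
  - by move=> u _; rewrite /= Rmult_1_r; exact: Rabs_cos_le_1.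
have b2 t : 0 <= t -> Rabs (cos t - 1) <= 1 * t ^ 2.
  move=> t0; apply: (abs_le_of_derive (fun t => cos t - 1) (fun t => - sin t)) => //; try lra.
  - by move=> u _; auto_derive; [|ring].
  - by rewrite cos_0; ring.
  - by move=> u [u0 _]; rewrite Rabs_Ropp; exact: b1.
have b3 t : 0 <= t -> Rabs (sin t - t) <= 1 * t ^ 3.
  move=> t0; apply: (abs_le_of_derive (fun t => sin t - t) (fun t => cos t - 1)) => //; try lra.
  - by move=> u _; auto_derive; [|ring].
  - by rewrite sin_0; ring.
  - by move=> u [u0 _]; exact: b2.
have b4 t : 0 <= t -> Rabs (cos t - 1 + t ^ 2 / 2) <= 1 * t ^ 4.
  move=> t0; apply: (abs_le_of_derive (fun t => cos t - 1 + t ^ 2 / 2)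
                       (fun t => - (sin t - t))) => //; try lra.
  - by move=> u _; auto_derive; [|field].
  - by rewrite cos_0; field.
  - by move=> u [u0 _]; rewrite Rabs_Ropp; exact: b3.
have b5 t : 0 <= t -> Rabs (sin t - t + t ^ 3 / 6) <= 1 * t ^ 5.
  move=> t0; apply: (abs_le_of_derive (fun t => sin t - t + t ^ 3 / 6)
                       (fun t => cos t - 1 + t ^ 2 / 2)) => //; try lra.
  - by move=> u _; auto_derive; [|field].
  - by rewrite sin_0; field.
  - by move=> u [u0 _]; exact: b4.
have := (b1 x x0, b2 x x0, b3 x x0, b4 x x0, b5 x x0); rewrite !Rmult_1_l pow_1.
by move=> [[[[? ?] ?] ?] ?].
Qed.

(* With [w = r exp (i y)], [log_mod r y + i * log_arg r y] is the logarithm of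
   [(1 - r) / (1 - w)]; the terms [j = 0] vanish because their numerators do. *)
Definition log_mod (r y : R) : R := PSeries (fun j => (cos (INR j * y) - 1) / INR j) r.
Definition log_arg (r y : R) : R := PSeries (fun j => sin (INR j * y) / INR j) r.

Lemma div_INR_le (a b : R) (j : nat) : 0 <= b ->
  Rabs a <= INR j * b -> Rabs (a / INR j) <= b.
Proof.
(* At j = 0 the quotient is 0, because [/ 0] is 0. *)
move=> b0; case: j => [|j] ab; first by rewrite /= /Rdiv Rinv_0 Rmult_0_r Rabs_R0.
have j0 := INR_S_pos j.
rewrite Rabs_div ?(Rabs_pos_eq (INR _)); [|lra|lra].
by apply: (proj2 (Rle_div_l _ _ _ j0)); lra.
Qed.

Lemma Rabs_div_INR_le (a b : R) (j : nat) : Rabs a <= b -> Rabs (a / INR j) <= b.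
Proof.
move=> ab; have a0 := Rabs_pos a.
case: j => [|j]; first by rewrite /= /Rdiv Rinv_0 Rmult_0_r Rabs_R0; lra.
by apply: div_INR_le; [lra | rewrite S_INR; have := pos_INR j; nra].
Qed.

Lemma CV_radius_log_mod y :
  Rbar_le 1 (CV_radius (fun j => (cos (INR j * y) - 1) / INR j)).
Proof.
apply: (CV_radius_bounded_coef _ 2) => j; apply: Rabs_div_INR_le; apply: Rabs_le.
by have := COS_bound (INR j * y); lra.
Qed.

Lemma CV_radius_log_arg y : Rbar_le 1 (CV_radius (fun j => sin (INR j * y) / INR j)).
Proof.
by apply: (CV_radius_bounded_coef _ 1) => j; apply: Rabs_div_INR_le; exact: Rabs_sin_le_1.
Qed.

(** Taylor's formula is applied to each coefficient: the error (j y)^4 / j leaves j^3, whose series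
    is [polylog 3]. *)
Lemma log_mod_taylor r y : 0 <= r < 1 -> 0 <= y ->
  Rabs (log_mod r y + y ^ 2 / 2 * polylog 1 r) <= y ^ 4 * polylog 3 r.
Proof.
move=> r01 y0; rewrite /log_mod /polylog -!PSeries_scal.
have exs s c : ex_pseries (PS_scal c (power_coef s)) r.
  exact: ex_pseries_unit (CV_radius_scal_power_coef c s) r01.
rewrite -PSeries_plus //; last first.
  exact: ex_pseries_unit (CV_radius_log_mod y) r01.
apply: PSeries_abs_le => //; first exact: CV_radius_scal_power_coef.
move=> j; rewrite /PS_plus /PS_scal /plus /scal /= /mult /= /power_coef.
have j0 := pos_INR j.
have -> : (cos (INR j * y) - 1) / INR j + y * (y * 1) / 2 * INR j ^ 1 =
          (cos (INR j * y) - 1 + (INR j * y) ^ 2 / 2) / INR j.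
  case: j j0 => [|j] j0; first by rewrite /= /Rdiv !Rmult_0_l cos_0; ring.
  by field; exact: not_0_INR.
apply: div_INR_le; first exact: Rmult_le_pos (pow_le y 4 y0) (pow_le _ 3 j0).
have [_ _ _ h _] := cos_sin_taylor (INR j * y) (Rmult_le_pos _ _ j0 y0).
by apply: Rle_trans h _; rewrite /=; lra.
Qed.

(** Again coefficient by coefficient. Subtracting 1 from [polylog 0] removes its term j = 0. *)
Lemma log_arg_taylor r y : 0 <= r < 1 -> 0 <= y ->
  Rabs (log_arg r y - y * (polylog 0 r - 1) + y ^ 3 / 6 * polylog 2 r)
    <= y ^ 5 * polylog 4 r.
Proof.
move=> r01 y0.
have exs s : ex_pseries (power_coef s) r.
  exact: ex_pseries_unit (CV_radius_power_coef s) r01.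
have exs' s c : ex_pseries (PS_scal c (power_coef s)) r.
  by apply: ex_pseries_scal => //; exact: Rmult_comm.
have -> : polylog 0 r - 1 = PSeries (PS_incr_1 (power_coef 0)) r.
  rewrite PSeries_incr_1 -/(polylog 0 r) polylog0 //; field; lra.
have -> : log_arg r y - y * PSeries (PS_incr_1 (power_coef 0)) r =
          log_arg r y + - y * PSeries (PS_incr_1 (power_coef 0)) r by ring.
have exi : ex_pseries (PS_scal (- y) (PS_incr_1 (power_coef 0))) r.
  apply: ex_pseries_scal; first exact: Rmult_comm.
  exact: ex_pseries_incr_1.
have exl : ex_pseries (fun j => sin (INR j * y) / INR j) r.
  exact: ex_pseries_unit (CV_radius_log_arg y) r01.
rewrite /log_arg /polylog -!PSeries_scal -!PSeries_plus //; last exact: ex_pseries_plus.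
apply: PSeries_abs_le => //; first exact: CV_radius_scal_power_coef.
move=> j; rewrite /PS_plus /PS_scal /plus /scal /= /mult /= /power_coef.
have j0 := pos_INR j.
have -> : sin (INR j * y) / INR j + - y * PS_incr_1 (power_coef 0) j +
     y * (y * (y * 1)) / 6 * INR j ^ 2 =
          (sin (INR j * y) - INR j * y + (INR j * y) ^ 3 / 6) / INR j.
  case: j j0 => [|j] j0.
    by rewrite /PS_incr_1 /zero /= /Rdiv !Rmult_0_l sin_0; ring.
  by rewrite /PS_incr_1 /power_coef; field; exact: not_0_INR.
apply: div_INR_le; first exact: Rmult_le_pos (pow_le y 5 y0) (pow_le _ 4 j0).
have [_ _ _ _ h] := cos_sin_taylor (INR j * y) (Rmult_le_pos _ _ j0 y0).
by apply: Rle_trans h _; rewrite /=; lra.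
Qed.

Lemma log_mod_le r y : 0 <= r < 1 -> log_mod r y <= r * (cos y - 1).
Proof.
move=> r01; rewrite /log_mod.
set a := fun j => _.
have exa : ex_series (fun j => a j * r ^ j).
  by apply/ex_pseries_R; exact: ex_pseries_unit (CV_radius_log_mod y) r01.
rewrite /PSeries Series_incr_1 // Series_incr_1; last by have := proj1 (ex_series_incr_1 _) exa.
have a0 : a 0%N = 0 by rewrite /a /= Rmult_0_l cos_0 /Rdiv; ring.
have a1 : a 1%N = cos y - 1 by rewrite /a /= Rmult_1_l; field.
rewrite a0 a1.
have neg j : a j <= 0.
  rewrite /a; case: j => [|j]; first by rewrite -/(a 0%N) a0; lra.
  have j0 : 0 < INR (S j) by exact: INR_S_pos j.
  have := COS_bound (INR (S j) * y) => -[_ c1].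
  apply: (Rmult_le_reg_l (INR (S j))) => //; field_simplify; lra.
have : 0 <= Series (fun j => - (a j.+2 * r ^ j.+2)).
  apply: Series_nonneg => [j|].
    have := pow_le r (j.+2) (proj1 r01); have := neg j.+2; nra.
  apply: ex_series_opp.
  exact: (proj1 (ex_series_incr_n (fun j => a j * r ^ j) 2) exa).
rewrite Series_opp /= => h; nra.
Qed.

Lemma log_mod_le_0 r y : 0 <= r < 1 -> log_mod r y <= 0.
Proof. move=> r01; have := log_mod_le r y r01; have := COS_bound y; nra. Qed.

Lemma eq_of_derive_0 (f : R -> R) (x : R) : 0 <= x ->
  (forall t, 0 <= t <= x -> is_derive f t 0) -> f x = f 0.
Proof. by move=> x0 der; have [t [_ e]] := mean_value f (fun _ => 0) 0 x x0 der; lra. Qed.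

(** With e = exp(i y), P + i q is the geometric series e / (1 - t e). The last two equations are the
    real and imaginary parts of (P + i q)(1 - t e) = e. *)
Lemma log_mod_arg_derive t y : 0 <= t < 1 -> exists P q,
  [/\ is_derive (fun r => log_mod r y) t (P - / (1 - t)),
      is_derive (fun r => log_arg r y) t q,
      P - t * (cos y * P - sin y * q) = cos y &
      q - t * (sin y * P + cos y * q) = sin y].
Proof.
move=> t01.
pose a j := cos (INR (S j) * y); pose b j := sin (INR (S j) * y).
have ra : Rbar_le 1 (CV_radius a).
  apply: (CV_radius_bounded_coef _ 1) => j; exact: Rabs_cos_le_1.
have rb : Rbar_le 1 (CV_radius b).
  apply: (CV_radius_bounded_coef _ 1) => j; exact: Rabs_sin_le_1.
have ea := ex_pseries_unit _ _ ra t01.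
have eb := ex_pseries_unit _ _ rb t01.
have e0 := ex_pseries_unit _ _ (CV_radius_power_coef 0) t01.
exists (PSeries a t), (PSeries b t); split.
- rewrite -polylog0 // /polylog -PSeries_minus //.
  rewrite (PSeries_ext _ (PS_derive (fun j => (cos (INR j * y) - 1) / INR j))).
    by apply: is_derive_PSeries; apply: lt_CV_radius => //; exact: CV_radius_log_mod.
  move=> j.
  change (cos (INR j.+1 * y) + - 1 = INR j.+1 * ((cos (INR j.+1 * y) - 1) / INR j.+1)).
  by field; exact: not_0_INR.
- rewrite (PSeries_ext _ (PS_derive (fun j => sin (INR j * y) / INR j))).
    by apply: is_derive_PSeries; apply: lt_CV_radius => //; exact: CV_radius_log_arg.
  by move=> j; rewrite /PS_derive /b; field; exact: not_0_INR.
- rewrite {1}(PSeries_decr_1 _ _ ea).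
  have -> : PSeries (PS_decr_1 a) t = cos y * PSeries a t - sin y * PSeries b t.
    rewrite -!PSeries_scal -PSeries_minus; first last.
    + by apply: ex_pseries_scal => //; exact: Rmult_comm.
    + by apply: ex_pseries_scal => //; exact: Rmult_comm.
    apply: PSeries_ext => j.
    rewrite /PS_minus /PS_plus /PS_opp /PS_scal /plus /opp /scal /=.
    rewrite /mult /= /PS_decr_1 /a /b (S_INR j.+1).
    by rewrite Rmult_plus_distr_r Rmult_1_l cos_plus; ring.
  by rewrite {1}/a /= Rmult_1_l; ring.
- rewrite {1}(PSeries_decr_1 _ _ eb).
  have -> : PSeries (PS_decr_1 b) t = sin y * PSeries a t + cos y * PSeries b t.
    rewrite -!PSeries_scal -PSeries_plus; first last.
    + by apply: ex_pseries_scal => //; exact: Rmult_comm.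
    + by apply: ex_pseries_scal => //; exact: Rmult_comm.
    apply: PSeries_ext => j.
    rewrite /PS_plus /PS_scal /plus /scal /=.
    rewrite /mult /= /PS_decr_1 /a /b (S_INR j.+1).
    by rewrite Rmult_plus_distr_r Rmult_1_l sin_plus; ring.
  by rewrite {1}/b /= Rmult_1_l; ring.
Qed.

(* The left-hand sides are constant in [r] after division by [1 - r]. *)
Lemma exp_log_mod_arg r y : 0 <= r < 1 ->
  let U := exp (log_mod r y) * cos (log_arg r y) in
  let V := exp (log_mod r y) * sin (log_arg r y) in
  U * (1 - r * cos y) + V * (r * sin y) = 1 - r /\
  V * (1 - r * cos y) - U * (r * sin y) = 0.
Proof.
move=> r01 U V.
have m0 : log_mod 0 y = 0 by rewrite /log_mod PSeries_0 /= Rmult_0_l cos_0 /Rdiv; ring.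
have a0 : log_arg 0 y = 0 by rewrite /log_arg PSeries_0 /= Rmult_0_l sin_0 /Rdiv; ring.
pose X t := (exp (log_mod t y) * cos (log_arg t y) * (1 - t * cos y) +
             exp (log_mod t y) * sin (log_arg t y) * (t * sin y)) / (1 - t).
pose Y t := (exp (log_mod t y) * sin (log_arg t y) * (1 - t * cos y) -
             exp (log_mod t y) * cos (log_arg t y) * (t * sin y)) / (1 - t).
have ders t : 0 <= t <= r -> is_derive X t 0 /\ is_derive Y t 0.
  move=> ht; have [|P [q [dm da e1 e2]]] := log_mod_arg_derive t y; first lra.
  have em : ex_derive (fun r => log_mod r y) t by exists (P - / (1 - t)).
  have ea : ex_derive (fun r => log_arg r y) t by exists q.
  have t1 : 1 + - t <> 0 by lra.
  split; [rewrite /X | rewrite /Y]; auto_derive => //;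
    rewrite (is_derive_unique _ _ _ dm) (is_derive_unique _ _ _ da);
    set E := exp _; set c := cos (log_arg _ _); set s := sin (log_arg _ _).
  - transitivity (E * (c * (P - t * (cos y * P - sin y * q) - cos y) +
                       s * (sin y - (q - t * (sin y * P + cos y * q)))) / (1 - t)).
      by field; lra.
    by rewrite e1 e2 /Rdiv; ring.
  - transitivity (E * (s * (P - t * (cos y * P - sin y * q) - cos y) +
                       c * ((q - t * (sin y * P + cos y * q)) - sin y)) / (1 - t)).
      by field; lra.
    by rewrite e1 e2 /Rdiv; ring.
have XE : X r = X 0 by apply: eq_of_derive_0 => [|t /ders []//]; lra.
have YE : Y r = Y 0 by apply: eq_of_derive_0 => [|t /ders []//]; lra.
rewrite /X /Y m0 a0 exp_0 cos_0 sin_0 in XE YE.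
split.
- have -> : 1 - r = (1 * 1 * (1 - 0 * cos y) + 1 * 0 * (0 * sin y)) / (1 - 0) * (1 - r).
    by field.
  by rewrite -XE /U /V; field; lra.
- have -> : 0 = (1 * 0 * (1 - 0 * cos y) - 1 * 1 * (0 * sin y)) / (1 - 0) * (1 - r).
    by field.
  by rewrite -YE /U /V; field; lra.
Qed.

(** * Lipschitz bounds and continuity in the angle *)

Lemma Rabs_sub_le_of_derive (f df : R -> R) (C a b : R) :
  (forall t, Rmin a b <= t <= Rmax a b -> is_derive f t (df t)) ->
  (forall t, Rmin a b <= t <= Rmax a b -> Rabs (df t) <= C) ->
  Rabs (f b - f a) <= C * Rabs (b - a).
Proof.
move=> der bd.
have [||t [ht ->]] := MVT_gen f a b df; [by move=> t ht; apply: der; lra | |].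
  move=> t ht; apply: derivable_continuous_pt; exists (df t).
  by apply/is_derive_Reals; exact: der.
rewrite Rabs_mult; apply: Rmult_le_compat_r; [exact: Rabs_pos | exact: bd].
Qed.

Lemma Rabs_cos_sub_le a b : Rabs (cos a - cos b) <= Rabs (a - b).
Proof.
rewrite -(Rmult_1_l (Rabs (a - b))).
apply: (Rabs_sub_le_of_derive cos (fun t => - sin t)) => t _.
  by auto_derive; [|ring].
by rewrite Rabs_Ropp; exact: Rabs_sin_le_1.
Qed.

Lemma Rabs_sin_sub_le a b : Rabs (sin a - sin b) <= Rabs (a - b).
Proof.
rewrite -(Rmult_1_l (Rabs (a - b))).
apply: (Rabs_sub_le_of_derive sin cos) => t _.
  by auto_derive; [|ring].
by exact: Rabs_cos_le_1.
Qed.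

Lemma continuous_Rplus (f g : R -> R) x :
  continuous f x -> continuous g x -> continuous (fun y => f y + g y) x.
Proof. exact: (continuous_plus (V := R_NormedModule)). Qed.

Lemma continuous_Rminus (f g : R -> R) x :
  continuous f x -> continuous g x -> continuous (fun y => f y - g y) x.
Proof. exact: (continuous_minus (V := R_NormedModule)). Qed.

Lemma continuous_Rmult (f g : R -> R) x :
  continuous f x -> continuous g x -> continuous (fun y => f y * g y) x.
Proof. exact: (continuous_mult (K := R_AbsRing)). Qed.

Lemma continuous_lipschitz (f : R -> R) (C x : R) : 0 < C ->
  (forall y, Rabs (f y - f x) <= C * Rabs (y - x)) -> continuous f x.
Proof.
move=> C0 lip; apply/continuity_pt_filterlim => e e0.
exists (e / C); split; first exact: Rdiv_lt_0_compat.
move=> y [_ hy]; rewrite /dist /= /R_dist in hy *.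
apply: Rle_lt_trans (lip y) _.
apply: Rlt_le_trans (Rmult_lt_compat_l _ _ _ C0 hy) _.
by right; field; lra.
Qed.

Lemma PSeries_sub_le (a b : nat -> R) (r C : R) : 0 <= r < 1 ->
  Rbar_le 1 (CV_radius a) -> Rbar_le 1 (CV_radius b) ->
  (forall j, Rabs (a j - b j) <= C) -> Rabs (PSeries a r - PSeries b r) <= C / (1 - r).
Proof.
move=> r01 ra rb ab.
have ea := ex_pseries_unit _ _ ra r01.
have eb := ex_pseries_unit _ _ rb r01.
rewrite -PSeries_minus // /Rdiv -polylog0 // -PSeries_scal.
apply: PSeries_abs_le => //.
  apply: (CV_radius_bounded_coef _ (Rabs C)) => j.
  by rewrite /PS_scal /scal /= /mult /= /power_coef /= Rmult_1_r; lra.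
move=> j; apply: Rle_trans (ab j) _.
by rewrite /PS_scal /scal /= /mult /= /power_coef /= Rmult_1_r; lra.
Qed.

(** The denominator j cancels the Lipschitz constant j of cos(j y), so 1 / (1 - r), the sum of the
    r^j, is a Lipschitz constant for the series. *)
Lemma continuous_log_mod r y : 0 <= r < 1 -> continuous (log_mod r) y.
Proof.
move=> r01; apply: (continuous_lipschitz _ (/ (1 - r))) => [|z].
  by apply: Rinv_0_lt_compat; lra.
rewrite Rmult_comm; apply: PSeries_sub_le => //; try exact: CV_radius_log_mod.
move=> j; have -> : (cos (INR j * z) - 1) / INR j - (cos (INR j * y) - 1) / INR j =
  (cos (INR j * z) - cos (INR j * y)) / INR j by rewrite /Rdiv; ring.
apply: div_INR_le; first exact: Rabs_pos.
apply: Rle_trans (Rabs_cos_sub_le _ _) _.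
rewrite -Rmult_minus_distr_l Rabs_mult (Rabs_pos_eq (INR j)); [lra | exact: pos_INR].
Qed.

Lemma continuous_log_arg r y : 0 <= r < 1 -> continuous (log_arg r) y.
Proof.
move=> r01; apply: (continuous_lipschitz _ (/ (1 - r))) => [|z].
  by apply: Rinv_0_lt_compat; lra.
rewrite Rmult_comm; apply: PSeries_sub_le => //; try exact: CV_radius_log_arg.
move=> j; have -> : sin (INR j * z) / INR j - sin (INR j * y) / INR j =
  (sin (INR j * z) - sin (INR j * y)) / INR j by rewrite /Rdiv; ring.
apply: div_INR_le; first exact: Rabs_pos.
apply: Rle_trans (Rabs_sin_sub_le _ _) _.
rewrite -Rmult_minus_distr_l Rabs_mult (Rabs_pos_eq (INR j)); [lra | exact: pos_INR].
Qed.

(** * Fourier inversion *)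

Lemma INR_expn (m k : nat) : INR (m ^ k)%N = INR m ^ k.
Proof. by elim: k => [|k IHk] //; rewrite expnS -multE mult_INR IHk. Qed.

Lemma exp_pow (v : R) (n : nat) : exp v ^ n = exp (INR n * v).
Proof.
elim: n => [|n IHn]; first by rewrite /= Rmult_0_l exp_0.
by rewrite /pow -/(pow _ n) IHn -exp_plus S_INR; congr exp; ring.
Qed.

Lemma exp_neg_lt_1 (v : R) : 0 < v -> 0 < exp (- v) < 1.
Proof.
move=> v0; split; first exact: exp_pos.
by rewrite -exp_0; apply: exp_increasing; lra.
Qed.

Definition part_rate (k : nat) (x : R) (m : nat) : R := exp (- (x * INR m ^ k)).

(* [log_weight k x M theta] and [phase k x M theta] are the real and imaginary
   parts of [log (F (x - i theta) / F x)], where [F z] is the product over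
   [m <= M] of [1 / (1 - exp (- z m^k))]. *)
Definition log_weight (k : nat) (x : R) (M : nat) (theta : R) : R :=
  psum (fun m => log_mod (part_rate k x m) (INR m ^ k * theta)) M.
Definition phase (k : nat) (x : R) (M : nat) (theta : R) : R :=
  psum (fun m => log_arg (part_rate k x m) (INR m ^ k * theta)) M.
(** This is F x, in exponential form so that a new factor is a new summand. *)
Definition gen_product (k : nat) (x : R) (M : nat) : R :=
  exp (psum (fun m => - ln (1 - part_rate k x m)) M).

Lemma part_rate_lt_1 k x m : 0 < x -> 0 <= part_rate k x (S m) < 1.
Proof.
move=> x0; have := exp_neg_lt_1 (x * INR (S m) ^ k); rewrite /part_rate => h.
suff : 0 < x * INR (S m) ^ k by move=> /h; lra.
by apply: Rmult_lt_0_compat => //; apply: pow_lt; exact: INR_S_pos m.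
Qed.

Lemma log_weight_le_0 k x M theta : 0 < x -> log_weight k x M theta <= 0.
Proof.
move=> x0; apply: Rle_trans (psum_le _ (fun _ => 0) _ _) _ => [m|].
  by apply: log_mod_le_0; exact: part_rate_lt_1.
by elim: M => /= [|M IH]; lra.
Qed.

Lemma continuous_psum (f : nat -> R -> R) M y :
  (forall m, continuous (f (S m)) y) -> continuous (fun y => psum (fun m => f m y) M) y.
Proof.
move=> cf; elim: M => /= [|M IH]; first exact: continuous_const.
by apply: continuous_Rplus.
Qed.

Lemma continuous_scale (f : R -> R) a y :
  continuous f (a * y) -> continuous (fun y => f (a * y)) y.
Proof.
move=> cf; apply: (continuous_comp (fun y => a * y) f) => //.
by apply: (ex_derive_continuous (fun y => a * y)); auto_derive.
Qed.

Lemma continuous_log_weight k x M y : 0 < x -> continuous (log_weight k x M) y.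
Proof.
move=> x0; apply: (continuous_psum
  (fun m theta => log_mod (part_rate k x m) (INR m ^ k * theta))) => m.
by apply: continuous_scale; apply: continuous_log_mod; exact: part_rate_lt_1.
Qed.

Lemma continuous_phase k x M y : 0 < x -> continuous (phase k x M) y.
Proof.
move=> x0; apply: (continuous_psum
  (fun m theta => log_arg (part_rate k x m) (INR m ^ k * theta))) => m.
by apply: continuous_scale; apply: continuous_log_arg; exact: part_rate_lt_1.
Qed.

Lemma continuous_cos_comp (f : R -> R) y :
  continuous f y -> continuous (fun y => cos (f y)) y.
Proof. by move=> cf; apply: (continuous_comp f cos) => //; exact: continuous_cos. Qed.

Lemma continuous_sin_comp (f : R -> R) y :
  continuous f y -> continuous (fun y => sin (f y)) y.
Proof. by move=> cf; apply: (continuous_comp f sin) => //; exact: continuous_sin. Qed.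

Lemma continuous_exp_comp (f : R -> R) y :
  continuous f y -> continuous (fun y => exp (f y)) y.
Proof. by move=> cf; apply: (continuous_comp f exp) => //; exact: continuous_exp. Qed.

Lemma ex_RInt_of_continuous (f : R -> R) a b : (forall y, continuous f y) -> ex_RInt f a b.
Proof. by move=> cf; apply: (ex_RInt_continuous (V := R_CompleteNormedModule)). Qed.

Definition fourier_integrand (k : nat) (x : R) (M : nat) (n : R) (theta : R) : R :=
  exp (log_weight k x M theta) * cos (phase k x M theta - n * theta).

Lemma continuous_fourier_integrand k x M n y : 0 < x ->
  continuous (fourier_integrand k x M n) y.
Proof.
move=> x0; apply: continuous_Rmult.
  by apply: continuous_exp_comp; exact: continuous_log_weight.
apply: continuous_cos_comp; apply: continuous_Rminus.
  exact: continuous_phase.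
by apply: (ex_derive_continuous (fun y => n * y)); auto_derive.
Qed.

(** The usual mean over [-PI, PI] of F(x - i theta) exp(n (x - i theta)), up to notation. The real
    part is even in theta and the imaginary part odd, so [0, PI] suffices and everything stays
    real. *)
Definition fourier_coef (k : nat) (x : R) (M : nat) (n : Z) : R :=
  gen_product k x M * exp (IZR n * x) / PI *
  RInt (fourier_integrand k x M (IZR n)) 0 PI.

(** Let w = exp(- z b), where b is the new k-th power. Multiplying the product over M + 1 bases by 1
    - w gives the one over M bases, and the factor w shifts the frequency by b. *)
Lemma fourier_coef_rec k x M n : 0 < x ->
  fourier_coef k x M.+1 n =
  fourier_coef k x M n + fourier_coef k x M.+1 (n - Z.of_nat (M.+1 ^ k)%N).
Proof.
move=> x0; rewrite /fourier_coef minus_IZR -INR_IZR_INZ INR_expn.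
set b := INR M.+1 ^ k.
have r01 := part_rate_lt_1 k x M x0.
have rE : part_rate k x M.+1 = exp (- (x * b)) by [].
set r := part_rate k x M.+1 in r01 rE.
have -> : gen_product k x M.+1 = gen_product k x M / (1 - r).
  rewrite /gen_product /= exp_plus exp_Ropp exp_ln; last by rewrite -/r; lra.
  by rewrite -/r.
have -> : exp ((IZR n - b) * x) = exp (IZR n * x) * r.
  by rewrite rE -exp_plus; congr exp; ring.
set I1 := RInt (fourier_integrand k x M _) _ _.
set J1 := RInt _ _ _; set J2 := RInt _ _ _.
suff : J1 = (1 - r) * I1 + r * J2.
  by move=> ->; have pi0 := PI_RGT_0; field; lra.
have ex M' n' : ex_RInt (fourier_integrand k x M' n') 0 PI.
  by apply: ex_RInt_of_continuous => y; exact: continuous_fourier_integrand.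
apply: is_RInt_unique.
have h1 := is_RInt_scal _ _ _ (1 - r) _ (RInt_correct _ _ _ (ex M (IZR n))).
have h2 := is_RInt_scal _ _ _ r _ (RInt_correct _ _ _ (ex M.+1 (IZR n - b))).
apply: is_RInt_ext (is_RInt_plus _ _ _ _ _ _ h1 h2) => t _.
rewrite /plus /scal /= /mult /= /fourier_integrand /log_weight /phase /=.
rewrite -/(log_weight k x M t) -/(phase k x M t) -/r -/b exp_plus.
have [] := exp_log_mod_arg r (b * t) r01.
set U := exp (log_mod _ _); set a := log_arg _ _ => e1 e2.
set E := exp _; set X := phase k x M t - IZR n * t.
have -> : phase k x M t + a - IZR n * t = X + a by rewrite /X; ring.
have -> : phase k x M t + a - (IZR n - b) * t = X + b * t + a by rewrite /X; ring.
clearbody X; apply: Rminus_diag_uniq; rewrite !cos_plus sin_plus.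
(* The difference of both sides combines the two components of (U' + i V')(1 - w) = 1 - r, where U'
   + i V' is U exp(i a), with coefficients E cos X and E sin X. *)
transitivity (E * cos X * (1 - r - (U * cos a * (1 - r * cos (b * t)) +
    U * sin a * (r * sin (b * t)))) + E * sin X * (U * sin a * (1 - r * cos (b * t)) -
    U * cos a * (r * sin (b * t)))); first by ring.
by rewrite e1 e2; ring.
Qed.

Lemma Rabs_fourier_coef_le k x M n : 0 < x ->
  Rabs (fourier_coef k x M n) <= gen_product k x M * exp (IZR n * x).
Proof.
move=> x0; have pi0 := PI_RGT_0.
have g0 : 0 < gen_product k x M by exact: exp_pos.
have e0 := exp_pos (IZR n * x).
rewrite /fourier_coef Rabs_mult Rabs_pos_eq; last first.
  by apply: Rlt_le; apply: Rdiv_lt_0_compat => //; exact: Rmult_lt_0_compat.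
rewrite [X in _ <= X](_ : _ =
  gen_product k x M * exp (IZR n * x) / PI * ((PI - 0) * 1)); last by field; lra.
apply: Rmult_le_compat_l.
  by apply: Rlt_le; apply: Rdiv_lt_0_compat => //; exact: Rmult_lt_0_compat.
apply: abs_RInt_le_const; first lra.
  by apply: ex_RInt_of_continuous => y; exact: continuous_fourier_integrand.
move=> t _; rewrite /fourier_integrand Rabs_mult (Rabs_pos_eq (exp _)); last first.
  exact: Rlt_le (exp_pos _).
have h1 : exp (log_weight k x M t) <= 1.
  rewrite -exp_0; have [h|->] := log_weight_le_0 k x M t x0; last lra.
  by apply: Rlt_le; exact: exp_increasing.
have h2 := exp_pos (log_weight k x M t).
have h3 : Rabs (cos (phase k x M t - IZR n * t)) <= 1.
  by exact: Rabs_cos_le_1.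
have h4 := Rabs_pos (cos (phase k x M t - IZR n * t)); nra.
Qed.

Lemma sin_IZR_PI n : sin (IZR n * PI) = 0.
Proof. by apply: sin_eq_0_1; exists n. Qed.

(** With an empty product, what remains is the integral of cos(n theta) over [0, PI]: the only
    orthogonality relation in the argument. *)
Lemma fourier_coef0 k x n : fourier_coef k x 0 n = if (n =? 0)%Z then 1 else 0.
Proof.
have pi0 := PI_RGT_0.
rewrite /fourier_coef /gen_product /= exp_0; case: Z.eqb_spec => [->|n0].
  rewrite (RInt_ext _ (fun _ => 1)).
    by rewrite RInt_const /scal /= /mult /= Rmult_0_l exp_0; field; lra.
  by move=> t _; rewrite /fourier_integrand /= exp_0 Rmult_0_l Rminus_diag cos_0; ring.
have n0' : IZR n <> 0 by move/eq_IZR.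
suff -> : RInt (fourier_integrand k x 0 (IZR n)) 0 PI = 0 by ring.
apply: is_RInt_unique.
rewrite [X in is_RInt _ _ _ X](_ : _ =
    minus (sin (IZR n * PI) / IZR n) (sin (IZR n * 0) / IZR n)); last first.
  by rewrite sin_IZR_PI Rmult_0_r sin_0 /minus /plus /opp /=; field.
apply: (is_RInt_ext (fun t => cos (IZR n * t))).
  move=> t _; rewrite /fourier_integrand /= exp_0 Rmult_1_l Rminus_0_l.
  by rewrite cos_neg.
apply: (is_RInt_derive (fun t => sin (IZR n * t) / IZR n) (fun t => cos (IZR n * t))) => t _.
  by auto_derive; [|field].
by apply: (ex_derive_continuous (fun t => cos (IZR n * t))); auto_derive.
Qed.

(** By the recurrence and induction on [M], the coefficient at a negative [n] equals those at n - j
    b for every j. The trivial bound decays geometrically in j, so the common value is 0. *)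
Lemma fourier_coef_neg k x M n : 0 < x -> (n < 0)%Z -> fourier_coef k x M n = 0.
Proof.
move=> x0; elim: M n => [|M IHM] n n0.
  by rewrite fourier_coef0; case: Z.eqb_spec => // e; lia.
set b := Z.of_nat (M.+1 ^ k)%N.
have b0 : (0 < b)%Z.
  have : (0 < M.+1 ^ k)%N by rewrite expn_gt0.
  by move/ltP; rewrite /b; lia.
have shift j : fourier_coef k x M.+1 n = fourier_coef k x M.+1 (n - Z.of_nat j * b).
  elim: j => [|j ->]; first by congr fourier_coef; lia.
  rewrite fourier_coef_rec // IHM; last by nia.
  by rewrite Rplus_0_l; congr fourier_coef; rewrite -/b; lia.
apply: Rabs_eq_0; apply: Rle_antisym; last exact: Rabs_pos.
apply: Rnot_lt_le => pos.
have b0' := IZR_lt _ _ b0.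
set G := gen_product k x M.+1 * exp (IZR n * x).
have G0 : 0 < G by apply: Rmult_lt_0_compat; exact: exp_pos.
have [e0 e1] := exp_neg_lt_1 (IZR b * x) ltac:(nra).
have [|N hN] := pow_lt_1_zero (exp (- (IZR b * x))) _
    (Rabs (fourier_coef k x M.+1 n) / G) (Rdiv_lt_0_compat _ _ pos G0).
  by rewrite Rabs_pos_eq; lra.
have := hN N (Nat.le_refl N); rewrite Rabs_pos_eq; last by apply: pow_le; lra.
have := Rabs_fourier_coef_le k x M.+1 (n - Z.of_nat N * b) x0; rewrite -shift.
rewrite minus_IZR mult_IZR -INR_IZR_INZ.
have -> : exp ((IZR n - INR N * IZR b) * x) =
          exp (IZR n * x) * exp (- (IZR b * x)) ^ N.
  by rewrite exp_pow -exp_plus; congr exp; ring.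
rewrite -Rmult_assoc -/G => h1 h2.
have : G * exp (- (IZR b * x)) ^ N < G * (Rabs (fourier_coef k x M.+1 n) / G).
  exact: Rmult_lt_compat_l.
have -> : G * (Rabs (fourier_coef k x M.+1 n) / G) = Rabs (fourier_coef k x M.+1 n).
  by field; lra.
lra.
Qed.

Lemma power_partitions_fourier k x M n : (0 < k)%N -> 0 < x -> (n <= Z.of_nat M)%Z ->
  INR (power_partitions k n) = fourier_coef k x M n.
Proof.
move=> k0 x0; apply: power_partitions_unique => //.
- exact: fourier_coef0.
- by move=> M' n' n0; exact: fourier_coef_neg.
- by move=> M' n'; exact: fourier_coef_rec.
Qed.

(** * Regularity of v / (exp v - 1) *)

Lemma pow_le_exp (s : nat) (y : R) : 0 <= y -> y ^ s <= INR (fact s) * exp y.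
Proof.
move=> y0; have f0 := INR_fact_lt_0 s.
have h : y ^ s / INR (fact s) <= exp y.
  apply: Rle_trans (exp_ge_taylor y s y0).
  have t0 j : 0 <= y ^ j / INR (fact j).
    by apply: Rle_mult_inv_pos; [exact: pow_le | exact: INR_fact_lt_0].
  case: s f0 => [|s] f0; first by rewrite /=; lra.
  rewrite tech5; have := cond_pos_sum (fun j => y ^ j / INR (fact j)) s t0; lra.
have -> : y ^ s = INR (fact s) * (y ^ s / INR (fact s)) by field; lra.
by apply: Rmult_le_compat_l => //; lra.
Qed.

(* [exp_den i] is the [i]-th derivative of [(exp v - 1) / v], i.e. the integral
   of [s^i exp (s v)] over [0 <= s <= 1]. *)
Definition exp_den_coef (i j : nat) : R := / (INR (fact j) * (INR j + INR i + 1)).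
Definition exp_den (i : nat) (v : R) : R := PSeries (exp_den_coef i) v.

Lemma exp_den_coef_pos i j : 0 < exp_den_coef i j.
Proof.
apply: Rinv_0_lt_compat; apply: Rmult_lt_0_compat; first exact: INR_fact_lt_0.
have := pos_INR i; have := pos_INR j; lra.
Qed.

Lemma CV_radius_exp_den i : CV_radius (exp_den_coef i) = p_infty.
Proof.
have inf : CV_radius (fun j => / INR (fact j)) = p_infty.
  apply: CV_radius_infinite_DAlembert => [n|].
    by apply: Rinv_neq_0_compat; exact: INR_fact_neq_0.
  apply: (is_lim_seq_ext (fun n => / INR n.+1)).
    move=> n; rewrite Rabs_pos_eq.
      rewrite fact_simpl mult_INR; field.
      by split; first [exact: INR_fact_neq_0 | exact: not_0_INR].
    apply: Rle_mult_inv_pos; last by apply: Rinv_0_lt_compat; exact: INR_fact_lt_0.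
    by apply: Rlt_le; apply: Rinv_0_lt_compat; exact: INR_fact_lt_0.
  have := is_lim_seq_incr_1 (fun n => / INR n) 0; move=> [h _]; apply: h.
  have -> : Finite 0 = Rbar_inv p_infty by [].
  by apply: is_lim_seq_inv => //; exact: is_lim_seq_INR.
have dom : Rbar_le p_infty (CV_radius (exp_den_coef i)).
  rewrite -inf; apply: CV_radius_dominated => j.
  have f0 : 0 < / INR (fact j) by apply: Rinv_0_lt_compat; exact: INR_fact_lt_0.
  rewrite !Rabs_pos_eq; [|lra|exact: Rlt_le (exp_den_coef_pos i j)].
  rewrite /exp_den_coef Rinv_mult -[X in _ <= X]Rmult_1_r.
  apply: Rmult_le_compat_l; first lra.
  rewrite -Rinv_1; apply: Rinv_le_contravar; first lra.
  have := pos_INR i; have := pos_INR j; lra.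
by case: (CV_radius _) dom.
Qed.

Lemma is_derive_exp_den i v : is_derive (exp_den i) v (exp_den (S i) v).
Proof.
rewrite /exp_den (PSeries_ext (exp_den_coef (S i)) (PS_derive (exp_den_coef i))).
  by apply: is_derive_PSeries; rewrite CV_radius_exp_den.
move=> j; rewrite /PS_derive /exp_den_coef fact_simpl mult_INR !S_INR.
have := pos_INR i; have := pos_INR j => ? ?; field.
by repeat split; try exact: INR_fact_neq_0; lra.
Qed.

Lemma mul_exp_den0 v : v * exp_den 0 v = exp v - 1.
Proof.
have ex : ex_pseries (fun j => / INR (fact j)) v.
  by exists (exp v); exact: is_exp_Reals.
rewrite exp_Reals (PSeries_decr_1 _ _ ex) /= Rinv_1 /exp_den.
rewrite (PSeries_ext (exp_den_coef 0) (PS_decr_1 (fun j => / INR (fact j)))); first by ring.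
move=> j; rewrite /PS_decr_1 /exp_den_coef fact_simpl mult_INR S_INR /=.
have := pos_INR j => ?; field; split; [exact: INR_fact_neq_0 | lra].
Qed.

Lemma ex_series_exp_den i v : ex_series (fun j => exp_den_coef i j * v ^ j).
Proof.
by apply/ex_pseries_R; apply: CV_radius_inside; rewrite CV_radius_exp_den.
Qed.

Lemma exp_den_S_bound i v : 0 <= v -> 0 <= exp_den (S i) v <= exp_den i v.
Proof.
move=> v0; have vj j : 0 <= v ^ j by exact: pow_le.
have pos n j : 0 <= exp_den_coef n j * v ^ j.
  by apply: Rmult_le_pos => //; apply: Rlt_le; exact: exp_den_coef_pos.
split.
  by apply: Series_nonneg => //; exact: ex_series_exp_den.
apply: Series_le; last exact: ex_series_exp_den.
move=> j; split; first exact: pos.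
apply: Rmult_le_compat_r => //; rewrite /exp_den_coef S_INR.
have := pos_INR i; have := pos_INR j => ? ?; have := INR_fact_lt_0 j => ?.
apply: Rinv_le_contravar; first by apply: Rmult_lt_0_compat; lra.
by apply: Rmult_le_compat_l; lra.
Qed.

(** The constant is 121 = 1 + 120: the value is at least 1 and also at least v^4 / 120, from the
    term of degree 5 of exp. Fourth-power decay in v = u^k is enough to absorb every factor u^(3k-1)
    met below and leave an integrable 1 / (1 + u^2). *)
Lemma exp_den0_ge v : 0 <= v -> (1 + v ^ 4) / 121 <= exp_den 0 v /\ 1 <= exp_den 0 v.
Proof.
move=> v0.
have [v0'|<-] := v0; last first.
  rewrite /exp_den PSeries_0 /exp_den_coef /=; lra.
have e := mul_exp_den0 v.
have h1 : 1 <= exp_den 0 v.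
  apply: (Rmult_le_reg_l v) => //; rewrite e; have := exp_ineq1_le v; lra.
split; last by [].
suff : v ^ 4 / 120 <= exp_den 0 v by lra.
apply: (Rmult_le_reg_l v) => //; rewrite e.
have := exp_ge_taylor v 5 v0; rewrite /=.
have := pow_le v 2 v0; have := pow_le v 3 v0; have := pow_le v 4 v0; rewrite /=; lra.
Qed.

(** The generating function v / (exp v - 1) of the Bernoulli numbers. As the reciprocal of a power
    series it has no singularity at 0, where Riemann sums need it. *)
Definition bern (v : R) : R := / exp_den 0 v.
Definition bern1 (v : R) : R := - exp_den 1 v / exp_den 0 v ^ 2.
Definition bern2 (v : R) : R :=
  2 * exp_den 1 v ^ 2 / exp_den 0 v ^ 3 - exp_den 2 v / exp_den 0 v ^ 2.
Definition bern3 (v : R) : R :=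
  6 * exp_den 1 v * exp_den 2 v / exp_den 0 v ^ 3 - exp_den 3 v / exp_den 0 v ^ 2
  - 6 * exp_den 1 v ^ 3 / exp_den 0 v ^ 4.

Lemma is_derive_bern v : 0 <= v ->
  [/\ is_derive bern v (bern1 v), is_derive bern1 v (bern2 v) &
      is_derive bern2 v (bern3 v)].
Proof.
move=> v0; have [_ h1] := exp_den0_ge v v0.
have d0 := is_derive_exp_den 0 v; have d1 := is_derive_exp_den 1 v.
have d2 := is_derive_exp_den 2 v.
have e0 : ex_derive (fun x => exp_den 0 x) v by exists (exp_den 1 v).
have e1 : ex_derive (fun x => exp_den 1 x) v by exists (exp_den 2 v).
have e2 : ex_derive (fun x => exp_den 2 x) v by exists (exp_den 3 v).
have n0 : exp_den 0 v <> 0 by lra.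
have n2 : exp_den 0 v * (exp_den 0 v * 1) <> 0.
  by rewrite Rmult_1_r; apply: Rmult_integral_contrapositive.
have n3 : exp_den 0 v * (exp_den 0 v * (exp_den 0 v * 1)) <> 0.
  by apply: Rmult_integral_contrapositive.
split.
- rewrite /bern /bern1; auto_derive; first by [].
  by rewrite (is_derive_unique _ _ _ d0); field; lra.
- rewrite /bern1 /bern2; auto_derive; first by [].
  by rewrite (is_derive_unique _ _ _ d0) (is_derive_unique _ _ _ d1); field; lra.
- rewrite /bern2 /bern3; auto_derive; first by [].
  rewrite (is_derive_unique _ _ _ d0) (is_derive_unique _ _ _ d1).
  by rewrite (is_derive_unique _ _ _ d2); field; lra.
Qed.

(** The quotients of [exp_den 1], [exp_den 2], [exp_den 3] by [exp_den 0] lie in [0, 1], so each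
    derivative is at most 6 + 1 + 6 = 13 times [bern], and 13 * 121 < 2000. *)
Lemma bern_bound v : 0 <= v ->
  [/\ 0 < bern v <= 121 / (1 + v ^ 4), Rabs (bern1 v) <= 2000 / (1 + v ^ 4),
      Rabs (bern2 v) <= 2000 / (1 + v ^ 4) & Rabs (bern3 v) <= 2000 / (1 + v ^ 4)].
Proof.
move=> v0; have [h h1] := exp_den0_ge v v0.
have v4 := pow_le v 4 v0.
have hi : / exp_den 0 v <= 121 / (1 + v ^ 4).
  have -> : 121 / (1 + v ^ 4) = / ((1 + v ^ 4) / 121) by field; lra.
  by apply: Rinv_le_contravar => //; lra.
have [p1 q1] := exp_den_S_bound 0 v v0.
have [p2 q2] := exp_den_S_bound 1 v v0.
have [p3 q3] := exp_den_S_bound 2 v v0.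
have hi2 : 13 * / exp_den 0 v <= 2000 / (1 + v ^ 4).
  have : 13 * (121 / (1 + v ^ 4)) <= 2000 / (1 + v ^ 4).
    rewrite /Rdiv -Rmult_assoc; apply: Rmult_le_compat_r; last lra.
    by apply: Rlt_le; apply: Rinv_0_lt_compat; lra.
  lra.
have i0 : 0 < / exp_den 0 v by apply: Rinv_0_lt_compat; lra.
pose p := exp_den 0 v.
pose a := exp_den 1 v / p; pose b := exp_den 2 v / p; pose c := exp_den 3 v / p.
have ratio y : 0 <= y <= p -> 0 <= y / p <= 1.
  move=> [y0 yp]; split; first by apply: Rle_mult_inv_pos; rewrite /p; lra.
  by apply/Rle_div_l; rewrite /p in yp *; lra.
have a01 : 0 <= a <= 1 by apply: ratio; rewrite /p; lra.
have b01 : 0 <= b <= 1 by apply: ratio; rewrite /p; lra.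
have c01 : 0 <= c <= 1 by apply: ratio; rewrite /p; lra.
have np : exp_den 0 v <> 0 by lra.
have scaled y : Rabs y <= 13 -> Rabs (y * / exp_den 0 v) <= 2000 / (1 + v ^ 4).
  move=> hy; rewrite Rabs_mult (Rabs_pos_eq (/ _)); last lra.
  by apply: Rle_trans hi2; apply: Rmult_le_compat_r => //; lra.
have ab : 0 <= a * b <= 1 by nra.
have aa : 0 <= a * a <= 1 by nra.
have aaa : 0 <= a * a * a <= 1 by nra.
split; first by rewrite /bern; lra.
- have -> : bern1 v = - a * / exp_den 0 v by rewrite /bern1 /a /p; field.
  by apply: scaled; apply: Rabs_le; lra.
- have -> : bern2 v = (2 * (a * a) - b) * / exp_den 0 v.
    by rewrite /bern2 /a /b /p; field.
  by apply: scaled; apply: Rabs_le; lra.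
- have -> : bern3 v = (6 * (a * b) - c - 6 * (a * a * a)) * / exp_den 0 v.
    by rewrite /bern3 /a /b /c /p; field.
  by apply: scaled; apply: Rabs_le; lra.
Qed.

Lemma bern_exp v : 0 < v -> bern v = v * exp (- v) / (1 - exp (- v)).
Proof.
move=> v0; have e := mul_exp_den0 v.
have [_ h1] := exp_den0_ge v (Rlt_le _ _ v0).
have h := exp_neg_lt_1 v v0.
have -> : bern v = v / (exp v - 1) by rewrite -e /bern; field; lra.
have x1 : exp v * exp (- v) = 1 by rewrite -exp_plus Rplus_opp_r exp_0.
have h2 := exp_ineq1_le v.
apply: (Rmult_eq_reg_r ((exp v - 1) * (1 - exp (- v)))); last first.
  by apply: Rmult_integral_contrapositive; lra.
field_simplify; [|lra|lra].
have -> : v * exp v * exp (- v) = v * (exp v * exp (- v)) by ring.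
by rewrite x1; ring.
Qed.

(** These are v^2 and v^3 times the sums of j exp(- j v) and of j^2 exp(- j v), as [polylog_bern]
    shows, in a form that is smooth at 0. They satisfy v bern' = bern - G2 and v G2' = 2 G2 - G3,
    which makes their integrals multiples of that of [bern], up to boundary terms. *)
Definition bernG2 (v : R) : R := bern v - v * bern1 v.
Definition bernG3 (v : R) : R := 2 * bern v - 2 * v * bern1 v + v ^ 2 * bern2 v.

Lemma is_derive_locally_ext_pos (f g : R -> R) (v l : R) : 0 < v ->
  (forall t, 0 < t -> f t = g t) -> is_derive f v l -> is_derive g v l.
Proof.
move=> v0 fg; apply: is_derive_ext_loc.
exists (mkposreal v v0) => t ht; apply: fg.
by move: ht; rewrite /ball /= /AbsRing_ball /abs /= /minus /plus /opp /= => /Rabs_def2; lra.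
Qed.

(** The first identity is a geometric series. The others follow by differentiating it, since d/dv
    sends [polylog s (exp (- v))] to minus the polylogarithm with s + 1. *)
Lemma polylog_bern v : 0 < v ->
  [/\ v * (polylog 0 (exp (- v)) - 1) = bern v,
      v ^ 2 * polylog 1 (exp (- v)) = bernG2 v &
      v ^ 3 * polylog 2 (exp (- v)) = bernG3 v].
Proof.
have e0 t : 0 < t -> t * (polylog 0 (exp (- t)) - 1) = bern t.
  move=> t0; have h := exp_neg_lt_1 t t0.
  by rewrite polylog0 ?bern_exp //; [field; lra | lra].
have d0 t : 0 < t ->
    bern1 t = polylog 0 (exp (- t)) - 1 - t * polylog 1 (exp (- t)).
  move=> t0; have [d _ _] := is_derive_bern t (Rlt_le _ _ t0).
  rewrite -(is_derive_unique _ _ _ d); apply: is_derive_unique.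
  apply: (is_derive_locally_ext_pos (fun t => t * (polylog 0 (exp (- t)) - 1))) => //.
  have h := exp_neg_lt_1 t t0.
  have dp := is_derive_polylog 0 (exp (- t)) h.
  auto_derive; first by exists (polylog 1 (exp (- t)) / exp (- t)).
  by rewrite (is_derive_unique _ _ _ dp); field; lra.
move=> v0; split; first exact: e0.
  by rewrite /bernG2 d0 // -e0 //; ring.
have -> : bernG3 v = 2 * bernG2 v + v ^ 2 * bern2 v by rewrite /bernG3 /bernG2; ring.
have [_ d _] := is_derive_bern v (Rlt_le _ _ v0).
have -> : bern2 v = - 2 * polylog 1 (exp (- v)) + v * polylog 2 (exp (- v)).
  rewrite -(is_derive_unique _ _ _ d); apply: is_derive_unique.
  apply: (is_derive_locally_ext_pos
    (fun t => polylog 0 (exp (- t)) - 1 - t * polylog 1 (exp (- t)))) => //.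
    by move=> t t0; rewrite d0.
  have h := exp_neg_lt_1 v v0.
  have dp0 := is_derive_polylog 0 _ h; have dp1 := is_derive_polylog 1 _ h.
  auto_derive.
    split; first by exists (polylog 1 (exp (- v)) / exp (- v)).
    by split; first by exists (polylog 2 (exp (- v)) / exp (- v)).
  by rewrite (is_derive_unique _ _ _ dp0) (is_derive_unique _ _ _ dp1); field; lra.
by rewrite /bernG2 d0 // -e0 //; ring.
Qed.

(* Half of the exponential decay absorbs the powers of [j v]. *)
Lemma polylog_bound s : exists C, 0 < C /\ forall v, 0 < v ->
  0 <= v ^ S (S s) * polylog (S s) (exp (- v)) <= C / (1 + v ^ 4).
Proof.
pose F := 2 ^ S s * INR (fact (S s)).
have F0 : 0 < F by apply: Rmult_lt_0_compat; [apply: pow_lt; lra | exact: INR_fact_lt_0].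
exists (2 * F * 121 * 16); split; first lra.
move=> v v0.
have h := exp_neg_lt_1 v v0; have [w0 w1] := exp_neg_lt_1 (v / 2) ltac:(lra).
have vs : 0 < v ^ S s by exact: pow_lt.
have pos j : 0 <= power_coef (S s) j * exp (- v) ^ j.
  apply: Rmult_le_pos; first by apply: pow_le; exact: pos_INR.
  by apply: pow_le; lra.
have le : polylog (S s) (exp (- v)) <= F / v ^ S s * (exp (- (v / 2)) * / (1 - exp (- (v / 2)))).
  rewrite -polylog0; last lra.
  rewrite /polylog -PSeries_incr_1 -PSeries_scal.
  apply: Series_le; last first.
    apply/ex_pseries_R; apply: ex_pseries_scal; first exact: Rmult_comm.
    apply: ex_pseries_incr_1; apply: ex_pseries_unit; last lra.
    exact: CV_radius_power_coef.
  move=> j; split; first exact: pos.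
  case: j => [|j].
    by rewrite /power_coef /= !Rmult_0_l /PS_scal /scal /= /mult /= /PS_incr_1 /zero /=; lra.
  rewrite /PS_scal /scal /= /mult /= /PS_incr_1 /power_coef.
  change (exp (- v) * exp (- v) ^ j) with (exp (- v) ^ S j).
  change (exp (- (v / 2)) * exp (- (v / 2)) ^ j) with (exp (- (v / 2)) ^ S j).
  set J := INR (S j).
  have J0 : 0 < J by exact: INR_S_pos j.
  rewrite !exp_pow -/J.
  have -> : exp (J * - v) = exp (- (J * v / 2)) * exp (J * - (v / 2)).
    by rewrite -exp_plus; congr exp; field.
  rewrite Rmult_1_r -Rmult_assoc; apply: Rmult_le_compat_r.
    exact: Rlt_le (exp_pos _).
  have := pow_le_exp (S s) (J * v / 2) ltac:(nra).
  rewrite -[J * v / 2]/(J * v * / 2) !Rpow_mult_distr.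
  set e := exp (J * v * / 2); set e' := exp _ => q.
  have ee : e * e' = 1 by rewrite /e /e' -exp_plus Rplus_opp_r exp_0.
  have e'0 : 0 < e' by exact: exp_pos.
  apply: (Rmult_le_reg_r (v ^ S s * (/ 2) ^ S s)).
    by apply: Rmult_lt_0_compat => //; apply: pow_lt; lra.
  have -> : F / v ^ S s * (v ^ S s * (/ 2) ^ S s) = INR (fact (S s)).
    rewrite /F pow_inv; field; split; first by apply: pow_nonzero; lra.
    by apply: Rgt_not_eq.
  apply: Rle_trans (_ : INR (fact (S s)) * e * e' <= _); last first.
    by rewrite Rmult_assoc ee; lra.
  have -> : J ^ S s * e' * (v ^ S s * (/ 2) ^ S s) = J ^ S s * v ^ S s * (/ 2) ^ S s * e'.
    by ring.
  by apply: Rmult_le_compat_r; [lra | exact: q].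
have vss : 0 < v ^ S (S s) by exact: pow_lt.
split.
  apply: Rmult_le_pos; first lra.
  apply: Series_nonneg => //; apply/ex_pseries_R; apply: ex_pseries_unit; last lra.
  exact: CV_radius_power_coef.
apply: Rle_trans (Rmult_le_compat_l _ _ _ (Rlt_le _ _ vss) le) _.
have -> : v ^ S (S s) * (F / v ^ S s * (exp (- (v / 2)) * / (1 - exp (- (v / 2))))) =
          2 * F * bern (v / 2).
  rewrite bern_exp; last lra.
  rewrite (_ : v ^ S (S s) = v * v ^ S s) //; field; split; last lra.
  lra.
have [[_ b] _ _ _] := bern_bound (v / 2) ltac:(lra).
have v4 : 0 < v ^ 4 by exact: pow_lt.
have b' : 121 / (1 + (v / 2) ^ 4) <= 121 * 16 / (1 + v ^ 4).
  have -> : 121 * 16 / (1 + v ^ 4) = 121 * / ((1 + v ^ 4) / 16) by field; lra.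
  apply: Rmult_le_compat_l; first lra.
  by apply: Rinv_le_contravar; lra.
have -> : 2 * F * 121 * 16 / (1 + v ^ 4) = 2 * F * (121 * 16 / (1 + v ^ 4)).
  by field; lra.
by apply: Rmult_le_compat_l; lra.
Qed.

(** * Riemann sums *)

Lemma ex_RInt_of_derive (f df : R -> R) (a b : R) : a <= b ->
  (forall t, a <= t <= b -> is_derive f t (df t)) -> ex_RInt f a b.
Proof.
move=> ab der; apply: (ex_RInt_continuous (V := R_CompleteNormedModule)) => t.
rewrite Rmin_left // Rmax_right // => /der d.
by apply: ex_derive_continuous; exists (df t).
Qed.

Lemma right_endpoint_rule (f df : R -> R) (a b K : R) : a <= b ->
  (forall t, a <= t <= b -> is_derive f t (df t)) ->
  (forall t, a <= t <= b -> Rabs (df t) <= K) ->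
  Rabs (RInt f a b - (b - a) * f b) <= K * (b - a) ^ 2.
Proof.
move=> ab der bd.
have exf := ex_RInt_of_derive f df a b ab der.
have -> : RInt f a b - (b - a) * f b = RInt (fun t => f t - f b) a b.
  rewrite RInt_minus //; last exact: ex_RInt_const.
  by rewrite RInt_const /minus /plus /opp /scal /= /mult /=; ring.
have -> : K * (b - a) ^ 2 = (b - a) * (K * (b - a)) by ring.
apply: abs_RInt_le_const => //.
  by apply: ex_RInt_minus => //; exact: ex_RInt_const.
move=> t [ta tb]; rewrite Rabs_minus_sym.
have [||u [hu ->]] := mean_value f df t b; [lra | by move=> s hs; apply: der; lra |].
rewrite Rabs_mult (Rabs_pos_eq (b - t)); last lra.
by apply: Rmult_le_compat; [exact: Rabs_pos | lra | apply: bd; lra | lra].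
Qed.

(** The comparison is with the chord, whose slope is f' at some point u. At each t the gap is (f'(v)
    - f'(u)) (t - a), which the bound on f'' controls. *)
Lemma trapezoid_rule (f df ddf : R -> R) (a b K : R) : a < b ->
  (forall t, a <= t <= b -> is_derive f t (df t)) ->
  (forall t, a <= t <= b -> is_derive df t (ddf t)) ->
  (forall t, a <= t <= b -> Rabs (ddf t) <= K) ->
  Rabs (RInt f a b - (b - a) / 2 * (f a + f b)) <= K * (b - a) ^ 3.
Proof.
move=> ab der der2 bd.
have ab' := Rlt_le _ _ ab.
have exf := ex_RInt_of_derive f df a b ab' der.
pose s := (f b - f a) / (b - a).
pose l t := f a + s * (t - a).
pose L t := f a * t + s * (t - a) ^ 2 / 2.
have il : is_RInt l a b (minus (L b) (L a)).
  apply: (is_RInt_derive L l) => t _; first by rewrite /L /l; auto_derive; [|field].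
  by apply: (ex_derive_continuous l); rewrite /l; auto_derive.
have exl : ex_RInt l a b by exists (minus (L b) (L a)).
have -> : RInt f a b - (b - a) / 2 * (f a + f b) = RInt (fun t => f t - l t) a b.
  rewrite RInt_minus // (is_RInt_unique _ _ _ _ il) /minus /plus /opp /= /L /s.
  by field; lra.
have K0 : 0 <= K by apply: Rle_trans (bd a _); [exact: Rabs_pos | lra].
have -> : K * (b - a) ^ 3 = (b - a) * (K * (b - a) ^ 2) by ring.
apply: abs_RInt_le_const => //; first exact: ex_RInt_minus.
have [u [hu eu]] := mean_value f df a b ab' der.
have es : s = df u by rewrite /s eu; field; lra.
move=> t [ta tb].
have [||v [hv ev]] := mean_value f df a t; [lra | by move=> x hx; apply: der; lra |].
have -> : f t - l t = (df v - df u) * (t - a) by rewrite /l es; lra.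
have h : Rabs (df v - df u) <= K * Rabs (v - u).
  by apply: (Rabs_sub_le_of_derive df ddf) => x;
     rewrite /Rmin /Rmax; case: Rle_dec => ? ?; [apply: der2 | apply: der2 | apply: bd | apply: bd]; lra.
rewrite Rabs_mult (Rabs_pos_eq (t - a)); last lra.
have -> : K * (b - a) ^ 2 = K * (b - a) * (b - a) by ring.
apply: Rmult_le_compat; [exact: Rabs_pos | lra | | lra].
apply: Rle_trans h _; apply: Rmult_le_compat_l => //.
by apply: Rabs_le; lra.
Qed.

(** Each term is at most the increase of [atan] over the cell that ends at its point. *)
Lemma psum_inv_sq_le_atan eps M : 0 < eps ->
  eps * psum (fun m => / (1 + (INR m * eps) ^ 2)) M <= atan (INR M * eps).
Proof.
move=> e0; elim: M => [|M IH]; first by rewrite /= Rmult_0_l atan_0; lra.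
rewrite /psum -/(psum _ M) S_INR.
have M0 := pos_INR M.
set a := INR M * eps; have a0 : 0 <= a by rewrite /a; nra.
have -> : (INR M + 1) * eps = a + eps by rewrite /a; ring.
have [||t [ht e]] := mean_value atan (fun t => / (1 + t ^ 2)) a (a + eps); first lra.
  by move=> t _; auto_derive; [|rewrite /Rsqr; field; nra].
have : / (1 + (a + eps) ^ 2) <= / (1 + t ^ 2) by apply: Rinv_le_contravar; nra.
rewrite -/a in IH; nra.
Qed.

Lemma psum_inv_sq_bound eps M : 0 < eps ->
  psum (fun m => / (1 + (INR m * eps) ^ 2)) M <= 2 / eps.
Proof.
move=> e0; apply: (Rmult_le_reg_l eps) => //.
have -> : eps * (2 / eps) = 2 by field; lra.
apply: Rle_trans (psum_inv_sq_le_atan eps M e0) _.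
have := atan_bound (INR M * eps); have := PI_4; lra.
Qed.

Lemma RInt_cells (f : R -> R) (w : nat -> R) (eps K : R) (M : nat) :
  0 < eps <= 1 -> 0 <= K ->
  (forall a b, 0 <= a <= b -> ex_RInt f a b) ->
  (forall m, Rabs (RInt f (INR m * eps) (INR m * eps + eps) - w (S m)) <=
             K / (1 + (INR m * eps) ^ 2)) ->
  Rabs (RInt f 0 (INR M * eps) - psum w M) <= 6 * K / eps.
Proof.
move=> [e0 e1] K0 exf cell.
apply: Rle_trans (_ : psum (fun m => 3 * K * / (1 + (INR m * eps) ^ 2)) M <= _); last first.
  rewrite psum_scal; have := psum_inv_sq_bound eps M e0.
  have -> : 6 * K / eps = 3 * K * (2 / eps) by field; lra.
  by move=> h; apply: Rmult_le_compat_l => //; lra.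
elim: M => [|M IH].
  by rewrite /= Rmult_0_l RInt_point /zero /= Rminus_0_r Rabs_R0; lra.
have M0 := pos_INR M.
have a0 : 0 <= INR M * eps by nra.
have -> : INR (S M) * eps = INR M * eps + eps by rewrite S_INR; ring.
rewrite -(RInt_Chasles f 0 (INR M * eps)); first last.
- by apply: exf; lra.
- by apply: exf; lra.
change (Rabs (RInt f 0 (INR M * eps) + RInt f (INR M * eps) (INR M * eps + eps)
    - (psum w M + w (S M))) <= psum (fun m => 3 * K * / (1 + (INR m * eps) ^ 2)) M
    + 3 * K * / (1 + (INR (S M) * eps) ^ 2)).
have c := cell M.
(* The cell error is stated at the left endpoint, while [psum] samples the right one. As eps <= 1,
   the change costs a factor 3. *)
have le : K / (1 + (INR M * eps) ^ 2) <= 3 * K * / (1 + (INR (S M) * eps) ^ 2).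
  rewrite S_INR.
  have -> : 3 * K * / (1 + ((INR M + 1) * eps) ^ 2) =
            K * / ((1 + ((INR M + 1) * eps) ^ 2) / 3) by field; nra.
  have sq := pow2_ge_0 (INR M * eps - eps).
  by apply: Rmult_le_compat_l => //; apply: Rinv_le_contravar; nra.
set A := RInt f 0 _ in IH *; set B := RInt f _ _ in c *.
have -> : A + B - (psum w M + w M.+1) = (A - psum w M) + (B - w M.+1) by ring.
apply: Rle_trans (Rabs_triang _ _) _; lra.
Qed.

Lemma decay_const_nonneg (y C : R) : Rabs y <= C / (1 + 0 ^ 2) -> 0 <= C.
Proof.
by move=> /(Rle_trans _ _ _ (Rabs_pos y)); rewrite pow_i ?Rplus_0_r ?Rdiv_1_r //; lia.
Qed.

Lemma abs_RInt_le_inv_sq (f : R -> R) (c S : R) : 0 <= S -> ex_RInt f 0 S ->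
  (forall s, 0 <= s <= S -> Rabs (f s) <= c / (1 + s ^ 2)) -> Rabs (RInt f 0 S) <= 2 * c.
Proof.
move=> S0 exf bd.
have c0 : 0 <= c by apply: decay_const_nonneg (bd 0 _); lra.
have iat : is_RInt (fun t => c / (1 + t ^ 2)) 0 S (minus (c * atan S) (c * atan 0)).
  apply: (is_RInt_derive (fun t => c * atan t) (fun t => c / (1 + t ^ 2))) => t _.
    by auto_derive; [|rewrite /Rsqr; field; nra].
  apply: (ex_derive_continuous (fun t => c / (1 + t ^ 2))); auto_derive; nra.
apply: Rle_trans (abs_RInt_le _ _ _ S0 exf) _.
apply: Rle_trans (_ : minus (c * atan S) (c * atan 0) <= _).
  rewrite -(is_RInt_unique _ _ _ _ iat); apply: RInt_le => //.
  - exact: ex_RInt_norm.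
  - by exists (minus (c * atan S) (c * atan 0)).
  - by move=> u hu; apply: bd; lra.
rewrite /minus /plus /opp /= atan_0.
have := atan_bound S; have := PI_4; nra.
Qed.

Section RiemannSum.
Variables (f df ddf : R -> R) (C : R).
Hypothesis der : forall u, 0 <= u -> is_derive f u (df u).

Lemma riemann_sum_bound eps M : 0 < eps <= 1 ->
  (forall u, 0 <= u -> Rabs (df u) <= C / (1 + u ^ 2)) ->
  Rabs (RInt f 0 (INR M * eps) - eps * psum (fun m => f (INR m * eps)) M) <= 6 * C * eps.
Proof.
move=> [e0 e1] bd.
have C0 : 0 <= C := decay_const_nonneg _ _ (bd 0 (Rle_refl 0)).
rewrite -psum_scal; have -> : 6 * C * eps = 6 * (C * eps ^ 2) / eps by field; lra.
apply: RInt_cells => //; first by nra.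
  by move=> a b ab; apply: (ex_RInt_of_derive f df); [lra | move=> t ht; apply: der; lra].
move=> m; have M0 := pos_INR m; have a0 : 0 <= INR m * eps by nra.
have := right_endpoint_rule f df (INR m * eps) (INR m * eps + eps)
  (C / (1 + (INR m * eps) ^ 2)).
rewrite (_ : INR m * eps + eps - INR m * eps = eps); last by ring.
rewrite (_ : INR (S m) * eps = INR m * eps + eps); last by rewrite S_INR; ring.
have -> : C / (1 + (INR m * eps) ^ 2) * eps ^ 2 = C * eps ^ 2 / (1 + (INR m * eps) ^ 2).
  by rewrite /Rdiv; ring.
apply; first lra.
- by move=> t ht; apply: der; lra.
- move=> t ht; apply: Rle_trans (bd t _) _; first lra.
  apply: Rmult_le_compat_l => //; apply: Rinv_le_contravar; nra.
Qed.

(** The boundary term eps / 2 (f 0 - f X) of this rule is what later shows up as the - 1/2 in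
    [bern_sums]. *)
Lemma trapezoid_sum_bound eps M : 0 < eps <= 1 ->
  (forall u, 0 <= u -> is_derive df u (ddf u)) ->
  (forall u, 0 <= u -> Rabs (ddf u) <= C / (1 + u ^ 2)) ->
  Rabs (RInt f 0 (INR M * eps) - eps * psum (fun m => f (INR m * eps)) M
        - eps / 2 * (f 0 - f (INR M * eps))) <= 6 * C * eps ^ 2.
Proof.
move=> [e0 e1] der2 bd.
have C0 : 0 <= C := decay_const_nonneg _ _ (bd 0 (Rle_refl 0)).
(* [w m] is the trapezoid of the cell that ends at m eps. *)
pose w m := eps / 2 * (f (INR (Nat.pred m) * eps) + f (INR m * eps)).
have ws : psum w M = eps * psum (fun m => f (INR m * eps)) M
                     + eps / 2 * (f 0 - f (INR M * eps)).
  elim: M => [|M IH]; first by rewrite /= Rmult_0_l; ring.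
  by rewrite /psum -/(psum _ M) -/(psum _ M) IH /w [Nat.pred _]/=; field.
set A := RInt _ _ _; set P := psum (fun m => f (INR m * eps)) M in ws *.
have -> : A - eps * P - eps / 2 * (f 0 - f (INR M * eps)) = A - psum w M.
  by rewrite ws; ring.
have -> : 6 * C * eps ^ 2 = 6 * (C * eps ^ 3) / eps by field; lra.
apply: RInt_cells => //; first by apply: Rmult_le_pos => //; apply: pow_le; lra.
  by move=> a b ab; apply: (ex_RInt_of_derive f df); [lra | move=> t ht; apply: der; lra].
move=> m; have M0 := pos_INR m; have a0 : 0 <= INR m * eps by nra.
have := trapezoid_rule f df ddf (INR m * eps) (INR m * eps + eps)
  (C / (1 + (INR m * eps) ^ 2)).
rewrite (_ : INR m * eps + eps - INR m * eps = eps); last by ring.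
rewrite /w (_ : INR (S m) * eps = INR m * eps + eps); last by rewrite S_INR; ring.
have -> : C / (1 + (INR m * eps) ^ 2) * eps ^ 3 = C * eps ^ 3 / (1 + (INR m * eps) ^ 2).
  by rewrite /Rdiv; ring.
apply; first lra.
- by move=> t ht; apply: der; lra.
- by move=> t ht; apply: der2; lra.
- move=> t ht; apply: Rle_trans (bd t _) _; first lra.
  apply: Rmult_le_compat_l => //; apply: Rinv_le_contravar; nra.
Qed.

End RiemannSum.

(** * Sums of functions of u^k over the lattice eps m *)

Lemma pow_le_1_plus_pow (u : R) (i j : nat) : 0 <= u -> le i j -> u ^ i <= 1 + u ^ j.
Proof.
move=> u0 ij; have uj := pow_le u j u0.
case: (Rle_dec u 1) => u1.
  have : u ^ i <= 1 ^ i by apply: pow_incr; lra.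
  rewrite pow1; lra.
by have := Rle_pow u i j ltac:(lra) ij; lra.
Qed.

(** Both u^i and u^(i+2) are at most 1 + u^(4k), whence the factor 2. *)
Lemma pow_mul_decay (k i : nat) (u y C : R) : 0 <= u -> le (i + 2)%coq_nat (4 * k)%coq_nat ->
  Rabs y <= C / (1 + (u ^ k) ^ 4) -> Rabs (u ^ i * y) <= 2 * C / (1 + u ^ 2).
Proof.
move=> u0 ik hy.
have ui := pow_le u i u0.
rewrite Rabs_mult (Rabs_pos_eq _ ui).
have v4 := pow_le _ 4 (pow_le u k u0).
have C0 : 0 <= C.
  have p : 0 < 1 + (u ^ k) ^ 4 by lra.
  have := proj2 (Rle_div_r 0 C _ p) (Rle_trans _ _ _ (Rabs_pos y) hy); lra.
have b : u ^ i * (1 + u ^ 2) <= 2 * (1 + (u ^ k) ^ 4).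
  have e : u ^ i * (1 + u ^ 2) = u ^ i + u ^ (i + 2)%coq_nat by rewrite pow_add; ring.
  rewrite e -pow_mult (Nat.mul_comm k).
  have := pow_le_1_plus_pow u (i + 2)%coq_nat (4 * k)%coq_nat u0 ik.
  have := pow_le_1_plus_pow u i (4 * k)%coq_nat u0 ltac:(lia); lra.
have u2 := pow2_ge_0 u.
apply: Rle_trans (Rmult_le_compat_l _ _ _ ui hy) _.
have p1 : 0 < 1 + u ^ 2 by lra.
have p2 : 0 < 1 + (u ^ k) ^ 4 by lra.
apply: (proj1 (Rle_div_r _ _ _ p1)).
have -> : u ^ i * (C / (1 + (u ^ k) ^ 4)) * (1 + u ^ 2) =
          (C * (u ^ i * (1 + u ^ 2))) / (1 + (u ^ k) ^ 4) by field; lra.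
apply: (proj2 (Rle_div_l _ _ _ p2)).
apply: Rle_trans (Rmult_le_compat_l _ _ _ C0 b) _; lra.
Qed.

Lemma is_derive_comp_pow (g : R -> R) (k : nat) (u l : R) :
  is_derive g (u ^ k) l ->
  is_derive (fun u => g (u ^ k)) u (INR k * u ^ Nat.pred k * l).
Proof.
move=> d; auto_derive; first by exists l.
by rewrite (is_derive_unique _ _ _ d); ring.
Qed.

Lemma is_derive_bernG2 v : 0 <= v -> is_derive bernG2 v (- (v * bern2 v)).
Proof.
move=> v0; have [d0 d1 _] := is_derive_bern v v0.
have e0 : ex_derive (fun x => bern x) v by exists (bern1 v).
have e1 : ex_derive (fun x => bern1 x) v by exists (bern2 v).
rewrite /bernG2; auto_derive; first by [].
by rewrite (is_derive_unique _ _ _ d0) (is_derive_unique _ _ _ d1); ring.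
Qed.

Lemma is_derive_bernG3 v : 0 <= v -> is_derive bernG3 v (v ^ 2 * bern3 v).
Proof.
move=> v0; have [d0 d1 d2] := is_derive_bern v v0.
have e0 : ex_derive (fun x => bern x) v by exists (bern1 v).
have e1 : ex_derive (fun x => bern1 x) v by exists (bern2 v).
have e2 : ex_derive (fun x => bern2 x) v by exists (bern3 v).
rewrite /bernG3; auto_derive; first by [].
rewrite (is_derive_unique _ _ _ d0) (is_derive_unique _ _ _ d1).
by rewrite (is_derive_unique _ _ _ d2); ring.
Qed.

Section BernPowSums.
Variable k : nat.
Hypothesis hk : le 1 k.

Let Ik X := RInt (fun u => bern (u ^ k)) 0 X.

Lemma is_derive_bern_pow u : 0 <= u ->
  is_derive (fun u => bern (u ^ k)) u (INR k * u ^ Nat.pred k * bern1 (u ^ k)).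
Proof.
move=> u0; apply: is_derive_comp_pow.
by have [] := is_derive_bern (u ^ k) (pow_le u k u0).
Qed.

(** For k = 1 the exponent [pred (pred k)] is truncated to 0, harmlessly, because its coefficient
    [INR (pred k)] vanishes. *)
Lemma is_derive_bern_pow2 u : 0 <= u ->
  is_derive (fun u => INR k * u ^ Nat.pred k * bern1 (u ^ k)) u
    (INR k * INR (Nat.pred k) * (u ^ Nat.pred (Nat.pred k) * bern1 (u ^ k)) +
     INR k * INR k * (u ^ (Nat.pred k + Nat.pred k)%coq_nat * bern2 (u ^ k))).
Proof.
move=> u0; have [_ d _] := is_derive_bern (u ^ k) (pow_le u k u0).
auto_derive; first by exists (bern2 (u ^ k)).
by rewrite (is_derive_unique _ _ _ d) pow_add; ring.
Qed.

Lemma is_derive_bernG2_pow u : 0 <= u ->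
  is_derive (fun u => bernG2 (u ^ k)) u
    (- INR k * (u ^ (Nat.pred k + k)%coq_nat * bern2 (u ^ k))).
Proof.
move=> u0; have d := is_derive_comp_pow _ k u _ (is_derive_bernG2 _ (pow_le u k u0)).
rewrite (_ : - INR k * _ = INR k * u ^ Nat.pred k * - (u ^ k * bern2 (u ^ k))) //.
by rewrite pow_add; ring.
Qed.

Lemma is_derive_bernG3_pow u : 0 <= u ->
  is_derive (fun u => bernG3 (u ^ k)) u
    (INR k * (u ^ (Nat.pred k + (k + k))%coq_nat * bern3 (u ^ k))).
Proof.
move=> u0; have d := is_derive_comp_pow _ k u _ (is_derive_bernG3 _ (pow_le u k u0)).
rewrite (_ : INR k * _ = INR k * u ^ Nat.pred k * ((u ^ k) ^ 2 * bern3 (u ^ k))) //.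
by rewrite !pow_add; ring.
Qed.

Lemma Rabs_scal_decay (c y C u : R) : 0 <= c ->
  Rabs y <= 2 * C / (1 + u ^ 2) -> Rabs (c * y) <= c * 2 * C / (1 + u ^ 2).
Proof.
move=> c0 hy; rewrite Rabs_mult (Rabs_pos_eq c) //.
have -> : c * 2 * C / (1 + u ^ 2) = c * (2 * C / (1 + u ^ 2)).
  by have := pow2_ge_0 u => ?; field; lra.
exact: Rmult_le_compat_l.
Qed.

(** This sum multiplies the linear term of the phase and is needed to accuracy eps after division by
    eps, so it takes the second-order rule. The first-order rule suffices for the other two sums. *)
Lemma sum_bern_pow_trapezoid : exists C, 0 <= C /\ forall eps M, 0 < eps <= 1 ->
  Rabs (Ik (INR M * eps) - eps * psum (fun m => bern ((INR m * eps) ^ k)) M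
        - eps / 2 * (1 - bern ((INR M * eps) ^ k))) <= C * eps ^ 2.
Proof.
have k0 := pos_INR k; have k1 := pos_INR (Nat.pred k).
exists (6 * (8000 * INR k * INR k + 8000 * INR k * INR (Nat.pred k))).
split; first nra.
move=> eps M e01.
have b0 : bern (0 ^ k) = 1.
  rewrite pow_i //; rewrite /bern /exp_den PSeries_0 /exp_den_coef /=; field.
rewrite -{1}b0.
apply: (trapezoid_sum_bound (fun u => bern (u ^ k))
  (fun u => INR k * u ^ Nat.pred k * bern1 (u ^ k))
  (fun u => INR k * INR (Nat.pred k) * (u ^ Nat.pred (Nat.pred k) * bern1 (u ^ k)) +
     INR k * INR k * (u ^ (Nat.pred k + Nat.pred k)%coq_nat * bern2 (u ^ k)))) => //.
- exact: is_derive_bern_pow.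
- exact: is_derive_bern_pow2.
move=> u u0; have [_ d1 d2 _] := bern_bound (u ^ k) (pow_le u k u0).
have h1 := pow_mul_decay k (Nat.pred (Nat.pred k)) u _ _ u0 ltac:(lia) d1.
have h2 := pow_mul_decay k (Nat.pred k + Nat.pred k)%coq_nat u _ _ u0 ltac:(lia) d2.
have h3 := Rabs_scal_decay (INR k * INR (Nat.pred k)) _ _ _ ltac:(nra) h1.
have h4 := Rabs_scal_decay (INR k * INR k) _ _ _ ltac:(nra) h2.
apply: Rle_trans (Rabs_triang _ _) _.
apply: Rle_trans (Rplus_le_compat _ _ _ _ h3 h4) _.
have u2 := pow2_ge_0 u.
rewrite -Rdiv_plus_distr; apply: Rmult_le_compat_r.
  by apply: Rlt_le; apply: Rinv_0_lt_compat; lra.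
nra.
Qed.

Lemma sum_bernG2_pow_bound : exists C, 0 <= C /\ forall eps M, 0 < eps <= 1 ->
  Rabs (RInt (fun u => bernG2 (u ^ k)) 0 (INR M * eps)
        - eps * psum (fun m => bernG2 ((INR m * eps) ^ k)) M) <= C * eps.
Proof.
have k0 := pos_INR k.
exists (6 * (INR k * 2 * 2000)); split; first lra.
move=> eps M e01.
apply: (riemann_sum_bound (fun u => bernG2 (u ^ k)) _ _ is_derive_bernG2_pow) => //.
move=> u u0; have [_ _ d2 _] := bern_bound (u ^ k) (pow_le u k u0).
have h2 := pow_mul_decay k (Nat.pred k + k)%coq_nat u _ _ u0 ltac:(lia) d2.
rewrite -Ropp_mult_distr_l Rabs_Ropp; exact: Rabs_scal_decay.
Qed.

Lemma sum_bernG3_pow_bound : exists C, 0 <= C /\ forall eps M, 0 < eps <= 1 ->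
  Rabs (RInt (fun u => bernG3 (u ^ k)) 0 (INR M * eps)
        - eps * psum (fun m => bernG3 ((INR m * eps) ^ k)) M) <= C * eps.
Proof.
have k0 := pos_INR k.
exists (6 * (INR k * 2 * 2000)); split; first lra.
move=> eps M e01.
apply: (riemann_sum_bound (fun u => bernG3 (u ^ k)) _ _ is_derive_bernG3_pow) => //.
move=> u u0; have [_ _ _ d3] := bern_bound (u ^ k) (pow_le u k u0).
have h3 := pow_mul_decay k (Nat.pred k + (k + k))%coq_nat u _ _ u0 ltac:(lia) d3.
exact: Rabs_scal_decay.
Qed.

Lemma ex_RInt_bern_pow a b : 0 <= a <= b -> ex_RInt (fun u => bern (u ^ k)) a b.
Proof.
move=> ab; apply: ex_RInt_of_derive; first lra.
by move=> t ht; apply: is_derive_bern_pow; lra.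
Qed.

Lemma ex_RInt_bernG2_pow X : 0 <= X -> ex_RInt (fun u => bernG2 (u ^ k)) 0 X.
Proof.
by move=> X0; apply: ex_RInt_of_derive => // t ht; apply: is_derive_bernG2_pow; lra.
Qed.

Lemma ex_RInt_bernG3_pow X : 0 <= X -> ex_RInt (fun u => bernG3 (u ^ k)) 0 X.
Proof.
by move=> X0; apply: ex_RInt_of_derive => // t ht; apply: is_derive_bernG3_pow; lra.
Qed.

(* Integration by parts, i.e. integrating the derivative of [u * g (u^k)]. *)
Lemma RInt_scaling (g h dg : R -> R) (s X : R) : 0 <= X ->
  (forall v, 0 <= v -> is_derive g v (dg v)) ->
  (forall v, 0 <= v -> v * dg v = s * g v - h v) ->
  ex_RInt (fun u => g (u ^ k)) 0 X -> ex_RInt (fun u => h (u ^ k)) 0 X ->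
  (forall u, 0 <= u -> continuous (fun u => h (u ^ k)) u) ->
  RInt (fun u => h (u ^ k)) 0 X =
  (s + 1 / INR k) * RInt (fun u => g (u ^ k)) 0 X - X * g (X ^ k) / INR k.
Proof.
move=> X0 der vdg exg exh ch.
have k0 : 0 < INR k by apply: lt_0_INR; lia.
have dgk u : 0 <= u -> is_derive (fun u => g (u ^ k)) u (INR k * u ^ Nat.pred k * dg (u ^ k)).
  by move=> u0; apply: is_derive_comp_pow; apply: der; exact: pow_le.
pose F u := u * g (u ^ k).
pose dF u := (1 + INR k * s) * g (u ^ k) - INR k * h (u ^ k).
have derF u : 0 <= u -> is_derive F u (dF u).
  move=> u0; have d := dgk u u0.
  have d' : is_derive F u (1 * g (u ^ k) + u * (INR k * u ^ Nat.pred k * dg (u ^ k))).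
    by apply: (is_derive_mult (fun u => u) (fun u => g (u ^ k))) => //;
      [exact: is_derive_id | exact: Rmult_comm].
  have -> : dF u = 1 * g (u ^ k) + u * (INR k * u ^ Nat.pred k * dg (u ^ k)).
    have e := vdg (u ^ k) (pow_le u k u0).
    have e2 : u ^ k = u * u ^ Nat.pred k by rewrite -{1}(Nat.succ_pred k) //; lia.
    transitivity (g (u ^ k) + INR k * (s * g (u ^ k) - h (u ^ k))).
      by rewrite /dF; ring.
    by rewrite -e {2}e2; ring.
  exact: d'.
have iF : is_RInt dF 0 X (minus (F X) (F 0)).
  apply: (is_RInt_derive F dF) => t; rewrite Rmin_left // Rmax_right // => ht.
    by apply: derF; lra.
  apply: continuous_Rminus.
    apply: (continuous_scal_r (K := R_AbsRing) (V := R_NormedModule)).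
    apply: (ex_derive_continuous (fun u => g (u ^ k))).
    by exists (INR k * t ^ Nat.pred k * dg (t ^ k)); apply: dgk; lra.
  apply: (continuous_scal_r (K := R_AbsRing) (V := R_NormedModule)).
  by apply: ch; lra.
have e := is_RInt_unique _ _ _ _ iF.
rewrite /dF RInt_minus in e; first last.
- exact: (ex_RInt_scal (V := R_CompleteNormedModule)).
- exact: (ex_RInt_scal (V := R_CompleteNormedModule)).
rewrite (RInt_scal (V := R_CompleteNormedModule) (fun u => g (u ^ k))) // in e.
rewrite (RInt_scal (V := R_CompleteNormedModule) (fun u => h (u ^ k))) // in e.
move: e; set A := RInt _ _ _; set B := RInt _ _ _.
rewrite /minus /plus /opp /scal /= /mult /= /F => e.
apply: (Rmult_eq_reg_l (INR k)); last lra.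
have -> : INR k * ((s + 1 / INR k) * A - X * g (X ^ k) / INR k) =
          (1 + INR k * s) * A - X * g (X ^ k) by field; lra.
lra.
Qed.

Lemma RInt_bernG2_pow X : 0 <= X ->
  RInt (fun u => bernG2 (u ^ k)) 0 X = (1 + 1 / INR k) * Ik X - X * bern (X ^ k) / INR k.
Proof.
move=> X0; apply: (RInt_scaling bern bernG2 bern1) => //.
- by move=> v v0; have [] := is_derive_bern v v0.
- by move=> v _; rewrite /bernG2; ring.
- by apply: ex_RInt_bern_pow; lra.
- exact: ex_RInt_bernG2_pow.
- move=> u u0; apply: ex_derive_continuous.
  by eexists; exact: is_derive_bernG2_pow.
Qed.

Lemma RInt_bernG3_pow X : 0 <= X ->
  RInt (fun u => bernG3 (u ^ k)) 0 X =
  (2 + 1 / INR k) * RInt (fun u => bernG2 (u ^ k)) 0 X - X * bernG2 (X ^ k) / INR k.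
Proof.
move=> X0; apply: (RInt_scaling bernG2 bernG3 (fun v => - (v * bern2 v))) => //.
- exact: is_derive_bernG2.
- by move=> v _; rewrite /bernG2 /bernG3; ring.
- exact: ex_RInt_bernG2_pow.
- exact: ex_RInt_bernG3_pow.
- move=> u u0; apply: ex_derive_continuous.
  by eexists; exact: is_derive_bernG3_pow.
Qed.

Lemma bern_pow_decay u : 0 <= u -> bern (u ^ k) <= 242 / (1 + u ^ 2).
Proof.
move=> u0; have [[b0 b] _ _ _] := bern_bound (u ^ k) (pow_le u k u0).
rewrite -(Rabs_pos_eq (bern _)) in b; last lra.
have := pow_mul_decay k 0 u _ _ u0 ltac:(lia) b.
by rewrite Rmult_1_l Rabs_pos_eq; lra.
Qed.

Lemma bernG2_pow_decay u : 0 <= u -> Rabs (bernG2 (u ^ k)) <= 5000 / (1 + u ^ 2).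
Proof.
move=> u0; have [[b0 b] b1 _ _] := bern_bound (u ^ k) (pow_le u k u0).
rewrite -(Rabs_pos_eq (bern _)) in b; last lra.
have h0 := pow_mul_decay k 0 u _ _ u0 ltac:(lia) b.
have h1 := pow_mul_decay k k u _ _ u0 ltac:(lia) b1.
rewrite Rmult_1_l in h0; rewrite /bernG2 /Rminus.
apply: Rle_trans (Rabs_triang _ _) _; rewrite Rabs_Ropp.
have u2 := pow2_ge_0 u.
have : 2 * 121 / (1 + u ^ 2) + 2 * 2000 / (1 + u ^ 2) <= 5000 / (1 + u ^ 2).
  rewrite -Rdiv_plus_distr; apply: Rmult_le_compat_r; last lra.
  by apply: Rlt_le; apply: Rinv_0_lt_compat; lra.
lra.
Qed.

End BernPowSums.

(** * The constant c_k *)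

Lemma exp_le_exp (x y : R) : x <= y -> exp x <= exp y.
Proof. by case=> [h|->]; [exact: Rlt_le (exp_increasing _ _ h) | lra]. Qed.

Definition root (k : nat) (t : R) : R := Rpower t (1 / INR k).

Lemma root_pos k t : 0 < root k t.
Proof. exact: exp_pos. Qed.

Lemma root_pow k t : le 1 k -> 0 < t -> root k t ^ k = t.
Proof.
move=> hk t0; have k0 : 0 < INR k by apply: lt_0_INR; lia.
rewrite -Rpower_pow; last exact: root_pos.
rewrite /root Rpower_mult (_ : 1 / INR k * INR k = 1); last by field; lra.
exact: Rpower_1.
Qed.

Lemma pow_le_reg k x y : le 1 k -> 0 <= x -> 0 <= y -> x ^ k <= y ^ k -> x <= y.
Proof.
move=> hk x0 y0 h; apply: Rnot_lt_le => lt.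
have : y ^ k < x ^ k.
  have -> : k = S (Nat.pred k) by lia.
  elim: (Nat.pred k) => [|n IH]; first by rewrite /= !Rmult_1_r.
  rewrite (_ : y ^ S (S n) = y * y ^ S n) // (_ : x ^ S (S n) = x * x ^ S n) //.
  have := pow_le y (S n) y0; nra.
lra.
Qed.

Lemma sup_of_nondecreasing (F : R -> R) (B : R) :
  (forall X Y, 0 <= X <= Y -> F X <= F Y) -> (forall X, 0 <= X -> F X <= B) ->
  exists L, (forall X, 0 <= X -> F X <= L) /\
    forall eta, 0 < eta -> exists X0, 0 <= X0 /\ forall X, X0 <= X -> L - eta <= F X.
Proof.
move=> mono bd.
have [||L [ub lub]] := completeness (fun y => exists X, 0 <= X /\ y = F X).
- by exists B => y [X [X0 ->]]; exact: bd.
- by exists (F 0); exists 0; split; first lra.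
exists L; split; first by move=> X X0; apply: ub; exists X.
move=> eta eta0; apply: NNPP => no.
have : L <= L - eta.
  apply: lub => y [X [X0 ->]]; apply: Rnot_lt_le => lt.
  apply: no; exists X; split=> // Y XY.
  by apply: Rle_trans (mono X Y (conj X0 XY)); lra.
lra.
Qed.

Lemma RInt_nondecreasing (f : R -> R) :
  (forall a b, 0 <= a <= b -> ex_RInt f a b) -> (forall u, 0 <= u -> 0 <= f u) ->
  forall X Y, 0 <= X <= Y -> RInt f 0 X <= RInt f 0 Y.
Proof.
move=> exf f0 X Y XY; rewrite -(RInt_Chasles _ 0 X Y); try by apply: exf; lra.
suff : 0 <= RInt f X Y by rewrite /plus /=; lra.
by apply: RInt_ge_0; [lra | apply: exf; lra | move=> u hu; apply: f0; lra].
Qed.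

Section PowerExpIntegral.
Variable k : nat.
Hypothesis hk : le 1 k.

(** The terms, for j >= 1, of the expansion of bern(u^k) in powers of exp(- u^k). *)
Definition pow_exp (j u : R) : R := u ^ k * exp (- (j * u ^ k)).

Lemma continuous_pow_exp j u : continuous (pow_exp j) u.
Proof. by apply: ex_derive_continuous; rewrite /pow_exp; auto_derive. Qed.

Lemma ex_RInt_pow_exp j a b : ex_RInt (pow_exp j) a b.
Proof. by apply: ex_RInt_of_continuous => u; exact: continuous_pow_exp. Qed.

Lemma pow_exp1_le_1 u : 0 <= u -> 0 <= pow_exp 1 u <= 1.
Proof.
move=> u0; rewrite /pow_exp Rmult_1_l.
have v0 := pow_le u k u0; have e0 := exp_pos (- u ^ k).
split; first by apply: Rmult_le_pos; lra.
have := pow_le_exp 1 _ v0; rewrite /= Rmult_1_r Rmult_1_l => h.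
have <- : exp (u ^ k) * exp (- u ^ k) = 1 by rewrite -exp_plus Rplus_opp_r exp_0.
by apply: Rmult_le_compat_r; lra.
Qed.

Lemma RInt_pow_exp_scale lambda X : 0 < lambda -> 
  RInt (pow_exp (lambda ^ k)) 0 X = / lambda ^ S k * RInt (pow_exp 1) 0 (lambda * X).
Proof.
move=> l0; have lk : 0 < lambda ^ k by exact: pow_lt.
have h : is_RInt (pow_exp 1) (lambda * 0 + 0) (lambda * X + 0)
           (RInt (pow_exp 1) 0 (lambda * X)).
  by rewrite Rmult_0_r !Rplus_0_r; apply: RInt_correct; exact: ex_RInt_pow_exp.
have h1 := is_RInt_scal _ _ _ (/ lambda ^ S k) _ (is_RInt_comp_lin _ _ _ _ _ _ h).
apply: is_RInt_unique; apply: is_RInt_ext h1 => u _.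
rewrite /scal /= /mult /= /pow_exp Rplus_0_r Rmult_1_l Rpow_mult_distr.
by field; split; lra.
Qed.

(** The substitution t = u^k. [Phi] is an antiderivative of the Gamma integrand on t > 0; it tends
    to 0 at 0, as [pow_exp 1] is at most 1, and to k L at infinity. *)
Lemma Gamma_limit (L : R) :
  (forall eta, 0 < eta -> exists X0, 0 <= X0 /\ forall X, X0 <= X ->
     Rabs (RInt (pow_exp 1) 0 X - L) <= eta) ->
  Gamma (1 + 1 / INR k) = INR k * L.
Proof.
move=> lim; have k0 : 0 < INR k by apply: lt_0_INR; lia.
pose Phi t := INR k * RInt (pow_exp 1) 0 (root k t).
have dPhi t : 0 < t -> is_derive Phi t (Rpower t (1 + 1 / INR k - 1) * exp (- t)).
  move=> t0.
  have d1 : is_derive (root k) t (1 / INR k * Rpower t (1 / INR k - 1)).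
    by apply/is_derive_Reals; exact: derivable_pt_lim_power.
  have d2 : is_derive (fun y => RInt (pow_exp 1) 0 y) (root k t) (pow_exp 1 (root k t)).
    apply: (is_derive_RInt _ _ 0); last exact: continuous_pow_exp.
    by apply: filter_forall => y; apply: RInt_correct; exact: ex_RInt_pow_exp.
  have d := is_derive_scal _ _ (INR k) _ (is_derive_comp _ _ _ _ _ d2 d1).
  rewrite (_ : _ * exp _ =
    INR k * scal (1 / INR k * Rpower t (1 / INR k - 1)) (pow_exp 1 (root k t))) //.
  rewrite /scal /= /mult /= /pow_exp root_pow // Rmult_1_l.
  have -> : Rpower t (1 + 1 / INR k - 1) = t * Rpower t (1 / INR k - 1).
    by rewrite -{2}(Rpower_1 t t0) -Rpower_plus; congr Rpower; ring.
  by field; lra.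
have small t : 0 < t -> 0 <= Phi t <= INR k * root k t.
  move=> t0; have r0 := root_pos k t; rewrite /Phi; split.
    apply: Rmult_le_pos; first lra.
    apply: RInt_ge_0; [lra | exact: ex_RInt_pow_exp |].
    by move=> u hu; have := pow_exp1_le_1 u; lra.
  apply: Rmult_le_compat_l; first lra.
  rewrite -[X in _ <= X](_ : RInt (fun _ => 1) 0 (root k t) = _); last first.
    by rewrite RInt_const /scal /= /mult /=; ring.
  apply: RInt_le; [lra | exact: ex_RInt_pow_exp | exact: ex_RInt_const |].
  by move=> u hu; have := pow_exp1_le_1 u; lra.
suff : is_RInt_gen (fun t => Rpower t (1 + 1 / INR k - 1) * exp (- t))
         (at_right 0) (Rbar_locally p_infty) (INR k * L).
  by move=> H; rewrite /Gamma; exact (is_RInt_gen_unique _ _ H).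
move=> P [eps hP].
have e0 := cond_pos eps.
have [|X0 [X00 hX]] := lim (eps / (4 * INR k)); first by apply: Rdiv_lt_0_compat; lra.
pose y := eps / (2 * INR k).
have y0 : 0 < y by apply: Rdiv_lt_0_compat; lra.
rewrite /filtermapi.
(* Both endpoints of the improper integral vary: [Phi a] is within eps / 2 of 0 and [Phi b] within
   eps / 4 of its limit. *)
apply: (Filter_prod _ _ _ (fun a => 0 < a /\ 0 <= Phi a <= eps / 2)
          (fun b => 0 < b /\ Rabs (Phi b - INR k * L) <= eps / 4)).
- exists (mkposreal (y ^ k) (pow_lt _ _ y0)) => a.
  rewrite /ball /= /AbsRing_ball /abs /= /minus /plus /opp /= => /Rabs_def2 [ha _] a0.
  have [s1 s2] := small a a0; split=> //; split=> //; apply: Rle_trans s2 _.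
  have -> : eps / 2 = INR k * y by rewrite /y; field; lra.
  apply: Rmult_le_compat_l; first lra.
  apply: (pow_le_reg k) => //; [exact: Rlt_le (root_pos k a) | lra |].
  by rewrite root_pow //; lra.
- exists (X0 ^ k) => b hb.
  have b0 : 0 < b by have := pow_le X0 k X00; lra.
  have r0 : X0 <= root k b.
    apply: (pow_le_reg k) => //; first exact: Rlt_le (root_pos k b).
    by rewrite root_pow //; lra.
  split=> //; rewrite /Phi -Rmult_minus_distr_l Rabs_mult Rabs_pos_eq; last lra.
  have -> : eps / 4 = INR k * (eps / (4 * INR k)) by field; lra.
  by apply: Rmult_le_compat_l; [lra | exact: hX].
move=> a b [a0 [ha1 ha2]] [b0 hb]; rewrite [fst _]/= [snd _]/=.
exists (minus (Phi b) (Phi a)); split.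
  have m0 : 0 < Rmin a b by apply: Rmin_pos.
  apply: (is_RInt_derive Phi (fun t => Rpower t (1 + 1 / INR k - 1) * exp (- t))) => t ht.
    by apply: dPhi; lra.
  apply: (ex_derive_continuous (fun t => Rpower t (1 + 1 / INR k - 1) * exp (- t))).
  by rewrite /Rpower; auto_derive; lra.
apply: hP.
rewrite /ball /= /AbsRing_ball /abs /= /minus /plus /opp /=.
have /Rabs_le_between hb' := hb.
apply: Rabs_def1; lra.
Qed.

Lemma bern_le_1 v : 0 <= v -> 0 < bern v <= 1.
Proof.
move=> v0; have [_ h] := exp_den0_ge v v0; rewrite /bern; split.
  by apply: Rinv_0_lt_compat; lra.
by rewrite -Rinv_1; apply: Rinv_le_contravar; lra.
Qed.

Lemma bern_rec v : 0 <= v -> bern v = v * exp (- v) + exp (- v) * bern v.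
Proof.
case=> [v0|<-].
  by have h := exp_neg_lt_1 v v0; rewrite bern_exp //; field; lra.
by rewrite Ropp_0 exp_0; ring.
Qed.

Lemma is_derive_exp_bern_pow j u : 0 <= u ->
  is_derive (fun u => exp (- (j * u ^ k)) * bern (u ^ k)) u
    (exp (- (j * u ^ k)) * (INR k * u ^ Nat.pred k * (bern1 (u ^ k) - j * bern (u ^ k)))).
Proof.
move=> u0; have [d _ _] := is_derive_bern (u ^ k) (pow_le u k u0).
auto_derive; first by exists (bern1 (u ^ k)).
by rewrite (is_derive_unique _ _ _ d); ring.
Qed.

Lemma ex_RInt_exp_bern_pow j a b : 0 <= a <= b ->
  ex_RInt (fun u => exp (- (j * u ^ k)) * bern (u ^ k)) a b.
Proof.
move=> ab; apply: ex_RInt_of_derive; first lra.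
by move=> t ht; apply: is_derive_exp_bern_pow; lra.
Qed.

(** [J] uses of [bern_rec]. The explicit remainder makes it possible to avoid exchanging an infinite
    sum with an integral. *)
Lemma RInt_bern_pow_split J X : 0 <= X ->
  RInt (fun u => bern (u ^ k)) 0 X =
  psum (fun j => RInt (pow_exp (INR j)) 0 X) J +
  RInt (fun u => exp (- (INR J * u ^ k)) * bern (u ^ k)) 0 X.
Proof.
move=> X0; elim: J => [|J ->].
  rewrite /= Rplus_0_l; apply: RInt_ext => u _.
  by rewrite Rmult_0_l Ropp_0 exp_0 Rmult_1_l.
rewrite /psum -/(psum _ J) Rplus_assoc; congr Rplus.
have h1 := RInt_correct _ _ _ (ex_RInt_pow_exp (INR (S J)) 0 X).
have h2 := RInt_correct _ _ _ (ex_RInt_exp_bern_pow (INR (S J)) 0 X ltac:(lra)).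
apply: is_RInt_unique; apply: is_RInt_ext (is_RInt_plus _ _ _ _ _ _ h1 h2) => u.
rewrite Rmin_left // Rmax_right // => hu.
rewrite /plus [LHS]/= -/(INR (S J)) /pow_exp S_INR.
have v0 := pow_le u k (Rlt_le _ _ (proj1 hu)).
rewrite [X in _ = _ * X](bern_rec _ v0).
have -> : exp (- ((INR J + 1) * u ^ k)) = exp (- (INR J * u ^ k)) * exp (- u ^ k).
  by rewrite -exp_plus; congr exp; ring.
by ring.
Qed.

Lemma RInt_bern_pow_bounded X : 0 <= X -> RInt (fun u => bern (u ^ k)) 0 X <= 484.
Proof.
move=> X0.
apply: Rle_trans (Rle_abs _) _; apply: abs_RInt_le_inv_sq => //.
  by apply: ex_RInt_bern_pow; lra.
move=> u [u0 _]; have b := bern_le_1 _ (pow_le u k u0).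
by rewrite Rabs_pos_eq; [exact: bern_pow_decay | lra].
Qed.

Lemma bern_pow_ge_0 u : 0 <= u -> 0 <= bern (u ^ k).
Proof. by move=> u0; apply: Rlt_le; apply: (proj1 (bern_le_1 _ _)); apply: pow_le. Qed.

Lemma RInt_exp_bern_pow_ge_0 j X : 0 <= X ->
  0 <= RInt (fun u => exp (- (j * u ^ k)) * bern (u ^ k)) 0 X.
Proof.
move=> X0; apply: RInt_ge_0; [lra | by apply: ex_RInt_exp_bern_pow; lra |].
move=> u hu; apply: Rmult_le_pos; first exact: Rlt_le (exp_pos _).
by apply: bern_pow_ge_0; lra.
Qed.

(** On [0, eta] the integrand is at most 1; beyond eta the exponential factor is at most its value
    at eta. *)
Lemma RInt_tail_bound J eta X B : 0 < eta <= X ->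
  RInt (fun u => bern (u ^ k)) 0 X <= B ->
  0 <= RInt (fun u => exp (- (INR J * u ^ k)) * bern (u ^ k)) 0 X
    <= eta + exp (- eta ^ k) ^ J * B.
Proof.
move=> [e0 eX] hB; have J0 := pos_INR J.
split; first by apply: RInt_exp_bern_pow_ge_0; lra.
rewrite -(RInt_Chasles _ 0 eta X); first last.
- by apply: ex_RInt_exp_bern_pow; lra.
- by apply: ex_RInt_exp_bern_pow; lra.
apply: Rplus_le_compat.
  rewrite -[X in _ <= X](_ : RInt (fun _ => 1) 0 eta = _); last first.
    by rewrite RInt_const /scal /= /mult /=; ring.
  apply: RInt_le; [lra | by apply: ex_RInt_exp_bern_pow; lra | exact: ex_RInt_const |].
  move=> u hu; have v0 := pow_le u k (Rlt_le _ _ (proj1 hu)).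
  have := bern_le_1 _ v0; have := exp_pos (- (INR J * u ^ k)).
  have : exp (- (INR J * u ^ k)) <= exp 0 by apply: exp_le_exp; nra.
  rewrite exp_0; nra.
have exb := ex_RInt_bern_pow k.
have c0 := pow_lt _ J (exp_pos (- eta ^ k)).
apply: Rle_trans (_ : exp (- eta ^ k) ^ J * RInt (fun u => bern (u ^ k)) eta X <= _).
  have h := is_RInt_scal _ _ _ (exp (- eta ^ k) ^ J) _ (RInt_correct _ _ _ (exb eta X ltac:(lra))).
  rewrite -[X in _ <= X](is_RInt_unique _ _ _ _ h).
  apply: RInt_le; [lra | by apply: ex_RInt_exp_bern_pow; lra | by eexists; exact: h |].
  move=> u hu; rewrite /scal /= /mult /=.
  apply: Rmult_le_compat_r; first by apply: bern_pow_ge_0; lra.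
  rewrite exp_pow; apply: exp_le_exp.
  have : eta ^ k <= u ^ k by apply: pow_incr; lra.
  nra.
apply: Rmult_le_compat_l; first lra.
apply: Rle_trans hB; rewrite -(RInt_Chasles _ 0 eta X); try by apply: exb; lra.
suff : 0 <= RInt (fun u => bern (u ^ k)) 0 eta by rewrite /plus /=; lra.
by apply: RInt_ge_0; [lra | apply: exb; lra | move=> u hu; apply: bern_pow_ge_0; lra].
Qed.

Lemma Rzeta_series (L : R) : is_series (fun n => / root k (INR (S n)) ^ S k) L ->
  Rzeta (1 + 1 / INR k) = L.
Proof.
move=> isL; have k0 : 0 < INR k by apply: lt_0_INR; lia.
rewrite /Rzeta /zeta; case: Rlt_dec => [s1|no]; last first.
  have i0 := Rdiv_lt_0_compat 1 (INR k) Rlt_0_1 k0.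
  by exfalso; apply: no; rewrite /=; lra.
rewrite /dirichlet_zeta /=.
apply: is_series_unique; apply: is_series_ext isL => n.
change (/ root k (INR (S n)) ^ S k =
  exp (- (1 + 1 / INR k) * ln (INR (S n)) - - 0 * 0) *
  cos (- (1 + 1 / INR k) * 0 + - 0 * ln (INR (S n)))).
have -> : - (1 + 1 / INR k) * 0 + - 0 * ln (INR (S n)) = 0 by ring.
rewrite cos_0 Rmult_1_r /root /Rpower exp_pow -exp_Ropp; congr exp.
by rewrite (S_INR k); field; lra.
Qed.

(** Termwise integration of the expansion of [bern]: scaling u by j^(1/k) gives the j-th term the
    weight j^(-(1 + 1/k)), so the integral is zeta(1 + 1/k) times that of u^k exp(- u^k), which is
    Gamma(1 + 1/k) / k. The partial sums are squeezed between bounds for the integral, so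
    convergence of the zeta series is an outcome. *)
Lemma c_integral : 0 < c_ k /\ forall eta, 0 < eta -> exists X0, 0 <= X0 /\
  forall X, X0 <= X -> Rabs (RInt (fun u => bern (u ^ k)) 0 X - c_ k) <= eta.
Proof.
have k0 : 0 < INR k by apply: lt_0_INR; lia.
have exb := ex_RInt_bern_pow k.
have [||LI [ubI limI]] := sup_of_nondecreasing
    (fun X => RInt (fun u => bern (u ^ k)) 0 X) 484.
- by apply: RInt_nondecreasing; [exact: exb | exact: bern_pow_ge_0].
- exact: RInt_bern_pow_bounded.
have [||LJ [ubJ limJ]] := sup_of_nondecreasing (RInt (pow_exp 1) 0) 484.
- apply: RInt_nondecreasing; first by move=> a b _; exact: ex_RInt_pow_exp.
  by move=> u /pow_exp1_le_1; lra.
- move=> X X0; apply: Rle_trans (RInt_bern_pow_bounded X X0).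
  rewrite (RInt_bern_pow_split 1 X X0).
  by have := RInt_exp_bern_pow_ge_0 (INR 1) X X0; rewrite /=; lra.
have LJ0 : 0 < LJ.
  apply: Rlt_le_trans (ubJ 1 Rle_0_1).
  apply: RInt_gt_0; first lra.
    move=> u hu; apply: Rmult_lt_0_compat; [by apply: pow_lt; lra | exact: exp_pos].
  by move=> u _; exact: continuous_pow_exp.
have GE : Gamma (1 + 1 / INR k) = INR k * LJ.
  apply: Gamma_limit => eta eta0; have [X0 [X00 h]] := limJ eta eta0.
  exists X0; split=> // X hX; apply: Rabs_le.
  have := h X hX; have := ubJ X; lra.
pose w j := / root k (INR j) ^ S k.
have wpos j : 0 < w j by apply: Rinv_0_lt_compat; apply: pow_lt; exact: root_pos.
have scale j X : RInt (pow_exp (INR (S j))) 0 X =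
    w (S j) * RInt (pow_exp 1) 0 (root k (INR (S j)) * X).
  have n0 := INR_S_pos j.
  by rewrite -{1}(root_pow k (INR (S j))) // RInt_pow_exp_scale //; exact: root_pos.
have root_ge_1 j : 1 <= root k (INR (S j)).
  apply: (pow_le_reg k) => //; [lra | exact: Rlt_le (root_pos _ _) |].
  by rewrite pow1 root_pow // S_INR; have := pos_INR j; lra.
have up J X : 0 <= X -> psum (fun j => RInt (pow_exp (INR j)) 0 X) J <= psum w J * LJ.
  move=> X0; rewrite Rmult_comm -psum_scal; apply: psum_le => j.
  rewrite scale (Rmult_comm LJ); apply: Rmult_le_compat_l; first exact: Rlt_le.
  apply: ubJ; apply: Rmult_le_pos => //; exact: Rlt_le (root_pos _ _).
have low J eta : 0 < eta -> exists X0, 0 <= X0 /\ forall X, X0 <= X ->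
    psum w J * (LJ - eta) <= psum (fun j => RInt (pow_exp (INR j)) 0 X) J.
  move=> eta0; have [X0 [X00 h]] := limJ eta eta0; exists X0; split=> // X hX.
  rewrite Rmult_comm -psum_scal; apply: psum_le => j.
  rewrite scale (Rmult_comm (LJ - eta)); apply: Rmult_le_compat_l; first exact: Rlt_le.
  by apply: h; have := root_ge_1 j; nra.
have wsum0 J : 0 <= psum w J by apply: psum_nonneg => j; exact: Rlt_le.
(* For fixed [J], one large [X] brings all [J] scaled integrals close to [LJ]; the tolerance is
   divided by [psum w J + 1] so that the total loss is at most eta. *)
have sumle J : psum w J * LJ <= LI.
  apply: le_epsilon => eta eta0.
  have [|X0 [X00 h]] := low J (eta / (psum w J + 1)).
    by apply: Rdiv_lt_0_compat => //; have := wsum0 J; lra.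
  have := h X0 (Rle_refl _); have := ubI X0 X00.
  rewrite (RInt_bern_pow_split J X0 X00).
  have := RInt_exp_bern_pow_ge_0 (INR J) X0 X00.
  have : psum w J * (eta / (psum w J + 1)) <= eta.
    have -> : psum w J * (eta / (psum w J + 1)) = (psum w J * eta) / (psum w J + 1).
      by field; have := wsum0 J; lra.
    have s0 : 0 < psum w J + 1 by have := wsum0 J; lra.
    by apply: (proj2 (Rle_div_l _ _ _ s0)); nra.
  lra.
(* One eta is lost by truncating at X and two in the remainder: the piece [0, eta], and 484 exp(-
   eta^k)^J, which is below eta for large [J]. *)
have sumge eta : 0 < eta -> exists N, forall J, le N J -> LI - 3 * eta <= psum w J * LJ.
  move=> eta0.
  have [q0 q1] := exp_neg_lt_1 (eta ^ k) (pow_lt _ _ eta0).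
  have [|N hN] := pow_lt_1_zero (exp (- eta ^ k)) _ (eta / 484) ltac:(lra).
    by rewrite Rabs_pos_eq; lra.
  exists N => J NJ; have := hN J NJ; rewrite Rabs_pos_eq; last by apply: pow_le; lra.
  move=> hJ.
  have [X0 [X00 h]] := limI eta eta0.
  have hX := h (X0 + eta) ltac:(lra).
  have X1 : 0 <= X0 + eta by lra.
  have := up J _ X1.
  have [_] := RInt_tail_bound J eta (X0 + eta) 484 ltac:(lra) (RInt_bern_pow_bounded _ X1).
  rewrite (RInt_bern_pow_split J _ X1) in hX.
  lra.
have psum_sum_n J : sum_n (fun n => w (S n)) J = psum w (S J).
  elim: J => [|J IH]; first by rewrite sum_O /= Rplus_0_l.
  by rewrite sum_Sn IH.
have ser : is_series (fun n => w (S n)) (LI / LJ).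
  move=> P [eps hP].
  have e0 := cond_pos eps.
  have [|N hN] := sumge (eps * LJ / 4).
    by apply: Rdiv_lt_0_compat; [exact: Rmult_lt_0_compat | lra].
  exists N => J NJ; apply: hP; rewrite psum_sum_n.
  rewrite /ball /= /AbsRing_ball /abs /= /minus /plus /opp /=.
  rewrite -/(psum w (S J)).
  have h1 := hN (S J) ltac:(lia); have h2 := sumle (S J).
  have -> : psum w J + w J.+1 + - (LI / LJ) = - ((LI - psum w (S J) * LJ) / LJ).
    by rewrite /=; field; lra.
  rewrite Rabs_Ropp Rabs_pos_eq; last by apply: Rle_mult_inv_pos; lra.
  have p := Rmult_lt_0_compat _ _ e0 LJ0.
  apply: (proj2 (Rlt_div_l _ _ _ LJ0)); lra.
have cE : c_ k = LI.
  by rewrite /c_ GE (Rzeta_series _ ser); field; lra.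
rewrite cE; split.
  have := sumle 1%N; rewrite /= Rplus_0_l; have := wpos 1%N; nra.
move=> eta eta0; have [X0 [X00 h]] := limI eta eta0.
exists X0; split=> // X hX; apply: Rabs_le.
have := h X hX; have := ubI X; lra.
Qed.

End PowerExpIntegral.

Lemma exists_nat_ge (x : R) : exists N : nat, forall M, le N M -> x <= INR M.
Proof.
have [N hN] := INR_unbounded x; exists N => M NM.
have := le_INR _ _ NM; lra.
Qed.

Section BernSums.
Variable k : nat.
Hypothesis hk : le 1 k.

(** The factors 1 + 1/k and 2 + 1/k are those of [RInt_scaling] with s = 1 and s = 2: the two
    constants are the limits of the integrals of G2(u^k) and G3(u^k). *)
Definition var_const : R := (1 + 1 / INR k) * c_ k.
Definition skew_const : R := (2 + 1 / INR k) * var_const.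

(** Only [C] must be uniform in eps. The threshold for [M] may depend on eps, so the boundary terms
    at X = M eps can be made as small as needed. *)
Lemma bern_sums : exists C, 0 <= C /\ forall eps, 0 < eps <= 1 ->
  exists M0, forall M, le M0 M ->
  [/\ Rabs (psum (fun m => bern ((INR m * eps) ^ k)) M - (c_ k / eps - 1 / 2)) <= C * eps,
      Rabs (psum (fun m => bernG2 ((INR m * eps) ^ k)) M - var_const / eps) <= C &
      Rabs (psum (fun m => bernG3 ((INR m * eps) ^ k)) M - skew_const / eps) <= C].
Proof.
have [C1 [C10 h1]] := sum_bern_pow_trapezoid k hk.
have [C2 [C20 h2]] := sum_bernG2_pow_bound k hk.
have [C3 [C30 h3]] := sum_bernG3_pow_bound k hk.
have [c0 lim] := c_integral k hk.
exists (C1 + C2 + C3 + 20); split; first lra.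
move=> eps [e0 e1].
(* The sums are integrals divided by eps, so accuracy eps^2 here leaves an error eps. *)
have [|X0 [X00 hX]] := lim (eps ^ 2); first exact: pow_lt.
(* From X >= 5000 / eps it follows that 5000 X / (1 + X^2) <= eps; 5000 is the constant of
   [bernG2_pow_decay]. *)
have [N hN] := exists_nat_ge ((X0 + 5000 / eps) / eps).
exists N => M NM.
have k1 : 1 <= INR k by apply: (le_INR 1).
have ik : 0 < 1 / INR k <= 1.
  split; first by apply: Rdiv_lt_0_compat; lra.
  by apply: (proj2 (Rle_div_l 1 1 (INR k) ltac:(lra))); lra.
set X := INR M * eps.
have q0 : 0 < 5000 / eps by apply: Rdiv_lt_0_compat; lra.
have hX1 : X0 + 5000 / eps <= X := proj1 (Rle_div_l _ _ _ e0) (hN M NM).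
have Xpos : 0 < X by lra.
have Xe : 5000 <= eps * X.
  have -> : 5000 = eps * (5000 / eps) by field; lra.
  by apply: Rmult_le_compat_l; lra.
have dec C : 0 <= C <= 5000 -> C / (1 + X ^ 2) * X <= eps /\ C / (1 + X ^ 2) <= eps.
  move=> hC; have X2 : 0 < 1 + X ^ 2 by nra.
  split; last by apply: (proj2 (Rle_div_l _ _ _ X2)); nra.
  have -> : C / (1 + X ^ 2) * X = C * X / (1 + X ^ 2) by field; lra.
  by apply: (proj2 (Rle_div_l _ _ _ X2)); nra.
have X0' := Rlt_le _ _ Xpos.
have b0 : 0 < bern (X ^ k) by apply: (proj1 (bern_le_1 _ _)); apply: pow_le.
have [b1 b2] : X * bern (X ^ k) <= eps /\ bern (X ^ k) <= eps.
  have [d1 d2] := dec 242 ltac:(lra); have := bern_pow_decay k hk X X0'; nra.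
have g1 : X * Rabs (bernG2 (X ^ k)) <= eps.
  have [d1 _] := dec 5000 ltac:(lra); have := bernG2_pow_decay k hk X X0'; nra.
have /Rabs_le_between iI := hX X ltac:(lra).
have /Rabs_le_between r1 := h1 eps M (conj e0 e1).
have /Rabs_le_between r2 := h2 eps M (conj e0 e1).
have /Rabs_le_between r3 := h3 eps M (conj e0 e1).
rewrite -/X in r1 r2 r3; clearbody X.
rewrite (RInt_bernG2_pow k hk X X0') in r2.
rewrite (RInt_bernG3_pow k hk X X0') (RInt_bernG2_pow k hk X X0') in r3.
set I := RInt _ 0 X in iI r1 r2 r3.
set S1 := psum _ M in r1 *; set S2 := psum _ M in r2 *; set S3 := psum _ M in r3 *.
have scale a t C : Rabs (eps * a - t) <= C * eps -> Rabs (a - t / eps) <= C.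
  move=> h; apply: (Rmult_le_reg_l eps) => //.
  rewrite -{1}(Rabs_pos_eq eps) -?Rabs_mult; last lra.
  by rewrite (_ : eps * (a - t / eps) = eps * a - t); [lra | field; lra].
have xb : 0 <= X * bern (X ^ k) / INR k <= eps.
  have : 0 <= X * bern (X ^ k) by nra.
  nra.
have xg : Rabs (X * bernG2 (X ^ k) / INR k) <= eps.
  have -> : X * bernG2 (X ^ k) / INR k = X * bernG2 (X ^ k) * (1 / INR k) by field; lra.
  rewrite Rabs_mult (Rabs_pos_eq (1 / INR k)); last lra.
  rewrite Rabs_mult (Rabs_pos_eq X) //.
  have := Rmult_le_pos _ _ X0' (Rabs_pos (bernG2 (X ^ k))); nra.
move/Rabs_le_between: xg => xg.
have G2c : - (3 * eps) <= (1 + 1 / INR k) * I - X * bern (X ^ k) / INR k - var_const <= 3 * eps.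
  rewrite /var_const.
  have -> : (1 + 1 / INR k) * I - X * bern (X ^ k) / INR k - (1 + 1 / INR k) * c_ k =
    (1 + 1 / INR k) * (I - c_ k) - X * bern (X ^ k) / INR k by ring.
  nra.
split.
- have -> : c_ k / eps - 1 / 2 = (c_ k - eps / 2) / eps by field; lra.
  have : Rabs (S1 - (c_ k - eps / 2) / eps) <= (C1 + 2) * eps.
    apply: scale; apply: Rabs_le; nra.
  nra.
- apply: Rle_trans (_ : C2 + 3 <= _); last lra.
  apply: scale; apply: Rabs_le; lra.
- apply: Rle_trans (_ : C3 + 10 <= _); last lra.
  apply: scale; rewrite /skew_const.
  set G := (1 + 1 / INR k) * I - X * bern (X ^ k) / INR k in G2c r3.
  have : - (9 * eps) <= (2 + 1 / INR k) * G - (2 + 1 / INR k) * var_const <= 9 * eps.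
    rewrite -Rmult_minus_distr_l; nra.
  move=> ?; apply: Rabs_le; lra.
Qed.

End BernSums.

(** * Minor arcs *)

(** Half of |1 - exp(i phi)|. It serves as a distance from phi to the multiples of 2 PI: even,
    periodic and subadditive, with no reduction modulo 2 PI to perform. *)
Definition half_chord (phi : R) : R := Rabs (sin (phi / 2)).

Lemma one_minus_cos phi : 1 - cos phi = 2 * half_chord phi ^ 2.
Proof.
rewrite /half_chord pow2_abs.
have -> : phi = 2 * (phi / 2) by field.
by rewrite cos_2a_sin (_ : 2 * (phi / 2) / 2 = phi / 2); [ring | field].
Qed.

Lemma half_chord_pos phi : 0 <= half_chord phi.
Proof. exact: Rabs_pos. Qed.

Lemma half_chord_add a b : half_chord (a + b) <= half_chord a + half_chord b.
Proof.
rewrite /half_chord Rdiv_plus_distr sin_plus.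
apply: Rle_trans (Rabs_triang _ _) _; rewrite !Rabs_mult.
have ca : Rabs (cos (a / 2)) <= 1 by exact: Rabs_cos_le_1.
have cb : Rabs (cos (b / 2)) <= 1 by exact: Rabs_cos_le_1.
have := Rabs_pos (sin (a / 2)); have := Rabs_pos (sin (b / 2)); nra.
Qed.

Lemma half_chord_opp a : half_chord (- a) = half_chord a.
Proof. by rewrite /half_chord (_ : - a / 2 = - (a / 2)) ?sin_neg ?Rabs_Ropp //; field. Qed.

Lemma half_chord_mul_nat n a : half_chord (INR n * a) <= INR n * half_chord a.
Proof.
elim: n => [|n IH]; first by rewrite /half_chord /= !Rmult_0_l /Rdiv Rmult_0_l sin_0 Rabs_R0; lra.
by rewrite S_INR !Rmult_plus_distr_r !Rmult_1_l; have := half_chord_add (INR n * a) a; lra.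
Qed.

Lemma half_chord_ge phi : 0 <= phi <= PI -> phi / 8 <= half_chord phi.
Proof.
move=> [p0 p1]; apply: Rle_trans (Rle_abs _).
have [] := SIN (phi / 2); [lra | lra |].
rewrite /sin_lb /sin_approx /sin_term /=.
have := PI_4; set y := phi / 2 => pi4.
have y0 : 0 <= y <= 2 by rewrite /y; lra.
have -> : phi / 8 = y / 4 by rewrite /y; field.
move=> h _; apply: Rle_trans h.
(* This is the Taylor lower bound of degree 7 for sin y, minus y / 4. It is nonnegative because y^2
   <= 4. *)
have : 0 <= y * (3 / 4 - y ^ 2 / 6 + y ^ 4 * (1 / 120 - y ^ 2 / 5040)).
  apply: Rmult_le_pos; first lra.
  have y2 : 0 <= y ^ 2 <= 4 by nra.
  have : 0 <= y ^ 4 * (1 / 120 - y ^ 2 / 5040).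
    by apply: Rmult_le_pos; [apply: pow_le; lra | lra].
  lra.
by rewrite /=; lra.
Qed.

(** * Finite differences and lower bounds for sums *)

Fixpoint fdiff (j : nat) (f : nat -> R) : nat -> R :=
  match j with O => f | S j' => fun m => fdiff j' f (S m) - fdiff j' f m end.

(** Leibniz' rule for a product with the identity, which drives the induction on the exponent in
    [fdiff_pow]. *)
Lemma fdiff_mul_id j f m :
  fdiff (S j) (fun i => INR i * f i) m =
  (INR m + INR (S j)) * fdiff (S j) f m + INR (S j) * fdiff j f m.
Proof.
elim: j m => [|j IH] m; first by rewrite /fdiff S_INR /=; ring.
change (fdiff j.+1 (fun i => INR i * f i) (S m) - fdiff j.+1 (fun i => INR i * f i) m =
  (INR m + INR (S (S j))) * (fdiff j.+1 f (S m) - fdiff j.+1 f m) +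
  INR (S (S j)) * fdiff (S j) f m).
rewrite !IH /fdiff -/fdiff !S_INR; ring.
Qed.

Lemma fdiff_pow i : (forall j m, lt i j -> fdiff j (fun m => INR m ^ i) m = 0) /\
  (forall m, fdiff i (fun m => INR m ^ i) m = INR (fact i)).
Proof.
elim: i => [|i [IH0 IH1]]; split.
- move=> j m; elim: j m => [|j IHj] m; first lia.
  move=> _; case: j IHj => [|j] IHj; first by rewrite /=; ring.
  rewrite (_ : fdiff j.+2 _ m = fdiff j.+1 (fun m => INR m ^ 0) (S m)
                                - fdiff j.+1 (fun m => INR m ^ 0) m) //.
  by rewrite !IHj; [ring | lia | lia].
- by move=> m.
- move=> [|j] m ij; first lia.
  rewrite (fdiff_mul_id j (fun m => INR m ^ i)) !IH0; [ring | lia | lia].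
- move=> m; rewrite (fdiff_mul_id i (fun m => INR m ^ i)) IH0 ?IH1; last lia.
  by rewrite fact_simpl mult_INR; ring.
Qed.

Lemma fdiff_scal j f a m : fdiff j (fun i => f i * a) m = fdiff j f m * a.
Proof. by elim: j m => [|j IH] m //=; rewrite !IH; ring. Qed.

(** A difference of order j is a signed sum of values with total weight 2^j, and [half_chord] is
    even and subadditive. *)
Lemma half_chord_fdiff j f m w :
  (forall i, le i j -> half_chord (f (m + i)%coq_nat) <= w) ->
  half_chord (fdiff j f m) <= 2 ^ j * w.
Proof.
elim: j m => [|j IH] m h.
  by rewrite /= Rmult_1_l -(Nat.add_0_r m); apply: h.
rewrite /fdiff -/fdiff /Rminus.
apply: Rle_trans (half_chord_add _ _) _; rewrite half_chord_opp.
have h1 : half_chord (fdiff j f (S m)) <= 2 ^ j * w.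
  by apply: IH => i hi; rewrite Nat.add_succ_comm; apply: (h (S i)); lia.
have h2 : half_chord (fdiff j f m) <= 2 ^ j * w by apply: IH => i hi; apply: h; lia.
by rewrite /=; lra.
Qed.

Lemma psum_add f a b :
  psum f (a + b)%coq_nat = psum f a + psum (fun m => f (a + m)%coq_nat) b.
Proof.
elim: b => [|b IH]; first by rewrite Nat.add_0_r /=; ring.
rewrite Nat.add_succ_r.
change (psum f (a + b)%coq_nat + f (S (a + b)%coq_nat) =
  psum f a + (psum (fun m => f (a + m)%coq_nat) b + f (a + S b)%coq_nat)).
by rewrite IH Nat.add_succ_r; ring.
Qed.

Lemma psum_ge_term f i b : (forall m, 0 <= f (S m)) -> lt 0 i -> le i b -> f i <= psum f b.
Proof.
move=> f0 i0 ib; apply: Rle_trans (psum_le_length f i b f0 ib).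
case: i i0 ib => [|i] i0 ib; first lia.
by rewrite /=; have := psum_nonneg f i f0; lra.
Qed.

Lemma psum_ge_blocks f K w q : (forall m, 0 <= f (S m)) ->
  (forall m, exists i, [/\ lt 0 i, le i K & w <= f (m + i)%coq_nat]) ->
  INR q * w <= psum f (q * K)%coq_nat.
Proof.
move=> f0 blk; elim: q => [|q IH]; first by rewrite /= Rmult_0_l; lra.
rewrite Nat.mul_succ_l psum_add S_INR.
set a := (q * K)%coq_nat in IH *.
have [i [i0 iK wi]] := blk a.
have h : f (a + i)%coq_nat <= psum (fun m => f (a + m)%coq_nat) K.
  apply: (psum_ge_term (fun m => f (a + m)%coq_nat)) => // m.
  by rewrite Nat.add_succ_r; exact: f0.
lra.
Qed.

Lemma psum_ge_progression f Q J : (forall m, 0 <= f (S m)) -> le 1 Q ->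
  psum (fun j => f (1 + Q * j)%coq_nat) J <= psum f (1 + Q * J)%coq_nat.
Proof.
move=> f0 Q1; elim: J => [|J IH]; first exact: psum_nonneg.
have mono := psum_le_length f (1 + Q * J)%coq_nat (Q * S J)%coq_nat f0 ltac:(nia).
change (psum (fun j => f (1 + Q * j)%coq_nat) J + f (1 + Q * S J)%coq_nat <=
  psum f (Q * S J)%coq_nat + f (S (Q * S J)%coq_nat)).
have -> : S (Q * S J)%coq_nat = (1 + Q * S J)%coq_nat by lia.
lra.
Qed.

Lemma pow_mod_1 (Q j k : nat) : exists t, (Nat.pow (1 + Q * j) k = 1 + Q * t)%coq_nat.
Proof.
elim: k => [|k [t IH]]; first by exists 0%N; rewrite /=; lia.
by exists (t + j + Q * j * t)%coq_nat; rewrite Nat.pow_succ_r' IH; nia.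
Qed.

Lemma psum_ge_const g d w : (forall i, le 1 i -> le i d -> w <= g i) ->
  INR d * w <= psum g d.
Proof.
elim: d => [|d IH] h; first by rewrite /=; lra.
rewrite S_INR /psum -/(psum g d).
have := IH (fun i i1 id => h i i1 ltac:(lia)); have := h (S d) ltac:(lia) ltac:(lia); lra.
Qed.

Section MinorArc.
Variables (k : nat) (theta : R).

Let Q := fact k.
Let s := half_chord (INR Q * theta).
Let f (m : nat) : R := 1 - cos (INR m ^ k * theta).

Let f0 m : 0 <= f m.
Proof. by rewrite /f; have := COS_bound (INR m ^ k * theta); lra. Qed.

Let f_ge m w : 0 <= w -> w <= half_chord (INR m ^ k * theta) -> 2 * w ^ 2 <= f m.
Proof. by move=> w0 h; rewrite /f one_minus_cos; have := pow_incr _ _ 2 (conj w0 h); lra. Qed.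

Let Q1 : le 1 Q.
Proof. exact: lt_O_fact. Qed.

(** Every block of k + 1 consecutive m holds one with m^k theta far from the multiples of 2 PI.
    Otherwise the k-th difference k! theta would have half-chord at most s / 2 instead of s. *)
Lemma minor_arc_differences q N : le (q * S k)%coq_nat N ->
  INR q * (2 * (s / 2 ^ S k) ^ 2) <= psum f N.
Proof.
move=> qN; apply: Rle_trans (psum_le_length f _ _ (fun m => f0 _) qN).
have s0 : 0 <= s := half_chord_pos _.
have p0 : 0 < 2 ^ S k by apply: pow_lt; lra.
have w0 : 0 <= s / 2 ^ S k by apply: Rle_mult_inv_pos.
apply: psum_ge_blocks => // m.
apply: NNPP => no.
have small i : le i k -> half_chord (INR ((m + 1) + i)%coq_nat ^ k * theta) < s / 2 ^ S k.
  move=> ik; apply: Rnot_le_lt => h; apply: no; exists (S i); split; [lia | lia |].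
  have -> : (m + S i = m + 1 + i)%coq_nat by lia.
  exact: f_ge.
have := half_chord_fdiff k (fun i => INR i ^ k * theta) (m + 1)%coq_nat (s / 2 ^ S k)
   (fun i ik => Rlt_le _ _ (small i ik)).
rewrite fdiff_scal (proj2 (fdiff_pow k)) -/Q -/s.
have -> : 2 ^ k * (s / 2 ^ S k) = s / 2.
  by rewrite (_ : 2 ^ S k = 2 * 2 ^ k) //; field; apply: pow_nonzero; lra.
(* The strict inequality in [small] excludes s = 0, for which s <= s / 2 would be no
   contradiction. *)
have := small 0%N (Nat.le_0_l k); have := half_chord_pos (INR (m + 1 + 0)%coq_nat ^ k * theta).
move=> h1 h2 h3.
have : 0 < s / 2 ^ S k by lra.
move/(Rmult_lt_0_compat _ _ p0); rewrite (_ : 2 ^ S k * (s / 2 ^ S k) = s); [lra | field; lra].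
Qed.

(* On [m = 1 + Q j] we have [m^k theta = theta] up to a multiple of [Q theta]. *)
Lemma minor_arc_progression J N : le 1 J -> le (1 + Q * J)%coq_nat N ->
  / INR Q <= theta <= PI -> s * (INR (1 + Q)%coq_nat * INR J) ^ k <= / (16 * INR Q) ->
  INR J * (2 * (/ (16 * INR Q)) ^ 2) <= psum f N.
Proof.
move=> J1 QJN [t0 t1] hs; apply: Rle_trans (psum_le_length f _ _ (fun m => f0 _) QJN).
apply: Rle_trans (psum_ge_progression f Q J (fun m => f0 _) Q1).
have q0 : 0 < INR Q by apply: lt_0_INR; lia.
have i0 : 0 < / INR Q by apply: Rinv_0_lt_compat.
apply: psum_ge_const => j j1 jJ; apply: f_ge.
  by apply: Rlt_le; apply: Rinv_0_lt_compat; lra.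
have [t ht] := pow_mod_1 Q j k.
have s0 : 0 <= s := half_chord_pos _.
rewrite -pow_INR ht plus_INR mult_INR.
have tle : INR t <= (INR (1 + Q)%coq_nat * INR J) ^ k.
  rewrite -mult_INR -pow_INR; apply: le_INR.
  have : le (Nat.pow (1 + Q * j) k) (Nat.pow ((1 + Q) * J) k) by apply: Nat.pow_le_mono_l; nia.
  by rewrite ht => h; apply: Nat.le_trans h; nia.
have h1 : half_chord theta <= half_chord ((INR 1 + INR Q * INR t) * theta) + INR t * s.
  have e : theta = (INR 1 + INR Q * INR t) * theta + - (INR t * (INR Q * theta)).
    by rewrite /=; ring.
  rewrite {1}e; apply: Rle_trans (half_chord_add _ _) _; rewrite half_chord_opp.
  by have := half_chord_mul_nat t (INR Q * theta); rewrite -/s; lra.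
have h2 := half_chord_ge theta ltac:(lra).
have h3 : INR t * s <= / (16 * INR Q).
  by apply: Rle_trans hs; rewrite Rmult_comm; apply: Rmult_le_compat_l.
(* The half-chord of theta is at least 1 / (8 Q); half of this may be lost to the multiple of Q
   theta. *)
have -> : / (16 * INR Q) = / INR Q / 8 - / (16 * INR Q) by field; lra.
lra.
Qed.

Lemma largest_below J N : le J N -> theta * INR J ^ k <= 1 -> exists m,
  [/\ le J m, le m N, theta * INR m ^ k <= 1 & m = N \/ 1 < theta * INR (S m) ^ k].
Proof.
move=> JN; move: {2}(N - J)%coq_nat (erefl (N - J)%coq_nat) => d.
elim: d J JN => [|d IH] J JN e h.
  by exists J; split => //; left; lia.
case: (Rle_dec (theta * INR (S J) ^ k) 1) => h'.
  by have [||m [m1 m2 m3 m4]] := IH (S J) _ _ h'; [lia | lia | exists m; split => //; lia].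
by exists J; split => //; right; lra.
Qed.

(** Let m be the last index up to [N] with theta m^k <= 1. In the upper half of 1, ..., m the angles
    lie between tau / 2^k and 1, where the half-chord is bounded below. *)
Lemma minor_arc_small J N tau : le 1 J -> le J N -> 0 <= theta ->
  0 < tau <= 1 -> tau <= theta * INR (S N) ^ k -> theta * INR J ^ k <= 1 ->
  INR J / 2 * (2 * (tau / 2 ^ k / 8) ^ 2) <= psum f N.
Proof.
move=> J1 JN t0 [tau0 tau1] htau hJ.
have [m [Jm mN hm hmax]] := largest_below J N JN hJ.
have p0 : 0 < 2 ^ k by apply: pow_lt; lra.
have hS : tau <= theta * INR (S m) ^ k by case: hmax => [->|] //; lra.
apply: Rle_trans (psum_le_length f _ _ (fun m => f0 _) mN).
(* The upper half is h < i <= m; the bound m <= 2 h + 1 yields m + 1 <= 2 i there. *)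
have [h [d [e [h1 h2]]]] : exists h d,
    (m = h + d /\ le m (2 * d) /\ le m (2 * h + 1))%coq_nat.
  exists (Nat.div2 m), (m - Nat.div2 m)%coq_nat.
  by have := Nat.div2_odd m; case: (Nat.odd m) => /=; lia.
rewrite {1}e psum_add.
have w0 : 0 <= tau / 2 ^ k / 8 by apply: Rle_mult_inv_pos; [apply: Rle_mult_inv_pos; lra | lra].
set w := 2 * _.
have w00 : 0 <= w by rewrite /w; have := pow2_ge_0 (tau / 2 ^ k / 8); lra.
have : INR d * w <= psum (fun i => f (h + i)%coq_nat) d.
  apply: psum_ge_const => i i1 id; apply: f_ge => //.
  set y := INR (h + i)%coq_nat.
  have y0 : 0 <= y := pos_INR _.
  have ym : y ^ k <= INR m ^ k by apply: pow_incr; split => //; apply: le_INR; lia.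
  have yS : INR (S m) ^ k <= 2 ^ k * y ^ k.
    rewrite -Rpow_mult_distr; apply: pow_incr; split; first exact: pos_INR.
    by rewrite /y (_ : 2 = INR 2) // -mult_INR; apply: le_INR; lia.
  have b1 : tau / 2 ^ k <= y ^ k * theta.
    apply: (proj2 (Rle_div_l _ _ _ p0)); nra.
  have b2 : y ^ k * theta <= 1 by nra.
  have := half_chord_ge (y ^ k * theta); have := PI2_1; lra.
have : INR J / 2 * w <= INR d * w.
  apply: Rmult_le_compat_r => //.
  have := le_INR _ _ Jm; have := le_INR _ _ h1; rewrite mult_INR /=; lra.
have := psum_nonneg f h (fun m => f0 _); lra.
Qed.

End MinorArc.

(** The case split is on the half-chord of k! theta against kappa / J^k. Above it, J^(3k) blocks
    contribute J^(-2k) each, hence J^k >= J in total. Below it, theta is either at least 1 / k!,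
    giving J terms of a progression, or so small that theta J^k <= 1. The exponent 4 k makes room
    for J^(3k) (k + 1) terms; any power of [N] would do, since the result is exponentiated. *)
Lemma minor_arc k tau : le 1 k -> 0 < tau <= 1 -> exists c J0, 0 < c /\
  forall J N theta, le J0 J -> INR J ^ (4 * k)%coq_nat <= INR N ->
  tau <= theta * INR (S N) ^ k -> 0 <= theta <= PI ->
  c * INR J <= psum (fun m => 1 - cos (INR m ^ k * theta)) N.
Proof.
move=> hk [tau0 tau1].
pose Q := fact k; pose q := INR Q; pose p := INR (1 + Q)%coq_nat.
have Q1 : le 1 Q by exact: lt_O_fact.
have q1 : 1 <= q by apply: (le_INR 1).
have p1 : 1 <= p by apply: (le_INR 1); lia.
have pk0 : 0 < p ^ k by apply: pow_lt; lra.
have t2 : 0 < 2 ^ k by apply: pow_lt; lra.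
(* Chosen so that s <= kappa / J^k is exactly what [minor_arc_progression] asks of s. *)
pose kappa := / (16 * q * p ^ k).
have kap0 : 0 < kappa by apply: Rinv_0_lt_compat; apply: Rmult_lt_0_compat; lra.
pose c1 := 2 * (kappa / 2 ^ S k) ^ 2.
pose c2 := 2 * (/ (16 * q)) ^ 2.
pose c3 := / 2 * (2 * (tau / 2 ^ k / 8) ^ 2).
have sq x : 0 < x -> 0 < 2 * x ^ 2 by move=> x0; have := pow_lt x 2 x0; lra.
have c10 : 0 < c1.
  by apply: sq; apply: Rdiv_lt_0_compat => //; apply: pow_lt; lra.
have c20 : 0 < c2 by apply: sq; apply: Rinv_0_lt_compat; lra.
have c30 : 0 < c3.
  by apply: Rmult_lt_0_compat; [lra | apply: sq; apply: Rdiv_lt_0_compat; [exact: Rdiv_lt_0_compat | lra]].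
pose c := Rmin c1 (Rmin c2 c3).
have cle : c <= c1 /\ c <= c2 /\ c <= c3.
  by rewrite /c; have := Rmin_l c1 (Rmin c2 c3); have := Rmin_r c1 (Rmin c2 c3);
     have := Rmin_l c2 c3; have := Rmin_r c2 c3; lra.
(* J >= 2 + k! gives 1 + k! J <= J^2 <= N for the progression and k + 1 <= 2^k <= J^k for the
   blocks. *)
exists c, (2 + Q)%coq_nat; split; first by rewrite /c; do 2!(apply: Rmin_pos => //).
move=> J N theta hJ JN htau [t0 t1].
have JN' : le (Nat.pow J (4 * k)%coq_nat) N by apply: INR_le; rewrite pow_INR.
have JNat : le (J * J)%coq_nat N.
  apply: Nat.le_trans JN'; rewrite (_ : J * J = Nat.pow J 2)%coq_nat; last by rewrite /=; lia.
  by apply: Nat.pow_le_mono_r; lia.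
have J1 : 1 <= INR J by apply: (le_INR 1); lia.
have Jk0 : 0 < INR J ^ k by apply: pow_lt; lra.
have Jk1 : INR J <= INR J ^ k by rewrite -{1}(pow_1 (INR J)); apply: Rle_pow; [lra | exact: hk].
case: (Rle_dec (kappa / INR J ^ k) (half_chord (q * theta))) => hs.
  have hblk : le (Nat.pow J (3 * k)%coq_nat * S k)%coq_nat N.
    apply: Nat.le_trans JN'; rewrite (_ : 4 * k = 3 * k + k)%coq_nat; last by lia.
    rewrite Nat.pow_add_r; apply: Nat.mul_le_mono_l.
    apply: (Nat.le_trans _ (Nat.pow 2 k)); last by apply: Nat.pow_le_mono_l; lia.
    by have := Nat.pow_gt_lin_r 2 k ltac:(lia); lia.
  apply: Rle_trans (minor_arc_differences k theta _ _ hblk).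
  rewrite pow_INR -/Q -/q.
  have e : 2 * (half_chord (q * theta) / 2 ^ S k) ^ 2 >= c1 * / (INR J ^ k) ^ 2.
    apply: Rle_ge; rewrite /c1.
    have -> : 2 * (kappa / 2 ^ S k) ^ 2 * / (INR J ^ k) ^ 2 =
              2 * (kappa / INR J ^ k / 2 ^ S k) ^ 2.
      by field; split; [lra | apply: pow_nonzero; lra].
    apply: Rmult_le_compat_l; first lra.
    have t2' : 0 < 2 ^ S k by apply: pow_lt; lra.
    apply: pow_incr; split; first by apply: Rlt_le; do 2!(apply: Rdiv_lt_0_compat => //).
    by apply: Rmult_le_compat_r => //; apply: Rlt_le; exact: Rinv_0_lt_compat.
  apply: Rle_trans (_ : INR J ^ (3 * k)%coq_nat * (c1 * / (INR J ^ k) ^ 2) <= _); last first.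
    by apply: Rmult_le_compat_l; [apply: pow_le; lra | lra].
  have -> : INR J ^ (3 * k)%coq_nat * (c1 * / (INR J ^ k) ^ 2) = c1 * INR J ^ k.
    by rewrite (Nat.mul_comm 3) pow_mult; field; lra.
  nra.
case: (Rle_dec (/ q) theta) => ht.
  have hprog : le (1 + Q * J)%coq_nat N by nia.
  apply: Rle_trans (minor_arc_progression k theta J N _ hprog _ _); first by rewrite -/Q -/q -/c2; nra.
  - by lia.
  - by rewrite -/Q -/q.
  rewrite -/Q -/q -/p Rpow_mult_distr.
  have -> : / (16 * q) = kappa / INR J ^ k * (p ^ k * INR J ^ k).
    by rewrite /kappa; field; lra.
  by apply: Rmult_le_compat_r; [apply: Rmult_le_pos; lra | lra].
have qt : q * theta <= 1.
  have -> : 1 = q * / q by field; lra.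
  by apply: Rmult_le_compat_l; lra.
(* As 0 <= q theta <= 1 < PI, a small half-chord of q theta means that theta itself is small, not
   only close to a multiple of 2 PI / q. *)
have hJt : theta * INR J ^ k <= 1.
  have h := half_chord_ge (q * theta); have pi1 := PI2_1.
  have h' : q * theta / 8 <= kappa / INR J ^ k.
    by apply: Rle_trans (h _) _; [split; nra | lra].
  have h2 : theta <= 8 * (kappa / INR J ^ k) by nra.
  have k1 : kappa <= / 16.
    by apply: Rinv_le_contravar; [lra | have := pow_R1_Rle p k p1; nra].
  apply: Rle_trans (Rmult_le_compat_r _ _ _ (Rlt_le _ _ Jk0) h2) _.
  have -> : 8 * (kappa / INR J ^ k) * INR J ^ k = 8 * kappa by field; lra.
  lra.
apply: Rle_trans (minor_arc_small k theta J N tau _ _ _ _ _ _) => //.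
- have -> : INR J / 2 * (2 * (tau / 2 ^ k / 8) ^ 2) = c3 * INR J by rewrite /c3; field; lra.
  nra.
- lia.
- nia.
Qed.

(** * Gaussian moments and Laplace's method *)

Lemma Rabs_exp_minus_1 (x : R) : Rabs (exp x - 1) <= Rabs x * exp (Rabs x).
Proof.
have h1 := exp_ineq1_le x; have h2 := exp_ineq1_le (- x).
have e : exp x * exp (- x) = 1 by rewrite -exp_plus Rplus_opp_r exp_0.
case: (Rle_dec 0 x) => x0.
  rewrite (Rabs_pos_eq x) // Rabs_pos_eq; nra.
rewrite (Rabs_left x); last lra.
have : exp x < 1 by rewrite -exp_0; apply: exp_increasing; lra.
move=> ?; rewrite Rabs_left; nra.
Qed.

Lemma Rabs_cos_minus_1 x : Rabs (cos x - 1) <= x ^ 2.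
Proof.
case: (Rle_dec 0 x) => x0; first by have [] := cos_sin_taylor x x0.
have [_ h _ _ _] := cos_sin_taylor (- x) ltac:(lra).
by move: h; rewrite cos_neg (_ : (- x) ^ 2 = x ^ 2) //; ring.
Qed.

Lemma Rabs_sin_minus_id x : Rabs (sin x - x) <= Rabs x ^ 3.
Proof.
case: (Rle_dec 0 x) => x0.
  by have [_ _ h _ _] := cos_sin_taylor x x0; rewrite (Rabs_pos_eq x).
have [_ _ h _ _] := cos_sin_taylor (- x) ltac:(lra).
rewrite (Rabs_left x); last lra.
by move: h; rewrite sin_neg (_ : - sin x - - x = - (sin x - x)) ?Rabs_Ropp //; ring.
Qed.

Section Gaussian.
Variable B : R.
Hypothesis B0 : 0 < B.

Definition gauss (s : R) : R := exp (- (B * s ^ 2 / 2)).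

Lemma continuous_gauss_pow n s : continuous (fun s => s ^ n * gauss s) s.
Proof.
by apply: (ex_derive_continuous (fun s => s ^ n * gauss s)); rewrite /gauss; auto_derive.
Qed.

Definition gauss_moment (n : nat) (S : R) : R := RInt (fun s => s ^ n * gauss s) 0 S.

Lemma ex_RInt_gauss_pow n a b : ex_RInt (fun s => s ^ n * gauss s) a b.
Proof. by apply: ex_RInt_of_continuous => s; exact: continuous_gauss_pow. Qed.

(** Integration by parts. The range ends at a finite [S], so the boundary term stays until
    [gauss_tail] disposes of it. *)
Lemma gauss_moment_rec n S :
  gauss_moment (n + 2)%coq_nat S =
  (INR (n + 1)%coq_nat * gauss_moment n S - S ^ (n + 1)%coq_nat * gauss S) / B.
Proof.
pose F s := - (s ^ (n + 1)%coq_nat * gauss s).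
pose dF s := B * (s ^ (n + 2)%coq_nat * gauss s) - INR (n + 1)%coq_nat * (s ^ n * gauss s).
have der s : is_derive F s (dF s).
  rewrite /F /dF /gauss; auto_derive => //.
  rewrite (_ : Nat.pred (n + 1) = n)%coq_nat; last by lia.
  by move: (INR (n + 1)%coq_nat) => c; rewrite !pow_add /= /Rdiv; field.
have cdF s : continuous dF s.
  by apply: (ex_derive_continuous dF); rewrite /dF /gauss; auto_derive.
have h := is_RInt_derive F dF 0 S (fun s _ => der s) (fun s _ => cdF s).
have h1 := is_RInt_scal _ _ _ B _ (RInt_correct _ _ _ (ex_RInt_gauss_pow (n + 2)%coq_nat 0 S)).
have h2 := is_RInt_scal _ _ _ (INR (n + 1)%coq_nat) _ (RInt_correct _ _ _ (ex_RInt_gauss_pow n 0 S)).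
have e := is_RInt_unique _ _ _ _ (is_RInt_minus _ _ _ _ _ _ h1 h2).
move: (is_RInt_unique _ _ _ _ h).
rewrite [X in X = _](_ : _ = B * gauss_moment (n + 2)%coq_nat S -
  INR (n + 1)%coq_nat * gauss_moment n S); last exact: e.
rewrite /minus /plus /opp /= /F pow_i; last by lia.
move=> e'; apply: (Rmult_eq_reg_l B); last lra.
field_simplify; [nra | lra].
Qed.

(** The exponent B s^2 / 4 is half that of [gauss]: this is what survives when the error in the
    logarithmic modulus may take up the other half. *)
Lemma gauss_decay n : exists G, 0 < G /\
  forall s, (1 + s ^ 2) ^ n * exp (- (B * s ^ 2 / 4)) <= G.
Proof.
pose G := (4 / B) ^ n * INR (fact n) * exp (B / 4).
have b4 : 0 < 4 / B by apply: Rdiv_lt_0_compat; lra.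
exists G; split.
  apply: Rmult_lt_0_compat; last exact: exp_pos.
  by apply: Rmult_lt_0_compat; [exact: pow_lt | exact: INR_fact_lt_0].
move=> s; have s2 := pow2_ge_0 s.
have := pow_le_exp n (B / 4 * (1 + s ^ 2)) ltac:(nra).
rewrite Rpow_mult_distr => h.
have e : exp (B / 4 * (1 + s ^ 2)) * exp (- (B * s ^ 2 / 4)) = exp (B / 4).
  by rewrite -exp_plus; congr exp; field.
have e1 : (4 / B) ^ n * (B / 4) ^ n = 1.
  by rewrite -Rpow_mult_distr (_ : 4 / B * (B / 4) = 1) ?pow1 //; field; lra.
have p0 := pow_lt _ n b4.
have g0 := exp_pos (- (B * s ^ 2 / 4)).
have -> : (1 + s ^ 2) ^ n * exp (- (B * s ^ 2 / 4)) =
    ((4 / B) ^ n * ((B / 4) ^ n * (1 + s ^ 2) ^ n)) * exp (- (B * s ^ 2 / 4)).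
  by rewrite -(Rmult_assoc ((4 / B) ^ n)) e1; ring.
have -> : G = ((4 / B) ^ n * (INR (fact n) * exp (B / 4 * (1 + s ^ 2)))) * exp (- (B * s ^ 2 / 4)).
  by rewrite /G -e; ring.
apply: Rmult_le_compat_r; first lra.
by apply: Rmult_le_compat_l; lra.
Qed.

End Gaussian.

Lemma Rabs_mul_le (a b x y : R) : Rabs a <= x -> Rabs b <= y -> Rabs (a * b) <= x * y.
Proof.
by move=> h1 h2; rewrite Rabs_mult; apply: Rmult_le_compat => //; exact: Rabs_pos.
Qed.

(* Laplace's method with an explicit first-order correction: [L] and [psi] are
   the logarithmic modulus and the phase in the variable [s] of unit scale. *)
Section Laplace.
Variables (B D C G : R).
Hypotheses (B0 : 0 < B) (C0 : 0 <= C) (G0 : 0 < G).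
(** The largest power of 1 + s^2 spent below is the tenth, in [sin_bound], and one more factor is
    turned into the integrable 1 / (1 + s^2); 13 leaves slack. *)
Hypothesis decay : forall s, (1 + s ^ 2) ^ 13 * exp (- (B * s ^ 2 / 4)) <= G.
Variables (tau eta : R) (L psi : R -> R).
Hypotheses (tau01 : 0 < tau <= 1) (tauC : C * tau ^ 2 <= B / 8).
Hypotheses (eta01 : 0 < eta <= 1) (etaC : C * eta ^ 2 <= B / 8) (eta_tau : eta <= tau).
Hypotheses (cL : forall s, continuous L s) (cpsi : forall s, continuous psi s).
Let S := tau / eta.
Hypothesis hL : forall s, 0 <= s <= S ->
  Rabs (L s + B * s ^ 2 / 2) <= C * eta ^ 2 * (s ^ 2 + s ^ 4).
Hypothesis hpsi : forall s, 0 <= s <= S ->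
  Rabs (psi s + eta * (s / 2 + D * s ^ 3 / 6)) <= C * eta ^ 3 * (s + s ^ 3 + s ^ 5).

Let S0 : 0 < S.
Proof. by apply: Rdiv_lt_0_compat; lra. Qed.

Let etaS : eta * S = tau.
Proof. by rewrite /S; field; lra. Qed.

(** Common majorants: powers of [w] for the polynomials in s, [g] for both exp(L s) and the
    Gaussian, [P1] for the cubic part of the phase, [A] for the whole phase divided by eta. *)
Let w (s : R) := 1 + s ^ 2.
Let g (s : R) := exp (- (B * s ^ 2 / 4)).
Let P1 := 1 + Rabs D.
Let A := P1 + C.

Let P1_ge : 1 <= P1.
Proof. by rewrite /P1; have := Rabs_pos D; lra. Qed.

Let w_ge s : 1 <= w s.
Proof. by rewrite /w; have := pow2_ge_0 s; lra. Qed.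

Let poly_bounds s : 0 <= s ->
  [/\ s <= w s, s ^ 2 <= w s, s ^ 2 + s ^ 4 <= w s ^ 2, s + s ^ 3 + s ^ 5 <= w s ^ 3 &
      s ^ 3 <= w s ^ 2].
Proof.
move=> s0; rewrite /w; have s2 := pow2_ge_0 s; have q := pow2_ge_0 (s - 1).
have s3 := pow_le s 3 s0; have s4 := pow_le s 4 s0; have s5 := pow_le s 5 s0.
have s6 := pow_le s 6 s0.
have e1 : 0 <= s ^ 2 * (s - 1) ^ 2 by apply: Rmult_le_pos.
have e2 : 0 <= s ^ 4 * (s - 1) ^ 2 by apply: Rmult_le_pos.
by rewrite /= in s2 q s3 s4 s5 s6 e1 e2 *; split; nra.
Qed.

(** The conditions C eta^2 <= B / 8 and C tau^2 <= B / 8 are made for this: the terms in s^2 and s^4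
    = s^2 s^2 with eta s <= tau each take at most a quarter of the Gaussian exponent. *)
Let R_bound s : 0 <= s <= S -> Rabs (L s + B * s ^ 2 / 2) <= B * s ^ 2 / 4.
Proof.
move=> hs; apply: Rle_trans (hL s hs) _.
have es : 0 <= eta * s <= tau by rewrite -etaS; nra.
have s2 := pow2_ge_0 s.
have e2 : (eta * s) ^ 2 <= tau ^ 2 by apply: pow_incr.
have -> : C * eta ^ 2 * (s ^ 2 + s ^ 4) = (C * eta ^ 2 + C * (eta * s) ^ 2) * s ^ 2 by ring.
have : C * (eta * s) ^ 2 <= B / 8 by apply: Rle_trans tauC; apply: Rmult_le_compat_l.
move=> h; have -> : B * s ^ 2 / 4 = (B / 8 + B / 8) * s ^ 2 by field.
by apply: Rmult_le_compat_r; lra.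
Qed.

Let gauss_le_g s : gauss B s <= g s.
Proof.
by apply: exp_le_exp; have := pow2_ge_0 s; nra.
Qed.

Let g_pos s : 0 < g s.
Proof. exact: exp_pos. Qed.

Let expL_le s : 0 <= s <= S -> exp (L s) <= g s.
Proof.
move=> hs; apply: exp_le_exp; have /Rabs_le_between := R_bound s hs; lra.
Qed.

Let expL_sub s : 0 <= s <= S ->
  Rabs (exp (L s) - gauss B s) <= C * eta ^ 2 * w s ^ 2 * g s.
Proof.
move=> hs; set r := L s + B * s ^ 2 / 2.
have -> : exp (L s) - gauss B s = gauss B s * (exp r - 1).
  by rewrite Rmult_minus_distr_l Rmult_1_r /gauss -exp_plus /r; congr (_ - _); congr exp; ring.
have ga := exp_pos (- (B * s ^ 2 / 2)).
rewrite Rabs_mult (Rabs_pos_eq (gauss B s)); last exact: Rlt_le.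
have rb := R_bound s hs; rewrite -/r in rb.
apply: Rle_trans (_ : gauss B s * (Rabs r * exp (B * s ^ 2 / 4)) <= _).
  apply: Rmult_le_compat_l; first exact: Rlt_le.
  apply: Rle_trans (Rabs_exp_minus_1 r) _; apply: Rmult_le_compat_l; first exact: Rabs_pos.
  exact: exp_le_exp.
have -> : gauss B s * (Rabs r * exp (B * s ^ 2 / 4)) = Rabs r * g s.
  have -> : g s = gauss B s * exp (B * s ^ 2 / 4).
    by rewrite /g /gauss -exp_plus; congr exp; field.
  by ring.
apply: Rmult_le_compat_r; first exact: Rlt_le.
apply: Rle_trans (hL s hs) _.
have [_ _ h _ _] := poly_bounds s (proj1 hs).
by apply: Rmult_le_compat_l => //; apply: Rmult_le_pos => //; exact: pow2_ge_0.
Qed.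

Let psi_sub s : 0 <= s <= S ->
  Rabs (psi s + eta * (s / 2 + D * s ^ 3 / 6)) <= C * eta ^ 3 * w s ^ 3.
Proof.
move=> hs; apply: Rle_trans (hpsi s hs) _.
have [_ _ _ h _] := poly_bounds s (proj1 hs).
by apply: Rmult_le_compat_l => //; apply: Rmult_le_pos => //; apply: pow_le; lra.
Qed.

Let P_bound s : 0 <= s -> Rabs (s / 2 + D * s ^ 3 / 6) <= P1 * w s ^ 2.
Proof.
move=> s0; have [h1 _ _ _ h3] := poly_bounds s s0.
have w1 := w_ge s.
have h : Rabs (D * s ^ 3 / 6) <= Rabs D * w s ^ 2.
  have -> : D * s ^ 3 / 6 = D * (s ^ 3 / 6) by field.
  apply: Rabs_mul_le; first lra.
  have := pow_le s 3 s0 => s3; rewrite Rabs_pos_eq; lra.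
apply: Rle_trans (Rabs_triang _ _) _; rewrite (Rabs_pos_eq (s / 2)); last lra.
rewrite /P1; nra.
Qed.

Let psi_bound s : 0 <= s <= S -> Rabs (psi s) <= eta * A * w s ^ 3.
Proof.
move=> hs; have h1 := psi_sub s hs; have h2 := P_bound s (proj1 hs).
have w1 := w_ge s.
have -> : psi s = (psi s + eta * (s / 2 + D * s ^ 3 / 6)) + - (eta * (s / 2 + D * s ^ 3 / 6)).
  by ring.
apply: Rle_trans (Rabs_triang _ _) _; rewrite Rabs_Ropp Rabs_mult (Rabs_pos_eq eta); last lra.
have w3 : 0 <= w s ^ 3 by apply: pow_le; lra.
have h3 : eta * Rabs (s / 2 + D * s ^ 3 / 6) <= eta * (P1 * w s ^ 3).
  apply: Rmult_le_compat_l; first lra.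
  apply: Rle_trans h2 _; apply: Rmult_le_compat_l; first lra.
  by apply: Rle_pow => //; lia.
have h4 : C * eta ^ 3 * w s ^ 3 <= eta * C * w s ^ 3.
  apply: Rmult_le_compat_r => //; have : eta ^ 3 <= eta.
    by rewrite -{2}(pow_1 eta) /=; nra.
  nra.
rewrite /A; nra.
Qed.

Let wg_decay n s : le n 12 -> w s ^ n * g s <= G / (1 + s ^ 2).
Proof.
move=> n12; have w1 := w_ge s; have g0 := g_pos s.
apply: (proj1 (Rle_div_r _ _ _ _)); first by rewrite -/(w s); lra.
apply: Rle_trans (decay s); rewrite -/(w s) -/(g s).
have -> : w s ^ n * g s * w s = (w s ^ n * w s) * g s by ring.
apply: Rmult_le_compat_r; first lra.
rewrite -[X in w s ^ n * X]pow_1 -pow_add; apply: Rle_pow => //; lia.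
Qed.

Let wg_bound c n s : 0 <= c -> le n 12 -> c * w s ^ n * g s <= c * G / (1 + s ^ 2).
Proof.
move=> c0 n12; rewrite Rmult_assoc /Rdiv Rmult_assoc.
by apply: Rmult_le_compat_l => //; exact: wg_decay.
Qed.

Let cos_bound n s : 0 <= s <= S -> le n 3 ->
  Rabs (exp (L s) * cos (psi s) - gauss B s) * w s ^ n <=
  eta ^ 2 * (A ^ 2 + C) * G / (1 + s ^ 2).
Proof.
move=> hs n3; have w1 := w_ge s; have g0 := g_pos s; have L0 := exp_pos (L s).
have c0 : 0 <= eta ^ 2 * (A ^ 2 + C).
  by have := pow2_ge_0 eta; have := pow2_ge_0 A; nra.
apply: Rle_trans (wg_bound _ (6 + n)%coq_nat s c0 ltac:(lia)).
rewrite pow_add.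
have -> : eta ^ 2 * (A ^ 2 + C) * (w s ^ 6 * w s ^ n) * g s =
  (eta ^ 2 * (A ^ 2 + C) * w s ^ 6 * g s) * w s ^ n by ring.
apply: Rmult_le_compat_r; first by apply: pow_le; lra.
have -> : exp (L s) * cos (psi s) - gauss B s =
  exp (L s) * (cos (psi s) - 1) + (exp (L s) - gauss B s) by ring.
apply: Rle_trans (Rabs_triang _ _) _.
have h1 : Rabs (exp (L s) * (cos (psi s) - 1)) <= g s * (eta * A * w s ^ 3) ^ 2.
  apply: Rabs_mul_le; first by rewrite Rabs_pos_eq; [exact: expL_le | lra].
  apply: Rle_trans (Rabs_cos_minus_1 _) _; rewrite -pow2_abs.
  by apply: pow_incr; split; [exact: Rabs_pos | exact: psi_bound].
have h2 : C * eta ^ 2 * w s ^ 2 * g s <= C * eta ^ 2 * w s ^ 6 * g s.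
  apply: Rmult_le_compat_r; first lra.
  apply: Rmult_le_compat_l; last by apply: Rle_pow => //; lia.
  by apply: Rmult_le_pos => //; exact: pow2_ge_0.
have h3 := expL_sub s hs.
apply: Rle_trans (Rplus_le_compat _ _ _ _ h1 (Rle_trans _ _ _ h3 h2)) _.
by right; ring.
Qed.

(** Three replacements, each costing eta^3: sin psi by psi, psi by its polynomial, and exp(L s) by
    the Gaussian. In the last, eta^2 comes from [expL_sub] and eta from the polynomial. *)
Let sin_bound s : 0 <= s <= S ->
  Rabs (exp (L s) * (s * sin (psi s)) + eta * (gauss B s * (s * (s / 2 + D * s ^ 3 / 6)))) <=
  eta ^ 3 * (A ^ 3 + C + C * P1) * G / (1 + s ^ 2).
Proof.
move=> hs; have w1 := w_ge s; have g0 := g_pos s; have L0 := exp_pos (L s).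
have A0 : 0 <= A by rewrite /A; lra.
have e3 : 0 <= eta ^ 3 by apply: pow_le; lra.
have c0 : 0 <= eta ^ 3 * (A ^ 3 + C + C * P1).
  by apply: Rmult_le_pos => //; have := pow_le A 3 A0; nra.
apply: Rle_trans (wg_bound _ 10 s c0 ltac:(lia)).
set P := s / 2 + D * s ^ 3 / 6.
have [sw _ _ _ _] := poly_bounds s (proj1 hs).
have s0 : Rabs s <= w s by rewrite Rabs_pos_eq; lra.
have -> : exp (L s) * (s * sin (psi s)) + eta * (gauss B s * (s * P)) =
  (exp (L s) * (s * (sin (psi s) - psi s)) + exp (L s) * (s * (psi s + eta * P))) +
  - ((exp (L s) - gauss B s) * (s * (eta * P))) by ring.
have EL : Rabs (exp (L s)) <= g s by rewrite Rabs_pos_eq; [exact: expL_le | lra].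
have h1 : Rabs (exp (L s) * (s * (sin (psi s) - psi s))) <= g s * (w s * (eta * A * w s ^ 3) ^ 3).
  apply: Rabs_mul_le => //; apply: Rabs_mul_le => //.
  apply: Rle_trans (Rabs_sin_minus_id _) _.
  by apply: pow_incr; split; [exact: Rabs_pos | exact: psi_bound].
have h2 : Rabs (exp (L s) * (s * (psi s + eta * P))) <= g s * (w s * (C * eta ^ 3 * w s ^ 3)).
  by apply: Rabs_mul_le => //; apply: Rabs_mul_le => //; exact: psi_sub.
have h3 : Rabs (- ((exp (L s) - gauss B s) * (s * (eta * P)))) <=
          C * eta ^ 2 * w s ^ 2 * g s * (w s * (eta * (P1 * w s ^ 2))).
  rewrite Rabs_Ropp; apply: Rabs_mul_le; first exact: expL_sub.
  apply: Rabs_mul_le => //; apply: Rabs_mul_le; first by rewrite Rabs_pos_eq; lra.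
  by apply: P_bound; lra.
apply: Rle_trans (Rabs_triang _ _) _.
apply: Rle_trans (Rplus_le_compat _ _ _ _ (Rabs_triang _ _) (Rle_refl _)) _.
have w4 : w s ^ 4 <= w s ^ 10 by apply: Rle_pow => //; lia.
have w5 : w s ^ 5 <= w s ^ 10 by apply: Rle_pow => //; lia.
have m4 : (C * eta ^ 3 * g s) * w s ^ 4 <= (C * eta ^ 3 * g s) * w s ^ 10.
  by apply: Rmult_le_compat_l => //; apply: Rmult_le_pos; [exact: Rmult_le_pos | lra].
have m5 : (C * P1 * eta ^ 3 * g s) * w s ^ 5 <= (C * P1 * eta ^ 3 * g s) * w s ^ 10.
  apply: Rmult_le_compat_l => //; apply: Rmult_le_pos; [|lra].
  by apply: Rmult_le_pos => //; apply: Rmult_le_pos => //; lra.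
have e : eta ^ 3 * (A ^ 3 + C + C * P1) * w s ^ 10 * g s =
   g s * (w s * (eta * A * w s ^ 3) ^ 3) + (C * eta ^ 3 * g s) * w s ^ 10 +
   (C * P1 * eta ^ 3 * g s) * w s ^ 10 by ring.
rewrite e.
have e'' : C * eta ^ 2 * w s ^ 2 * g s * (w s * (eta * (P1 * w s ^ 2))) =
  (C * P1 * eta ^ 3 * g s) * w s ^ 5 by ring.
lra.
Qed.

Let cEL s : continuous (fun s => exp (L s)) s.
Proof. by apply: continuous_exp_comp. Qed.

Let ex_cos n : ex_RInt (fun s => s ^ n * (exp (L s) * cos (psi s))) 0 S.
Proof.
apply: ex_RInt_of_continuous => s; apply: continuous_Rmult.
  by apply: (ex_derive_continuous (fun s => s ^ n)); auto_derive.
apply: continuous_Rmult; first exact: cEL.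
exact: continuous_cos_comp.
Qed.

Let ex_sin : ex_RInt (fun s => exp (L s) * (s * sin (psi s))) 0 S.
Proof.
apply: ex_RInt_of_continuous => s; apply: continuous_Rmult; first exact: cEL.
apply: continuous_Rmult; last exact: continuous_sin_comp.
exact: continuous_id.
Qed.

(** With tau = eta s, the real part of (1 - i tau)^2 exp(i psi) is (1 - tau^2) cos psi + 2 tau sin
    psi. The three integrals are its pieces, and the first is also the denominator of the mean. *)
Definition laplace_den : R := RInt (fun s => exp (L s) * cos (psi s)) 0 S.
Definition laplace_cos2 : R := RInt (fun s => s ^ 2 * (exp (L s) * cos (psi s))) 0 S.
Definition laplace_sin : R := RInt (fun s => exp (L s) * (s * sin (psi s))) 0 S.

Let Z := gauss_moment B 0 S.
Definition laplace_K1 : R := 2 * (A ^ 2 + C) * G.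
Definition laplace_K2 : R := 2 * (A ^ 3 + C + C * P1) * G.

Lemma laplace_expL : Rabs (RInt (fun s => exp (L s)) 0 S) <= 2 * G.
Proof.
apply: abs_RInt_le_inv_sq; [exact: Rlt_le | exact: ex_RInt_of_continuous |].
move=> s hs; rewrite Rabs_pos_eq; last exact: Rlt_le (exp_pos _).
apply: Rle_trans (expL_le s hs) _.
by have := wg_decay 0 s ltac:(lia); rewrite /= Rmult_1_l.
Qed.

Lemma laplace_cos_moment n : le n 3 ->
  Rabs (RInt (fun s => s ^ (2 * n)%coq_nat * (exp (L s) * cos (psi s))) 0 S -
        gauss_moment B (2 * n)%coq_nat S) <= laplace_K1 * eta ^ 2.
Proof.
move=> n3.
have h1 := RInt_correct _ _ _ (ex_cos (2 * n)%coq_nat).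
have h2 := RInt_correct _ _ _ (ex_RInt_gauss_pow B (2 * n)%coq_nat 0 S).
have h := is_RInt_minus _ _ _ _ _ _ h1 h2.
rewrite [X in Rabs X](_ : _ = RInt (fun s =>
   minus (s ^ (2 * n)%coq_nat * (exp (L s) * cos (psi s))) (s ^ (2 * n)%coq_nat * gauss B s)) 0 S);
  last by rewrite (is_RInt_unique _ _ _ _ h).
have -> : laplace_K1 * eta ^ 2 = 2 * (eta ^ 2 * (A ^ 2 + C) * G) by rewrite /laplace_K1; ring.
apply: abs_RInt_le_inv_sq; [exact: Rlt_le | by eexists; exact: h |].
move=> s hs; apply: Rle_trans (cos_bound n s hs n3).
rewrite /minus /plus /opp /=.
have -> : s ^ (2 * n)%coq_nat * (exp (L s) * cos (psi s)) + - (s ^ (2 * n)%coq_nat * gauss B s) =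
  (exp (L s) * cos (psi s) - gauss B s) * (s ^ 2) ^ n by rewrite pow_mult; ring.
rewrite Rabs_mult; apply: Rmult_le_compat_l; first exact: Rabs_pos.
have s2 := pow2_ge_0 s.
rewrite Rabs_pos_eq; last exact: pow_le.
by apply: pow_incr; rewrite /w; lra.
Qed.

Lemma laplace_sin_moment :
  Rabs (laplace_sin + eta * (gauss_moment B 2 S / 2 + D / 6 * gauss_moment B 4 S)) <= laplace_K2 * eta ^ 3.
Proof.
have h1 := RInt_correct _ _ _ ex_sin.
have h2 := is_RInt_scal _ _ _ (eta / 2) _ (RInt_correct _ _ _ (ex_RInt_gauss_pow B 2 0 S)).
have h4 := is_RInt_scal _ _ _ (eta * D / 6) _ (RInt_correct _ _ _ (ex_RInt_gauss_pow B 4 0 S)).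
have h := is_RInt_plus _ _ _ _ _ _ h1 (is_RInt_plus _ _ _ _ _ _ h2 h4).
have e : RInt _ 0 S = laplace_sin +
    (eta / 2 * gauss_moment B 2 S + eta * D / 6 * gauss_moment B 4 S) := is_RInt_unique _ _ _ _ h.
have -> : laplace_sin + eta * (gauss_moment B 2 S / 2 + D / 6 * gauss_moment B 4 S) =
  laplace_sin + (eta / 2 * gauss_moment B 2 S + eta * D / 6 * gauss_moment B 4 S) by field.
rewrite -e.
have -> : laplace_K2 * eta ^ 3 = 2 * (eta ^ 3 * (A ^ 3 + C + C * P1) * G) by rewrite /laplace_K2; ring.
apply: abs_RInt_le_inv_sq; [exact: Rlt_le | by eexists; exact: h |].
move=> s hs; apply: Rle_trans (sin_bound s hs); right; congr Rabs.
by rewrite /plus /scal /= /mult /=; field.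
Qed.

(** Since S = tau / eta, two spare powers of 1 / S give eta^2 / tau^2. *)
Lemma gauss_tail n : le n 3 -> 0 <= S ^ n * gauss B S <= G * eta ^ 2 / tau ^ 2.
Proof.
move=> n3; have S1 : 1 <= S by apply: (Rmult_le_reg_l eta); lra.
have Sn : 0 < S ^ n by apply: pow_lt.
have ga : 0 < gauss B S by exact: exp_pos.
split; first by apply: Rmult_le_pos; lra.
have -> : G * eta ^ 2 / tau ^ 2 = G / S ^ 2 by rewrite /S; field; lra.
have S2 : 0 < S ^ 2 by apply: pow_lt.
apply: (proj1 (Rle_div_r _ _ _ S2)).
have -> : S ^ n * gauss B S * S ^ 2 = (S ^ n * S ^ 2) * gauss B S by ring.
refine (Rle_trans _ _ _ _ (decay S)).
apply: Rmult_le_compat; [by apply: Rmult_le_pos; lra | lra | | exact: gauss_le_g].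
rewrite -pow_add.
apply: Rle_trans (Rle_pow S (n + 2)%coq_nat 6 S1 ltac:(lia)) _.
have -> : S ^ 6 = (S ^ 2) ^ 3 by ring.
apply: Rle_trans (_ : (1 + S ^ 2) ^ 3 <= _); first by apply: pow_incr; lra.
by apply: Rle_pow; [lra | lia].
Qed.

Lemma gauss_moment_2 : Rabs (gauss_moment B 2 S - Z / B) <= G / (B * tau ^ 2) * eta ^ 2.
Proof.
rewrite (gauss_moment_rec B B0 0) -/Z [INR _]/= [S ^ _]/= Rmult_1_r Rmult_1_l.
have := gauss_tail 1 ltac:(lia); rewrite pow_1 => t.
have -> : (Z - S * gauss B S) / B - Z / B = - (S * gauss B S / B) by field; lra.
rewrite Rabs_Ropp Rabs_pos_eq; last by apply: Rle_mult_inv_pos; lra.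
have -> : G / (B * tau ^ 2) * eta ^ 2 = G * eta ^ 2 / tau ^ 2 / B by field; lra.
by apply: Rmult_le_compat_r; [apply: Rlt_le; apply: Rinv_0_lt_compat | lra].
Qed.

Lemma gauss_moment_4 : Rabs (gauss_moment B 4 S - 3 * Z / B ^ 2) <=
  (3 / B + 1) * (G / (B * tau ^ 2)) * eta ^ 2.
Proof.
rewrite (gauss_moment_rec B B0 2).
have -> : INR (2 + 1)%coq_nat = 3 by rewrite /=; ring.
have t := gauss_tail (2 + 1)%coq_nat ltac:(lia).
have h := gauss_moment_2.
set T := S ^ _ * gauss B S in t *.
have -> : (3 * gauss_moment B 2 S - T) / B - 3 * Z / B ^ 2 =
   3 / B * (gauss_moment B 2 S - Z / B) + - (T / B) by field; lra.
apply: Rle_trans (Rabs_triang _ _) _.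
have b3 : 0 < 3 / B by apply: Rdiv_lt_0_compat; lra.
have h1 : Rabs (3 / B * (gauss_moment B 2 S - Z / B)) <= 3 / B * (G / (B * tau ^ 2) * eta ^ 2).
  by apply: Rabs_mul_le => //; rewrite Rabs_pos_eq; lra.
have h2 : Rabs (- (T / B)) <= G / (B * tau ^ 2) * eta ^ 2.
  rewrite Rabs_Ropp Rabs_pos_eq; last by apply: Rle_mult_inv_pos; lra.
  have -> : G / (B * tau ^ 2) * eta ^ 2 = G * eta ^ 2 / tau ^ 2 / B by field; lra.
  by apply: Rmult_le_compat_r; [apply: Rlt_le; apply: Rinv_0_lt_compat | lra].
lra.
Qed.

Definition laplace_K3 : R := G / (B * tau ^ 2).
Definition laplace_K4 : R := laplace_K1 + laplace_K3 + laplace_K1 / B.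
Definition laplace_K5 : R := laplace_K2 + laplace_K3 / 2 + Rabs D * ((3 / B + 1) * laplace_K3) +
  laplace_K1 * (1 / (2 * B) + Rabs D / (2 * B ^ 2)).

(** The Gaussian integral [Z] is never evaluated. It is only exchanged for the denominator, as
    nothing but quotients matter in the end. *)
Lemma laplace_den_gauss : Rabs (laplace_den - Z) <= laplace_K1 * eta ^ 2.
Proof.
have h := laplace_cos_moment 0 ltac:(lia).
rewrite (_ : laplace_den = RInt (fun s => s ^ (2 * 0)%coq_nat * (exp (L s) * cos (psi s))) 0 S).
  exact: h.
by apply: RInt_ext => s _; rewrite /= Rmult_1_l.
Qed.

Lemma laplace_cos2_den : Rabs (laplace_cos2 - laplace_den / B) <= laplace_K4 * eta ^ 2.
Proof.
have h := laplace_cos_moment 1 ltac:(lia).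
have h0 := laplace_den_gauss; have h2 := gauss_moment_2.
have -> : laplace_cos2 - laplace_den / B =
   (laplace_cos2 - gauss_moment B 2 S) + (gauss_moment B 2 S - Z / B)
   + - (/ B * (laplace_den - Z)) by field; lra.
apply: Rle_trans (Rabs_triang _ _) _.
apply: Rle_trans (Rplus_le_compat _ _ _ _ (Rabs_triang _ _) (Rle_refl _)) _.
have iB : 0 < / B by apply: Rinv_0_lt_compat.
have h3 : Rabs (- (/ B * (laplace_den - Z))) <= / B * (laplace_K1 * eta ^ 2).
  by rewrite Rabs_Ropp; apply: Rabs_mul_le => //; rewrite Rabs_pos_eq; lra.
rewrite -/laplace_K3 in h2.
have -> : laplace_K4 * eta ^ 2 = laplace_K1 * eta ^ 2 + laplace_K3 * eta ^ 2 + / B * (laplace_K1 * eta ^ 2).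
  by rewrite /laplace_K4; field; lra.
by apply: Rplus_le_compat => //; apply: Rplus_le_compat.
Qed.

Lemma laplace_sin_den :
  Rabs (laplace_sin + eta * laplace_den * (1 / (2 * B) + D / (2 * B ^ 2))) <= laplace_K5 * eta ^ 3.
Proof.
have h := laplace_sin_moment.
have h0 := laplace_den_gauss; have h2 := gauss_moment_2; have h4 := gauss_moment_4.
rewrite -/laplace_K3 in h2 h4.
(* From the moments Z / B and 3 Z / B^2, weighted by 1 / 2 and D / 6. *)
set q := 1 / (2 * B) + D / (2 * B ^ 2).
have -> : laplace_sin + eta * laplace_den * q =
   (laplace_sin + eta * (gauss_moment B 2 S / 2 + D / 6 * gauss_moment B 4 S)) +
   (- (eta / 2 * (gauss_moment B 2 S - Z / B)) +
    (- (eta * D / 6 * (gauss_moment B 4 S - 3 * Z / B ^ 2)) +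
    eta * q * (laplace_den - Z))).
  by rewrite /q; field; lra.
have hq : Rabs q <= 1 / (2 * B) + Rabs D / (2 * B ^ 2).
  apply: Rle_trans (Rabs_triang _ _) _; apply: Rplus_le_compat.
    by rewrite Rabs_pos_eq; [lra | apply: Rlt_le; apply: Rdiv_lt_0_compat; lra].
  have b2 : 0 < 2 * B ^ 2 by have := pow_lt B 2 B0; lra.
  by rewrite Rabs_div ?(Rabs_pos_eq (2 * B ^ 2)); lra.
have m1 : Rabs (- (eta / 2 * (gauss_moment B 2 S - Z / B))) <= eta / 2 * (laplace_K3 * eta ^ 2).
  by rewrite Rabs_Ropp; apply: Rabs_mul_le => //; rewrite Rabs_pos_eq; lra.
have m2 : Rabs (- (eta * D / 6 * (gauss_moment B 4 S - 3 * Z / B ^ 2))) <=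
          eta * Rabs D * ((3 / B + 1) * laplace_K3 * eta ^ 2).
  rewrite Rabs_Ropp; apply: Rabs_mul_le => //.
  have -> : eta * D / 6 = eta / 6 * D by field.
  by rewrite Rabs_mult Rabs_pos_eq; [have := Rabs_pos D; nra | lra].
have m3 : Rabs (eta * q * (laplace_den - Z)) <=
          eta * (1 / (2 * B) + Rabs D / (2 * B ^ 2)) * (laplace_K1 * eta ^ 2).
  apply: Rabs_mul_le => //; apply: Rabs_mul_le => //; rewrite Rabs_pos_eq; lra.
apply: Rle_trans (Rabs_triang _ _) _.
have t1 := Rabs_triang (- (eta / 2 * (gauss_moment B 2 S - Z / B)))
  (- (eta * D / 6 * (gauss_moment B 4 S - 3 * Z / B ^ 2)) + eta * q * (laplace_den - Z)).
have t2 := Rabs_triang (- (eta * D / 6 * (gauss_moment B 4 S - 3 * Z / B ^ 2)))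
  (eta * q * (laplace_den - Z)).
have -> : laplace_K5 * eta ^ 3 = laplace_K2 * eta ^ 3 + eta / 2 * (laplace_K3 * eta ^ 2)
  + eta * Rabs D * ((3 / B + 1) * laplace_K3 * eta ^ 2)
  + eta * (1 / (2 * B) + Rabs D / (2 * B ^ 2)) * (laplace_K1 * eta ^ 2).
  by rewrite /laplace_K5; field; lra.
lra.
Qed.

(** Keeps the denominator away from 0, uniformly in eta, using only the part [0, 1] of the range. *)
Lemma gauss_moment0_ge : exp (- (B / 2)) <= Z.
Proof.
have S1 : 1 <= S by apply: (Rmult_le_reg_l eta); lra.
have ex a b : ex_RInt (fun s => s ^ 0 * gauss B s) a b by exact: ex_RInt_gauss_pow.
rewrite /Z /gauss_moment -(RInt_Chasles _ 0 1 S) // /plus /=.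
have p s : 0 < 1 * gauss B s by rewrite Rmult_1_l; exact: exp_pos.
have h1 : 0 <= RInt (fun s => 1 * gauss B s) 1 S.
  by apply: RInt_ge_0 => // s _; exact: Rlt_le.
have h2 : RInt (fun _ => exp (- (B / 2))) 0 1 <= RInt (fun s => 1 * gauss B s) 0 1.
  apply: RInt_le; [lra | exact: ex_RInt_const | exact: (ex 0 1) |].
  move=> s hs; rewrite Rmult_1_l; apply: exp_le_exp.
  have s2 : s ^ 2 <= 1 by nra.
  have : B * s ^ 2 <= B * 1 by apply: Rmult_le_compat_l; lra.
  lra.
rewrite RInt_const /scal /= /mult /= in h2; lra.
Qed.

End Laplace.

(** * The two arcs for the partition product *)

(** Makes the constants of the preceding section uniform: [tau], [eta0], [K] and [z] depend on B, D,
    C alone and precede eta, L and psi. *)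
Lemma laplace_expansion (B D C : R) : 0 < B -> 0 <= C ->
  exists tau eta0 K z,
  [/\ 0 < tau <= 1, 0 < eta0 <= tau, 0 <= K & 0 < z] /\
  forall eta (L psi : R -> R), 0 < eta <= eta0 ->
  (forall s, continuous L s) -> (forall s, continuous psi s) ->
  (forall s, 0 <= s <= tau / eta ->
     Rabs (L s + B * s ^ 2 / 2) <= C * eta ^ 2 * (s ^ 2 + s ^ 4)) ->
  (forall s, 0 <= s <= tau / eta ->
     Rabs (psi s + eta * (s / 2 + D * s ^ 3 / 6)) <= C * eta ^ 3 * (s + s ^ 3 + s ^ 5)) ->
  [/\ z <= laplace_den tau eta L psi,
      Rabs (RInt (fun s => exp (L s)) 0 (tau / eta)) <= K &
      Rabs (laplace_den tau eta L psi - eta ^ 2 * laplace_cos2 tau eta L psi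
            + 2 * eta * laplace_sin tau eta L psi
            - laplace_den tau eta L psi * (1 - eta ^ 2 * (2 / B + D / B ^ 2))) <= K * eta ^ 4].
Proof.
move=> B0 C0.
have [G [G0 dec]] := gauss_decay B B0 13.
pose tau := Rmin 1 (B / (8 * (C + 1))).
have q0 : 0 < B / (8 * (C + 1)) by apply: Rdiv_lt_0_compat; lra.
have tau01 : 0 < tau <= 1.
  by split; [apply: Rmin_pos; lra | exact: Rmin_l].
have tauC : C * tau ^ 2 <= B / 8.
  have h : tau <= B / (8 * (C + 1)) by exact: Rmin_r.
  have h2 : (C + 1) * tau <= B / 8.
    have -> : B / 8 = (C + 1) * (B / (8 * (C + 1))) by field; lra.
    by apply: Rmult_le_compat_l; lra.
  nra.
pose K1 := laplace_K1 D C G.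
have K10 : 0 <= K1.
  by apply: Rmult_le_pos; [have := pow2_ge_0 (1 + Rabs D + C); lra | lra].
pose z := exp (- (B / 2)) / 2.
have z0 : 0 < z by rewrite /z; have := exp_pos (- (B / 2)); lra.
(* This yields K1 eta^2 <= z. As the Gaussian integral is at least 2 z, the denominator is at least
   z. *)
pose eta0 := Rmin tau (z / (K1 + 1)).
have r0 : 0 < z / (K1 + 1) by apply: Rdiv_lt_0_compat; lra.
have eta00 : 0 < eta0 <= tau by split; [apply: Rmin_pos; lra | exact: Rmin_l].
pose K4 := laplace_K4 B D C G tau; pose K5 := laplace_K5 B D C G tau.
pose K := 2 * G + Rabs K4 + 2 * Rabs K5.
exists tau, eta0, K, z; split.
  by split => //; rewrite /K; have := Rabs_pos K4; have := Rabs_pos K5; lra.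
move=> eta L psi [e0 e1] cL cpsi hL hpsi.
have eta01 : 0 < eta <= 1 by lra.
have eta_tau : eta <= tau by lra.
have etaC : C * eta ^ 2 <= B / 8.
  apply: Rle_trans tauC; apply: Rmult_le_compat_l => //; apply: pow_incr; lra.
have h0 := laplace_den_gauss B D C G C0 dec tau eta L psi tau01 tauC eta01 etaC cL cpsi hL hpsi.
have h1 := gauss_moment0_ge B B0 tau eta eta01 eta_tau.
have h2 := laplace_cos2_den B D C G B0 C0 dec tau eta L psi tau01 tauC eta01 etaC eta_tau cL cpsi hL hpsi.
have h3 := laplace_sin_den B D C G B0 C0 dec tau eta L psi tau01 tauC eta01 etaC eta_tau cL cpsi hL hpsi.
have h4 := laplace_expL B C G C0 dec tau eta L tau01 tauC eta01 etaC cL hL.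
rewrite -/K1 in h0; rewrite -/K4 in h2; rewrite -/K5 in h3.
have K4a := Rle_abs K4; have K5a := Rle_abs K5.
split.
- have hK : K1 * eta ^ 2 <= z.
    have e2 : eta ^ 2 <= eta by rewrite /=; nra.
    have e3 : eta <= z / (K1 + 1) by apply: Rle_trans e1 _; exact: Rmin_r.
    have -> : z = (K1 + 1) * (z / (K1 + 1)) by field; lra.
    have p2 := pow2_ge_0 eta; nra.
  have /Rabs_le_between := h0; have : exp (- (B / 2)) = 2 * z by rewrite /z; field.
  lra.
- rewrite /K; have := Rabs_pos K4; have := Rabs_pos K5; lra.
set den := laplace_den _ _ _ _ in h2 h3 *; set c2 := laplace_cos2 _ _ _ _ in h2 *.
set sn := laplace_sin _ _ _ _ in h3 *.
set q := 1 / (2 * B) + D / (2 * B ^ 2) in h3.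
(* Twice [q] is 1 / B + D / B^2; the missing 1 / B comes from the second cosine moment. *)
have -> : den - eta ^ 2 * c2 + 2 * eta * sn - den * (1 - eta ^ 2 * (2 / B + D / B ^ 2)) =
  - (eta ^ 2 * (c2 - den / B)) + 2 * eta * (sn + eta * den * q).
  by rewrite /q; field; lra.
apply: Rle_trans (Rabs_triang _ _) _; rewrite Rabs_Ropp.
have p2 := pow2_ge_0 eta.
have m1 : Rabs (eta ^ 2 * (c2 - den / B)) <= eta ^ 2 * (K4 * eta ^ 2).
  by apply: Rabs_mul_le => //; rewrite Rabs_pos_eq; lra.
have m2 : Rabs (2 * eta * (sn + eta * den * q)) <= 2 * eta * (K5 * eta ^ 3).
  by apply: Rabs_mul_le => //; rewrite Rabs_pos_eq; lra.
have p4 : 0 <= eta ^ 4 by apply: pow_le; lra.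
have m3 : (K4 + 2 * K5) * eta ^ 4 <= K * eta ^ 4.
  by apply: Rmult_le_compat_r => //; rewrite /K; lra.
lra.
Qed.

Section Arcs.
Variable k : nat.
Hypothesis hk : le 1 k.

Lemma polylog_sum_bound s : exists C, 0 <= C /\ forall eps M, 0 < eps ->
  psum (fun m => ((INR m * eps) ^ k) ^ S (S s) *
                 polylog (S s) (exp (- (INR m * eps) ^ k))) M <= C / eps.
Proof.
have [C [C0 h]] := polylog_bound s.
exists (4 * C); split; first lra.
move=> eps M e0.
apply: Rle_trans (_ : psum (fun m => 2 * C * / (1 + (INR m * eps) ^ 2)) M <= _).
  apply: psum_le => m.
  have u0 : 0 < INR (S m) * eps by apply: Rmult_lt_0_compat => //; exact: INR_S_pos m.
  have [h1 h2] := h ((INR (S m) * eps) ^ k) (pow_lt _ _ u0).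
  set y := _ * polylog _ _ in h1 h2 *.
  have h3 : Rabs y <= C / (1 + ((INR (S m) * eps) ^ k) ^ 4) by rewrite Rabs_pos_eq.
  have := pow_mul_decay k 0 (INR (S m) * eps) y C ltac:(lra) ltac:(lia) h3.
  by rewrite /= Rmult_1_l Rabs_pos_eq.
rewrite psum_scal.
have := psum_inv_sq_bound eps M e0 => h'.
have -> : 4 * C / eps = 2 * C * (2 / eps) by field; lra.
by apply: Rmult_le_compat_l; lra.
Qed.

(** With v = (m eps)^k, the Taylor coefficients of each factor are G2(v), bern(v) and G3(v), so
    [bern_sums] evaluates the whole sum. The choice of [n] cancels the term c_k tau / eps of the
    phase. *)
Lemma major_arc : exists C, 0 <= C /\ forall eps, 0 < eps <= 1 ->
  exists M0, forall M, le M0 M -> forall n tau, n = c_ k / eps ^ S k -> 0 <= tau ->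
  Rabs (log_weight k (eps ^ k) M (eps ^ k * tau) + var_const k * tau ^ 2 / (2 * eps))
    <= C * (tau ^ 2 + tau ^ 4 / eps) /\
  Rabs (phase k (eps ^ k) M (eps ^ k * tau) - n * (eps ^ k * tau)
        + (tau / 2 + skew_const k * tau ^ 3 / (6 * eps)))
    <= C * (eps * tau + tau ^ 3 + tau ^ 5 / eps).
Proof.
have [C [C0 sums]] := bern_sums k hk.
have [C4 [C40 s4]] := polylog_sum_bound 2.
have [C5 [C50 s5]] := polylog_sum_bound 3.
exists (C + C4 + C5); split; first lra.
move=> eps e01; have [e0 e1] := e01.
have [M0 hM0] := sums eps e01; exists M0 => M MM n tau -> t0.
have {hM0} [h1 h2 h3] := hM0 M MM.
pose v (m : nat) := (INR m * eps) ^ k.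
have vpos m : 0 < v (S m).
  by apply: pow_lt; apply: Rmult_lt_0_compat => //; exact: INR_S_pos m.
have rate m : part_rate k (eps ^ k) m = exp (- v m).
  by rewrite /part_rate /v; congr exp; rewrite Rpow_mult_distr; ring.
have ang m : INR m ^ k * (eps ^ k * tau) = v m * tau.
  by rewrite /v Rpow_mult_distr; ring.
have rate01 m : 0 <= exp (- v (S m)) < 1 by have := exp_neg_lt_1 _ (vpos m); lra.
have t2 := pow_le tau 2 t0; have t3 := pow_le tau 3 t0.
have t4 := pow_le tau 4 t0; have t5 := pow_le tau 5 t0.
have ie : 0 < / eps by apply: Rinv_0_lt_compat.
set S2 := psum _ M in h2; set S3 := psum _ M in h3; set S1 := psum _ M in h1.
split.
- have tay : Rabs (psum (fun m => log_mod (part_rate k (eps ^ k) m) (INR m ^ k * (eps ^ k * tau))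
                      + tau ^ 2 / 2 * bernG2 (v m)) M) <= tau ^ 4 * (C4 / eps).
    apply: Rle_trans (_ : tau ^ 4 * psum (fun m => v m ^ 4 * polylog 3 (exp (- v m))) M <= _).
      rewrite -psum_scal; apply: psum_abs_le => m; rewrite rate ang.
      have vt : 0 <= v (S m) * tau by apply: Rmult_le_pos => //; exact: Rlt_le.
      have := log_mod_taylor _ _ (rate01 m) vt.
      have [_ <- _] := polylog_bern _ (vpos m).
      set P1 := polylog 1 _; set P3 := polylog 3 _ => h.
      have -> : tau ^ 2 / 2 * (v m.+1 ^ 2 * P1) = (v m.+1 * tau) ^ 2 / 2 * P1 by field.
      by apply: Rle_trans h _; right; ring.
    by apply: Rmult_le_compat_l => //; exact: s4.
  rewrite psum_plus psum_scal -/(log_weight k (eps ^ k) M (eps ^ k * tau)) in tay.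
  rewrite -/S2 in tay.
  set LW := log_weight _ _ _ _ in tay *.
  have -> : LW + var_const k * tau ^ 2 / (2 * eps) =
    (LW + tau ^ 2 / 2 * S2) + - (tau ^ 2 / 2 * (S2 - var_const k / eps)) by field; lra.
  apply: Rle_trans (Rabs_triang _ _) _; rewrite Rabs_Ropp.
  have m1 : Rabs (tau ^ 2 / 2 * (S2 - var_const k / eps)) <= tau ^ 2 / 2 * C.
    by apply: Rabs_mul_le => //; rewrite Rabs_pos_eq; lra.
  have q : 0 <= tau ^ 4 / eps by apply: Rmult_le_pos; lra.
  have e4 : tau ^ 4 * (C4 / eps) = C4 * (tau ^ 4 / eps) by field; lra.
  have n1 : C * tau ^ 2 <= (C + C4 + C5) * tau ^ 2 by apply: Rmult_le_compat_r; lra.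
  have n2 : C4 * (tau ^ 4 / eps) <= (C + C4 + C5) * (tau ^ 4 / eps).
    by apply: Rmult_le_compat_r; lra.
  have n3 : 0 <= C * tau ^ 2 by apply: Rmult_le_pos.
  rewrite e4 in tay; lra.
- have tay : Rabs (psum (fun m => log_arg (part_rate k (eps ^ k) m) (INR m ^ k * (eps ^ k * tau))
               + (- tau * bern (v m) + tau ^ 3 / 6 * bernG3 (v m))) M) <= tau ^ 5 * (C5 / eps).
    apply: Rle_trans (_ : tau ^ 5 * psum (fun m => v m ^ 5 * polylog 4 (exp (- v m))) M <= _).
      rewrite -psum_scal; apply: psum_abs_le => m; rewrite rate ang.
      have vt : 0 <= v (S m) * tau by apply: Rmult_le_pos => //; exact: Rlt_le.
      have := log_arg_taylor _ _ (rate01 m) vt.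
      have [<- _ <-] := polylog_bern _ (vpos m).
      set P0 := polylog 0 _; set P2 := polylog 2 _; set P4 := polylog 4 _ => h.
      have -> : log_arg (exp (- v m.+1)) (v m.+1 * tau) +
         (- tau * (v m.+1 * (P0 - 1)) + tau ^ 3 / 6 * (v m.+1 ^ 3 * P2)) =
         log_arg (exp (- v m.+1)) (v m.+1 * tau) - v m.+1 * tau * (P0 - 1)
         + (v m.+1 * tau) ^ 3 / 6 * P2 by field.
      by apply: Rle_trans h _; right; ring.
    by apply: Rmult_le_compat_l => //; exact: s5.
  rewrite psum_plus psum_plus !psum_scal -/(phase k (eps ^ k) M (eps ^ k * tau)) in tay.
  rewrite -/S1 -/S3 in tay.
  set PH := phase _ _ _ _ in tay *.
  have xk : 0 < eps ^ k by apply: pow_lt.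
  have -> : c_ k / eps ^ S k * (eps ^ k * tau) = c_ k * tau / eps.
    by rewrite (_ : eps ^ S k = eps * eps ^ k) //; field; lra.
  have -> : PH - c_ k * tau / eps + (tau / 2 + skew_const k * tau ^ 3 / (6 * eps)) =
     (PH + (- tau * S1 + tau ^ 3 / 6 * S3)) + (tau * (S1 - (c_ k / eps - 1 / 2)) +
     - (tau ^ 3 / 6 * (S3 - skew_const k / eps))) by field; lra.
  apply: Rle_trans (Rabs_triang _ _) _.
  have tr := Rabs_triang (tau * (S1 - (c_ k / eps - 1 / 2)))
                (- (tau ^ 3 / 6 * (S3 - skew_const k / eps))).
  rewrite Rabs_Ropp in tr.
  have m1 : Rabs (tau * (S1 - (c_ k / eps - 1 / 2))) <= tau * (C * eps).
    by apply: Rabs_mul_le => //; rewrite Rabs_pos_eq; lra.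
  have m2 : Rabs (tau ^ 3 / 6 * (S3 - skew_const k / eps)) <= tau ^ 3 / 6 * C.
    by apply: Rabs_mul_le => //; rewrite Rabs_pos_eq; lra.
  have q : 0 <= tau ^ 5 / eps by apply: Rmult_le_pos; lra.
  have -> : (C + C4 + C5) * (eps * tau + tau ^ 3 + tau ^ 5 / eps) =
    (C + C4 + C5) * (eps * tau) + (C + C4 + C5) * tau ^ 3 + (C + C4 + C5) * (tau ^ 5 / eps) by ring.
  have et : 0 <= eps * tau by apply: Rmult_le_pos; lra.
  have n1 : C * (eps * tau) <= (C + C4 + C5) * (eps * tau) by apply: Rmult_le_compat_r; lra.
  have n2 : C * tau ^ 3 <= (C + C4 + C5) * tau ^ 3 by apply: Rmult_le_compat_r; lra.
  have n3 : C5 * (tau ^ 5 / eps) <= (C + C4 + C5) * (tau ^ 5 / eps) by apply: Rmult_le_compat_r; lra.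
  have n4 : 0 <= C * tau ^ 3 by apply: Rmult_le_pos.
  have e5 : tau ^ 5 * (C5 / eps) = C5 * (tau ^ 5 / eps) by field; lra.
  rewrite e5 in tay.
  lra.
Qed.

Lemma nat_root p N : le 1 p -> exists J, le (Nat.pow J p) N /\ lt N (Nat.pow (S J) p).
Proof.
move=> p1; elim: N => [|N [J [h1 h2]]].
  by exists 0%N; rewrite Nat.pow_0_l; [split; [lia | have := Nat.pow_nonzero 1 p ltac:(lia); lia] | lia].
case: (Nat.le_gt_cases (Nat.pow (S J) p) (S N)) => h.
  exists (S J); split => //.
  have := Nat.pow_lt_mono_l (S J) (S (S J)) p ltac:(lia) ltac:(lia); lia.
by exists J; split; lia.
Qed.

(** For m <= N <= 1 / eps the rate exp(- (m eps)^k) is at least exp(-1); the other factors only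
    decrease the modulus. *)
Lemma log_weight_le_cos_sum eps N M theta : 0 < eps -> INR N * eps <= 1 -> le N M ->
  log_weight k (eps ^ k) M theta <=
  - (exp (-1) * psum (fun m => 1 - cos (INR m ^ k * theta)) N).
Proof.
move=> e0 Ne NM.
have x0 : 0 < eps ^ k by apply: pow_lt.
have nonneg m : 0 <= - log_mod (part_rate k (eps ^ k) (S m)) (INR (S m) ^ k * theta).
  have := log_mod_le_0 _ (INR (S m) ^ k * theta) (part_rate_lt_1 k (eps ^ k) m x0); lra.
have h := psum_le_length (fun m => - log_mod (part_rate k (eps ^ k) m) (INR m ^ k * theta)) N M
  nonneg NM.
have e : psum (fun m => - log_mod (part_rate k (eps ^ k) m) (INR m ^ k * theta)) M =
         - log_weight k (eps ^ k) M theta.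
  by rewrite /log_weight; elim: (M) => [|M' IH]; [rewrite /=; ring | rewrite /psum -!/(psum _ M') IH; ring].
rewrite e in h; apply: Ropp_le_cancel; rewrite Ropp_involutive.
apply: Rle_trans h; rewrite -psum_scal.
elim: (N) Ne => [|N' IH] Ne; first by rewrite /=; lra.
rewrite /psum -/(psum _ N') -/(psum (fun m => - _) N').
apply: Rplus_le_compat; first by apply: IH; move: Ne; rewrite S_INR; nra.
have r01 := part_rate_lt_1 k (eps ^ k) N' x0.
have le := log_mod_le (part_rate k (eps ^ k) N'.+1) (INR N'.+1 ^ k * theta) r01.
have re : exp (-1) <= part_rate k (eps ^ k) N'.+1.
  rewrite /part_rate; apply: exp_le_exp.
  rewrite -Rpow_mult_distr.
  have : (eps * INR N'.+1) ^ k <= 1 ^ k.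
    by apply: pow_incr; split; [apply: Rmult_le_pos; [lra | exact: pos_INR] | lra].
  rewrite pow1; lra.
have := COS_bound (INR N'.+1 ^ k * theta); nra.
Qed.

(** Take N about 1 / eps and J about N^(1 / (4k)). The decay exp(- c' J) then beats every power of
    eps. *)
Lemma minor_arc_decay tau A : 0 < tau <= 1 -> exists K eps0, [/\ 0 < K, 0 < eps0 <= 1 &
  forall eps, 0 < eps <= eps0 -> exists M0, forall M, le M0 M ->
  forall theta, tau * eps ^ k <= theta <= PI ->
  exp (log_weight k (eps ^ k) M theta) <= K * eps ^ A].
Proof.
move=> tau01.
have [c [J0 [c0 minor]]] := minor_arc k tau hk tau01.
pose c' := exp (-1) * c.
have c'0 : 0 < c' by apply: Rmult_lt_0_compat => //; exact: exp_pos.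
(* (J + 1)^(4k) >= 1 / eps turns (J + 1)^(-p) into eps^A. The factor exp(c') in [K] pays for passing
   from J to J + 1. *)
pose p := (4 * k * A)%coq_nat.
pose K := exp c' * (INR (fact p) / c' ^ p).
have K0 : 0 < K.
  apply: Rmult_lt_0_compat; first exact: exp_pos.
  by apply: Rdiv_lt_0_compat; [exact: INR_fact_lt_0 | exact: pow_lt].
(* 1 / eps > T forces J >= J0. *)
pose T := INR J0 ^ (4 * k)%coq_nat.
have T0 : 0 <= T by apply: pow_le; exact: pos_INR.
exists K, (/ (T + 1)); split => //.
  by split; [apply: Rinv_0_lt_compat; lra | rewrite -Rinv_1; apply: Rinv_le_contravar; lra].
move=> eps [e0 e1].
have ie : T + 1 <= / eps.
  by rewrite -(Rinv_inv (T + 1)); apply: Rinv_le_contravar.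
have [N [hN1 hN2]] : exists N, INR N <= / eps < INR (S N).
  have ie0 : 0 <= / eps by lra.
  have [N [hN1 hN2]] := nfloor_ex _ ie0.
  by exists N; rewrite S_INR.
have [J [hJ1 hJ2]] := nat_root (4 * k)%coq_nat N ltac:(lia).
have hJ3 : / eps <= INR (S J) ^ (4 * k)%coq_nat.
  apply: Rle_trans (Rlt_le _ _ hN2) _; rewrite -pow_INR; apply: le_INR; lia.
have J0J : le J0 J.
  case: (Nat.le_gt_cases J0 J) => // lt; exfalso.
  have : INR (S J) ^ (4 * k)%coq_nat <= T.
    by apply: pow_incr; split; [exact: pos_INR | apply: le_INR; lia].
  lra.
exists N => M NM theta [h1 h2].
have x0 : 0 < eps ^ k by apply: pow_lt.
have Ne : INR N * eps <= 1.
  have -> : 1 = / eps * eps by field; lra.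
  by apply: Rmult_le_compat_r; lra.
have hth : tau <= theta * INR (S N) ^ k.
  apply: Rle_trans (_ : tau * eps ^ k * INR (S N) ^ k <= _); last first.
    by apply: Rmult_le_compat_r => //; apply: pow_le; exact: pos_INR.
  rewrite Rmult_assoc -Rpow_mult_distr.
  have : 1 ^ k <= (eps * INR (S N)) ^ k.
    apply: pow_incr; split; first lra.
    have -> : 1 = eps * / eps by field; lra.
    by apply: Rmult_le_compat_l; lra.
  rewrite pow1; nra.
have J1 : INR J ^ (4 * k)%coq_nat <= INR N by rewrite -pow_INR; apply: le_INR.
have sumJ := minor J N theta J0J J1 hth ltac:(nra).
have lw := log_weight_le_cos_sum eps N M theta e0 Ne NM.
apply: Rle_trans (_ : exp (c' - c' * INR (S J)) <= _).
  apply: exp_le_exp; apply: Rle_trans lw _; rewrite S_INR.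
  have := Rmult_le_compat_l _ _ _ (Rlt_le _ _ (exp_pos (-1))) sumJ; rewrite /c'; lra.
have y0 : 0 < c' * INR (S J).
  by apply: Rmult_lt_0_compat => //; exact: INR_S_pos J.
have tay := pow_le_exp p _ (Rlt_le _ _ y0).
have yp : 0 < (c' * INR (S J)) ^ p by apply: pow_lt.
have ee : exp (- (c' * INR (S J))) <= INR (fact p) / (c' * INR (S J)) ^ p.
  apply: (proj1 (Rle_div_r _ _ _ yp)).
  have -> : INR (fact p) = exp (- (c' * INR (S J))) * (INR (fact p) * exp (c' * INR (S J))).
    by rewrite Rmult_comm Rmult_assoc -exp_plus Rplus_opp_r exp_0; ring.
  by apply: Rmult_le_compat_l => //; exact: Rlt_le (exp_pos _).
have -> : exp (c' - c' * INR (S J)) = exp c' * exp (- (c' * INR (S J))) by rewrite -exp_plus.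
rewrite /K Rmult_assoc; apply: Rmult_le_compat_l; first exact: Rlt_le (exp_pos _).
apply: Rle_trans ee _.
rewrite Rpow_mult_distr /p pow_mult (pow_mult (INR (S J))) -/p.
have epsA : / (INR (S J) ^ (4 * k)%coq_nat) ^ A <= eps ^ A.
  rewrite -pow_inv; apply: pow_incr; split.
    by apply: Rlt_le; apply: Rinv_0_lt_compat; lra.
  by rewrite -(Rinv_inv eps); apply: Rinv_le_contravar; lra.
rewrite -(pow_mult c') -/p /Rdiv Rinv_mult -Rmult_assoc.
apply: Rmult_le_compat_l => //; apply: Rlt_le.
by apply: Rdiv_lt_0_compat; [exact: INR_fact_lt_0 | exact: pow_lt].
Qed.

End Arcs.

(** * Second differences of the partition function *)

Lemma cosh_sinh_taylor (y Y : R) : 0 <= y <= Y ->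
  [/\ 0 <= sinh y <= exp Y, 0 <= cosh y <= exp Y,
      Rabs (sinh y - y) <= exp Y * y ^ 3 & Rabs (cosh y - 1 - y ^ 2 / 2) <= exp Y * y ^ 4].
Proof.
move=> [y0 yY].
have E0 := exp_pos Y.
have sb t : 0 <= t <= Y -> 0 <= sinh t <= exp Y.
  move=> ht; rewrite /sinh; have := exp_le_exp t Y ltac:(lra).
  have := exp_le_exp (- t) t ltac:(lra); have := exp_pos (- t); lra.
have cb t : 0 <= t <= Y -> 0 <= cosh t <= exp Y.
  move=> ht; rewrite /cosh; have := exp_le_exp t Y ltac:(lra).
  have := exp_le_exp (- t) t ltac:(lra); have := exp_pos (- t); have := exp_pos t; lra.
have ds t : is_derive sinh t (cosh t) by rewrite /sinh /cosh; auto_derive; [|field].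
have dc t : is_derive cosh t (sinh t) by rewrite /sinh /cosh; auto_derive; [|field].
have s0 : sinh 0 = 0 by rewrite /sinh Ropp_0; field.
have c0 : cosh 0 = 1 by rewrite /cosh Ropp_0 exp_0; field.
have b1 t : 0 <= t <= Y -> Rabs (sinh t) <= exp Y * t ^ 1.
  move=> ht; apply: (abs_le_of_derive sinh cosh); try lra.
  - by move=> u _; exact: ds.
  - by move=> u hu; rewrite /= Rmult_1_r Rabs_pos_eq; have := cb u; lra.
have b2 t : 0 <= t <= Y -> Rabs (cosh t - 1) <= exp Y * t ^ 2.
  move=> ht; apply: (abs_le_of_derive (fun t => cosh t - 1) sinh); try lra.
  - by move=> u _; rewrite /sinh /cosh; auto_derive; [|field].
  - by move=> u hu; apply: b1; lra.
have b3 t : 0 <= t <= Y -> Rabs (sinh t - t) <= exp Y * t ^ 3.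
  move=> ht; apply: (abs_le_of_derive (fun t => sinh t - t) (fun t => cosh t - 1)); try lra.
  - by move=> u _; rewrite /sinh /cosh; auto_derive; [|field].
  - by move=> u hu; apply: b2; lra.
have b4 : Rabs (cosh y - 1 - y ^ 2 / 2) <= exp Y * y ^ 4.
  apply: (abs_le_of_derive (fun t => cosh t - 1 - t ^ 2 / 2) (fun t => sinh t - t)); try lra.
  - by move=> u _; rewrite /sinh /cosh; auto_derive; [|field].
  - by move=> u hu; apply: b3; lra.
by split; [apply: sb | apply: cb | apply: b3 | ]; try lra.
Qed.

(* The real part of [(cosh (d (x - i theta)) - 1) exp (i psi)]. *)
Definition shift_num (d x theta psi : R) : R :=
  (cosh (d * x) * cos (d * theta) - 1) * cos psi + sinh (d * x) * sin (d * theta) * sin psi.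

(** The real part of (d z)^2 / 2 exp(i psi) with z = x - i theta, the leading term of cosh(d z) -
    1. *)
Definition shift_num_main (d x theta psi : R) : R :=
  d ^ 2 / 2 * ((x ^ 2 - theta ^ 2) * cos psi + 2 * x * theta * sin psi).

Lemma Rabs_shift_num_le d x theta psi : 0 <= d -> 0 <= x <= 1 ->
  Rabs (shift_num d x theta psi) <= 2 * exp d + 1.
Proof.
move=> d0 x01; have [s c _ _] := cosh_sinh_taylor (d * x) d ltac:(nra).
have c1 : Rabs (cos psi) <= 1 by exact: Rabs_cos_le_1.
have s1 : Rabs (sin psi) <= 1 by exact: Rabs_sin_le_1.
have c2 := COS_bound (d * theta); have s2 := SIN_bound (d * theta).
have h1 : Rabs ((cosh (d * x) * cos (d * theta) - 1) * cos psi) <= (exp d + 1) * 1.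
  by apply: Rabs_mul_le => //; apply: Rabs_le; nra.
have h2 : Rabs (sinh (d * x) * sin (d * theta) * sin psi) <= exp d * 1.
  by apply: Rabs_mul_le => //; apply: Rabs_le; nra.
have := Rabs_triang ((cosh (d * x) * cos (d * theta) - 1) * cos psi)
  (sinh (d * x) * sin (d * theta) * sin psi).
rewrite /shift_num; lra.
Qed.

(** For theta <= x, on the major arc, |z| is comparable to x, so the quartic remainder of cosh is
    O(x^4). *)
Lemma Rabs_shift_num_sub_le d x theta psi : 0 <= d -> 0 <= x <= 1 -> 0 <= theta <= x ->
  Rabs (shift_num d x theta psi - shift_num_main d x theta psi) <=
  (2 * exp d + 3 + d ^ 2) * d ^ 4 * x ^ 4.
Proof.
move=> d0 x01 ht.
pose y := d * x; pose b := d * theta.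
have b0 : 0 <= b <= y by rewrite /b /y; nra.
have yd : y <= d by rewrite /y; nra.
have [s c s3 c4] := cosh_sinh_taylor y d ltac:(lra).
have [bs bc _ bc4 _] := cos_sin_taylor b (proj1 b0).
have [_ _ bs3 _ _] := cos_sin_taylor b (proj1 b0).
have c1 : Rabs (cos psi) <= 1 by exact: Rabs_cos_le_1.
have s1 : Rabs (sin psi) <= 1 by exact: Rabs_sin_le_1.
have cb1 : Rabs (cos b) <= 1 by exact: Rabs_cos_le_1.
have E0 := exp_pos d.
have y4 : 0 <= y ^ 4 by apply: pow_le; lra.
have by4 : b ^ 4 <= y ^ 4 by apply: pow_incr; lra.
have y2 : 0 <= y ^ 2 <= d ^ 2 by split; [exact: pow2_ge_0 | apply: pow_incr; lra].
have by2 : 0 <= b ^ 2 <= y ^ 2 by split; [exact: pow2_ge_0 | apply: pow_incr; lra].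
have y22 : y ^ 2 * b ^ 2 <= y ^ 4.
  by have -> : y ^ 4 = y ^ 2 * y ^ 2 by [ring]; apply: Rmult_le_compat_l; lra.
have y3 : y ^ 3 * b <= y ^ 4.
  have -> : y ^ 4 = y ^ 3 * y by ring.
  by apply: Rmult_le_compat_l; [apply: pow_le; lra | lra].
have yb3 : y * b ^ 3 <= y ^ 4.
  have -> : y ^ 4 = y * y ^ 3 by ring.
  by apply: Rmult_le_compat_l; [lra | apply: pow_incr; lra].
have hc : Rabs (cosh y * cos b - 1 - (y ^ 2 - b ^ 2) / 2) <= (exp d + 1 + d ^ 2 / 2 + 1 / 4) * y ^ 4.
  have -> : cosh y * cos b - 1 - (y ^ 2 - b ^ 2) / 2 =
    (cosh y - 1 - y ^ 2 / 2) * cos b +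
    ((1 + y ^ 2 / 2) * (cos b - 1 + b ^ 2 / 2) + - (y ^ 2 * b ^ 2 / 4)) by field.
  have t1 := Rabs_mul_le _ _ _ _ c4 cb1.
  have t2 : Rabs ((1 + y ^ 2 / 2) * (cos b - 1 + b ^ 2 / 2)) <= (1 + d ^ 2 / 2) * y ^ 4.
    by apply: Rabs_mul_le; [rewrite Rabs_pos_eq; lra | lra].
  have t3 : Rabs (- (y ^ 2 * b ^ 2 / 4)) <= y ^ 4 / 4.
    rewrite Rabs_Ropp Rabs_pos_eq; first lra.
    by have := Rmult_le_pos _ _ (proj1 y2) (proj1 by2); lra.
  apply: Rle_trans (Rabs_triang _ _) _.
  have := Rabs_triang ((1 + y ^ 2 / 2) * (cos b - 1 + b ^ 2 / 2)) (- (y ^ 2 * b ^ 2 / 4)).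
  lra.
have hs : Rabs (sinh y * sin b - y * b) <= (exp d + 1) * y ^ 4.
  have -> : sinh y * sin b - y * b = (sinh y - y) * sin b + y * (sin b - b) by ring.
  have t1 := Rabs_mul_le _ _ _ _ s3 bs.
  have t2 : Rabs (y * (sin b - b)) <= y * b ^ 3.
    by apply: Rabs_mul_le => //; rewrite Rabs_pos_eq; lra.
  apply: Rle_trans (Rabs_triang _ _) _.
  have : exp d * y ^ 3 * b <= exp d * y ^ 4 by rewrite Rmult_assoc; apply: Rmult_le_compat_l; lra.
  lra.
have -> : shift_num d x theta psi - shift_num_main d x theta psi =
  (cosh y * cos b - 1 - (y ^ 2 - b ^ 2) / 2) * cos psi + (sinh y * sin b - y * b) * sin psi.
  by rewrite /shift_num /shift_num_main -/y -/b /y /b; field.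
have t1 := Rabs_mul_le _ _ _ _ hc c1; have t2 := Rabs_mul_le _ _ _ _ hs s1.
apply: Rle_trans (Rabs_triang _ _) _.
have e : d ^ 4 * x ^ 4 = y ^ 4 by rewrite /y; ring.
rewrite Rmult_assoc e.
have d2 := pow2_ge_0 d; nra.
Qed.

Lemma continuous_shift_num d x (psi : R -> R) theta : continuous psi theta ->
  continuous (fun theta => shift_num d x theta (psi theta)) theta.
Proof.
move=> cp.
apply: continuous_Rplus.
  apply: continuous_Rmult; last exact: continuous_cos_comp.
  apply: (ex_derive_continuous (fun theta => cosh (d * x) * cos (d * theta) - 1)).
  by auto_derive.
apply: continuous_Rmult; last exact: continuous_sin_comp.
apply: (ex_derive_continuous (fun theta => sinh (d * x) * sin (d * theta))).
by auto_derive.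
Qed.

Lemma continuous_shift_num_main d x (psi : R -> R) theta : continuous psi theta ->
  continuous (fun theta => shift_num_main d x theta (psi theta)) theta.
Proof.
move=> cp; apply: (continuous_scal_r (K := R_AbsRing) (V := R_NormedModule)).
apply: continuous_Rplus.
  apply: continuous_Rmult; last exact: continuous_cos_comp.
  by apply: (ex_derive_continuous (fun theta => x ^ 2 - theta ^ 2)); auto_derive.
apply: continuous_Rmult; last exact: continuous_sin_comp.
by apply: (ex_derive_continuous (fun theta => 2 * x * theta)); auto_derive.
Qed.

Lemma RInt_rescale (f : R -> R) (a S : R) : (forall y, continuous f y) ->
  RInt f 0 (a * S) = a * RInt (fun s => f (a * s)) 0 S.
Proof.
move=> cf.
have h : is_RInt f (a * 0 + 0) (a * S + 0) (RInt f 0 (a * S)).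
  by rewrite Rmult_0_r !Rplus_0_r; apply: RInt_correct; exact: ex_RInt_of_continuous.
have h1 := is_RInt_comp_lin _ _ _ _ _ _ h.
have ex : ex_RInt (fun s => f (a * s)) 0 S.
  by apply: ex_RInt_of_continuous => y; exact: continuous_scale.
have h2 := is_RInt_scal _ _ _ a _ (RInt_correct _ _ _ ex).
rewrite -[RHS](is_RInt_unique _ _ _ _ h2) -(is_RInt_unique _ _ _ _ h1).
by apply: RInt_ext => s _; rewrite Rplus_0_r.
Qed.

Lemma Rabs_RInt_mult_le (W h : R -> R) (a b H : R) : a <= b ->
  (forall y, continuous W y) -> (forall y, continuous h y) ->
  (forall y, 0 <= W y) -> (forall y, a <= y <= b -> Rabs (h y) <= H) ->
  Rabs (RInt (fun y => W y * h y) a b) <= H * RInt W a b.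
Proof.
move=> ab cW ch W0 hH.
have cWh y : continuous (fun y => W y * h y) y by exact: continuous_Rmult.
have exWh : ex_RInt (fun y => W y * h y) a b by exact: ex_RInt_of_continuous.
have exW : ex_RInt W a b by exact: ex_RInt_of_continuous.
have hs := is_RInt_scal _ _ _ H _ (RInt_correct _ _ _ exW).
apply: Rle_trans (abs_RInt_le _ _ _ ab exWh) _.
rewrite -[X in _ <= X](is_RInt_unique _ _ _ _ hs).
apply: RInt_le => //; [exact: ex_RInt_norm | by eexists; exact: hs |].
move=> y hy; rewrite Rabs_mult (Rabs_pos_eq (W y)) // Rmult_comm /scal /= /mult /=.
by apply: Rmult_le_compat_r => //; apply: hH; lra.
Qed.

Section Shift.
Variables (k : nat) (x : R) (M : nat) (n delta : Z).
Hypothesis x0 : 0 < x.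

Let W (theta : R) := exp (log_weight k x M theta).
Let psi (theta : R) := phase k x M theta - IZR n * theta.
Let d := IZR delta.

Lemma continuous_weight y : continuous W y.
Proof. by apply: continuous_exp_comp; exact: continuous_log_weight. Qed.

Lemma continuous_total_phase y : continuous psi y.
Proof.
apply: continuous_Rminus; first exact: continuous_phase.
by apply: (ex_derive_continuous (fun y => IZR n * y)); auto_derive.
Qed.

Lemma continuous_weight_cos y : continuous (fun y => W y * cos (psi y)) y.
Proof.
apply: continuous_Rmult; first exact: continuous_weight.
by apply: continuous_cos_comp; exact: continuous_total_phase.
Qed.

Lemma continuous_weight_shift_num y : continuous (fun y => W y * shift_num d x y (psi y)) y.
Proof.
apply: continuous_Rmult; first exact: continuous_weight.
by apply: continuous_shift_num; exact: continuous_total_phase.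
Qed.

Lemma fourier_coef_shift_average : fourier_coef k x M n <> 0 ->
  1 / 2 * (fourier_coef k x M (n + delta) / fourier_coef k x M n +
           fourier_coef k x M (n - delta) / fourier_coef k x M n) =
  1 + RInt (fun theta => W theta * shift_num d x theta (psi theta)) 0 PI /
      RInt (fun theta => W theta * cos (psi theta)) 0 PI.
Proof.
rewrite /fourier_coef plus_IZR minus_IZR -/d.
set DEN := RInt (fun theta => W theta * cos (psi theta)) 0 PI.
set I1 := RInt (fourier_integrand k x M (IZR n + d)) 0 PI.
set I2 := RInt (fourier_integrand k x M (IZR n - d)) 0 PI.
have -> : exp ((IZR n + d) * x) = exp (IZR n * x) * exp (d * x).
  by rewrite -exp_plus; congr exp; ring.
have -> : exp ((IZR n - d) * x) = exp (IZR n * x) * exp (- (d * x)).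
  by rewrite -exp_plus; congr exp; ring.
move=> nz.
have D0 : DEN <> 0 by move=> e; apply: nz; rewrite e; ring.
have g0 : gen_product k x M <> 0 by apply: Rgt_not_eq; exact: exp_pos.
have en0 : exp (IZR n * x) <> 0 by apply: Rgt_not_eq; exact: exp_pos.
have pi0 : PI <> 0 by apply: Rgt_not_eq; exact: PI_RGT_0.
have exF n' : ex_RInt (fourier_integrand k x M n') 0 PI.
  by apply: ex_RInt_of_continuous => y; exact: continuous_fourier_integrand.
have exD : ex_RInt (fun theta => W theta * cos (psi theta)) 0 PI.
  by apply: ex_RInt_of_continuous; exact: continuous_weight_cos.
have h1 := is_RInt_scal _ _ _ (exp (d * x) / 2) _ (RInt_correct _ _ _ (exF (IZR n + d))).
have h2 := is_RInt_scal _ _ _ (exp (- (d * x)) / 2) _ (RInt_correct _ _ _ (exF (IZR n - d))).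
have h := is_RInt_minus _ _ _ _ _ _ (is_RInt_plus _ _ _ _ _ _ h1 h2) (RInt_correct _ _ _ exD).
have e : RInt (fun theta => W theta * shift_num d x theta (psi theta)) 0 PI =
   exp (d * x) / 2 * I1 + exp (- (d * x)) / 2 * I2 - DEN.
  apply: is_RInt_unique; apply: is_RInt_ext h => t _.
  rewrite /minus /plus /opp /scal /= /mult /= /fourier_integrand -/(W t).
  have -> : phase k x M t - (IZR n + d) * t = psi t - d * t by rewrite /psi; ring.
  have -> : phase k x M t - (IZR n - d) * t = psi t + d * t by rewrite /psi; ring.
  rewrite /shift_num /cosh /sinh; move: (psi t) => q.
  rewrite cos_minus cos_plus; field.
rewrite e; field; repeat split => //.
Qed.

End Shift.

Section Expansion.
Variables (k : nat) (delta : Z).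
Hypotheses (hk : le 1 k) (delta0 : (0 <= delta)%Z).

Let d := IZR delta.
Definition shift_average (n : Z) : R :=
  1 / 2 * (INR (power_partitions k (n + delta)) / INR (power_partitions k n) +
           INR (power_partitions k (n - delta)) / INR (power_partitions k n)).
(** The mean of (1 - i tau)^2 is 1 - eps [corr_const] to first order. With means eps / B of tau^2
    and 3 eps^2 / B^2 of tau^4, the terms - tau^2 and 2 tau (- tau / 2) each give - eps / B, and the
    cubic phase gives - eps D / B^2. *)
Definition corr_const : R := 2 / var_const k + skew_const k / var_const k ^ 2.

Lemma shift_average_expansion : exists K eps0, 0 < eps0 <= 1 /\
  forall eps n, 0 < eps <= eps0 -> IZR n = c_ k / eps ^ S k ->
  Rabs (shift_average n - (1 + d ^ 2 / 2 * (eps ^ k) ^ 2 * (1 - eps * corr_const))) <=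
  K * eps ^ (2 * k + 2)%coq_nat.
Proof.
have k1 : 1 <= INR k by apply: (le_INR 1).
have [c0 _] := c_integral k hk.
have d0 : 0 <= d by apply: IZR_le.
pose B := var_const k; pose D := skew_const k.
set beta := corr_const; have betaE : 2 / B + D / B ^ 2 = beta by [].
have B0 : 0 < B.
  apply: Rmult_lt_0_compat => //.
  by have := Rdiv_lt_0_compat 1 (INR k) ltac:(lra) ltac:(lra); lra.
have [C [C0 major]] := major_arc k hk.
have [tau [eta0 [K1 [z [[tau01 eta00 K10 z0] lap]]]]] := laplace_expansion B D C B0 C0.
(* The minor arc must be negligible against a u, where a = x sqrt(eps) is the width of the peak and
   u = eps^(2k+2) the error allowed; a u is at least eps^(3k+3). *)
pose A := (3 * k + 3)%coq_nat.
have [K2 [e2 [K20 e20 minor]]] := minor_arc_decay k hk tau A tau01.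
pose E := 2 * exp d + 1.
have E1 : 1 <= E by rewrite /E; have := exp_pos d; lra.
pose KN := (2 * exp d + 3 + d ^ 2) * d ^ 4.
have KN0 : 0 <= KN.
  apply: Rmult_le_pos; first by have := exp_pos d; have := pow2_ge_0 d; lra.
  exact: pow_le.
have q0 : 0 < z / (8 * K2) by apply: Rdiv_lt_0_compat; lra.
(* Three demands: the minor arc bound applies, eta = sqrt(eps) is at most eta0, and the minor arc
   takes at most half of the denominator. *)
pose eps0 := Rmin (Rmin e2 (eta0 ^ 2)) (z / (8 * K2)).
have eps00 : 0 < eps0 <= 1.
  rewrite /eps0; split; last first.
    by apply: Rle_trans (Rmin_l _ _) _; apply: Rle_trans (Rmin_l _ _) _; lra.
  by apply: Rmin_pos => //; apply: Rmin_pos; [lra | apply: pow_lt; lra].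
pose K := 2 / z * (d ^ 2 / 2 * K1 + (KN * K1 + 4 * K2 * E) + d ^ 2 / 2 * (1 + Rabs beta) * (4 * K2)).
exists K, eps0; split => // eps n [p0 pe] hn.
have pe2 : eps <= e2 by apply: Rle_trans pe _; apply: Rle_trans (Rmin_l _ _) _; exact: Rmin_l.
have peta : eps <= eta0 ^ 2 by apply: Rle_trans pe _; apply: Rle_trans (Rmin_l _ _) _; exact: Rmin_r.
have pz : eps <= z / (8 * K2) by apply: Rle_trans pe _; exact: Rmin_r.
have [M1 hM1] := major eps ltac:(lra).
have [M2 hM2] := minor eps ltac:(lra).
(* Large enough for both arcs and for the three arguments n - delta, n, n + delta; the last is the
   largest, as delta >= 0. *)
pose M := (M1 + M2 + Z.to_nat (n + delta))%coq_nat.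
have maj := hM1 M ltac:(lia) (IZR n).
have min := hM2 M ltac:(lia).
pose x := eps ^ k.
have x0 : 0 < x by apply: pow_lt.
have x1 : x <= 1 by rewrite /x -(pow1 k); apply: pow_incr; lra.
pose eta := sqrt eps.
have ee : eta ^ 2 = eps by apply: pow2_sqrt; lra.
have eta_pos : 0 < eta by apply: sqrt_lt_R0.
have eta_le : eta <= eta0 by apply: (pow_le_reg 2) => //; [lia | lra | lra | rewrite ee].
have eps_eta : eps <= eta by rewrite -ee /=; nra.
pose S := tau / eta.
have etaS : eta * S = tau by rewrite /S; field; lra.
pose W theta := exp (log_weight k x M theta).
pose psi theta := phase k x M theta - IZR n * theta.
have W0 theta : 0 <= W theta by apply: Rlt_le; exact: exp_pos.
have cW y : continuous W y by exact: continuous_weight.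
have cpsi y : continuous psi y by exact: continuous_total_phase.
have cWcos y : continuous (fun y => W y * cos (psi y)) y by exact: continuous_weight_cos.
have cWnum y : continuous (fun y => W y * shift_num d x y (psi y)) y.
  exact: continuous_weight_shift_num.
(* theta = a s, so [a] is the Jacobian. It is factored out of numerator and denominator and
   cancels. *)
pose a := x * eta.
have a0 : 0 < a by apply: Rmult_lt_0_compat.
have aS : a * S = tau * x by rewrite /a Rmult_assoc etaS; ring.
pose Ls s := log_weight k x M (a * s).
pose ps s := psi (a * s).
have cLs s : continuous Ls s by apply: continuous_scale; exact: continuous_log_weight.
have cps s : continuous ps s by apply: continuous_scale.
have [hden hK hT] : [/\ z <= laplace_den tau eta Ls ps,
      Rabs (RInt (fun s => exp (Ls s)) 0 (tau / eta)) <= K1 &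
      Rabs (laplace_den tau eta Ls ps - eta ^ 2 * laplace_cos2 tau eta Ls ps
            + 2 * eta * laplace_sin tau eta Ls ps
            - laplace_den tau eta Ls ps * (1 - eta ^ 2 * (2 / B + D / B ^ 2))) <= K1 * eta ^ 4].
  have scaled s : 0 <= s -> _ := fun s0 => maj (eta * s) hn (Rmult_le_pos _ _ (Rlt_le _ _ eta_pos) s0).
  apply: lap => //.
  - move=> s hs; have [h _] := scaled s (proj1 hs).
    rewrite -/B -/x -Rmult_assoc -/a -/(Ls s) in h.
    have -> : B * s ^ 2 / 2 = B * (eta * s) ^ 2 / (2 * eps) by rewrite -ee; field; lra.
    by apply: Rle_trans h _; right; rewrite -ee; field; lra.
  - move=> s hs; have [_ h] := scaled s (proj1 hs).
    rewrite -/D -/x -Rmult_assoc -/a -/(psi (a * s)) -/(ps s) in h.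
    have -> : eta * (s / 2 + D * s ^ 3 / 6) = eta * s / 2 + D * (eta * s) ^ 3 / (6 * eps).
      by rewrite -ee; field; lra.
    by apply: Rle_trans h _; right; rewrite -ee; field; lra.
set den := laplace_den _ _ _ _ in hden hT.
set c2 := laplace_cos2 _ _ _ _ in hT; set sn := laplace_sin _ _ _ _ in hT.
have tx : 0 < tau * x <= x by split; [apply: Rmult_lt_0_compat; lra | nra].
have pi1 := PI2_1; have pi4 := PI_4.
have exI (f : R -> R) b b' : (forall y, continuous f y) -> ex_RInt f b b' by exact: ex_RInt_of_continuous.
pose u := eps ^ (2 * k + 2)%coq_nat.
have u0 : 0 < u by apply: pow_lt.
have epsA : eps ^ A <= a * u.
  have -> : eps ^ A = x * eps * u.
    by rewrite /x /u /A (_ : 3 * k + 3 = k + (1 + (2 * k + 2)))%coq_nat ?pow_add; [ring | lia].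
  by apply: Rmult_le_compat_r; [lra | rewrite /a; apply: Rmult_le_compat_l; lra].
have minW y : tau * x <= y <= PI -> W y <= K2 * (a * u).
  move=> hy; apply: Rle_trans (min y hy) _.
  by apply: Rmult_le_compat_l; lra.
have minor_int (f : R -> R) H : (forall y, continuous (fun y => W y * f y) y) ->
    (forall y, Rabs (f y) <= H) -> 0 <= H ->
    Rabs (RInt (fun y => W y * f y) (tau * x) PI) <= 4 * K2 * H * (a * u).
  move=> cf hf H0.
  apply: Rle_trans (_ : (PI - tau * x) * (K2 * (a * u) * H) <= _).
    apply: abs_RInt_le_const; [lra | exact: exI |] => y hy.
    rewrite Rabs_mult (Rabs_pos_eq (W y)) //.
    apply: Rmult_le_compat => //; [exact: Rabs_pos | exact: minW].
  have -> : 4 * K2 * H * (a * u) = 4 * (K2 * (a * u) * H) by ring.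
  apply: Rmult_le_compat_r; last lra.
  by apply: Rmult_le_pos => //; apply: Rmult_le_pos; [lra | apply: Rmult_le_pos; lra].
pose DEN := RInt (fun y => W y * cos (psi y)) 0 PI.
pose NUM := RInt (fun y => W y * shift_num d x y (psi y)) 0 PI.
have DENmaj : RInt (fun y => W y * cos (psi y)) 0 (tau * x) = a * den by rewrite -aS RInt_rescale.
have [d1 [d1b DENE]] : exists d1, Rabs d1 <= 4 * K2 * u /\ DEN = a * (den + d1).
  pose t := RInt (fun y => W y * cos (psi y)) (tau * x) PI.
  exists (t / a); split.
    rewrite Rabs_div ?(Rabs_pos_eq a); [|lra|lra].
    apply: (proj2 (Rle_div_l _ _ _ a0)).
    have := minor_int (fun y => cos (psi y)) 1 cWcos _ Rle_0_1; rewrite -/t => h.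
    apply: Rle_trans (h _) _; last lra.
    by move=> y; exact: Rabs_cos_le_1.
  rewrite /DEN -(RInt_Chasles _ 0 (tau * x) PI); [|exact: exI|exact: exI].
  by rewrite DENmaj -/t /plus /=; field; lra.
have ux : u <= eps.
  rewrite /u (_ : 2 * k + 2 = 1 + (2 * k + 1))%coq_nat; last by lia.
  rewrite pow_add pow_1 -[X in _ <= X]Rmult_1_r; apply: Rmult_le_compat_l; first lra.
  by rewrite -(pow1 (2 * k + 1)%coq_nat); apply: pow_incr; lra.
have d1z : 4 * K2 * u <= z / 2.
  have : 8 * K2 * eps <= z.
    by have := proj2 (Rle_div_r _ _ (8 * K2) ltac:(lra)) pz; lra.
  have : 4 * K2 * u <= 4 * K2 * eps by apply: Rmult_le_compat_l; lra.
  lra.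
have den2 : z / 2 <= den + d1 by move/Rabs_le_between: d1b; lra.
have DEN0 : DEN <> 0 by rewrite DENE; apply: Rgt_not_eq; apply: Rmult_lt_0_compat; lra.
(* The allowed error is x^2 eps^2. The x^4 left by cosh fits in it because k >= 1 gives x <= eps. *)
have x2 : x ^ 2 * eps ^ 2 = u.
  by rewrite /x /u pow_add -pow_mult (Nat.mul_comm k).
have x4 : x ^ 4 <= u.
  rewrite -x2; have -> : x ^ 4 = x ^ 2 * x ^ 2 by ring.
  apply: Rmult_le_compat_l; first exact: pow2_ge_0.
  apply: pow_incr; split; first lra.
  rewrite /x -{2}(pow_1 eps) (_ : k = 1 + Nat.pred k)%coq_nat; last by lia.
  rewrite pow_add -[X in _ <= X]Rmult_1_r; apply: Rmult_le_compat_l; first by rewrite pow_1; lra.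
  by rewrite -(pow1 (Nat.pred k)); apply: pow_incr; lra.
have [e1 [e1b NUME]] : exists e1, Rabs e1 <= (KN * K1 + 4 * K2 * E) * u /\
    NUM = a * (d ^ 2 * x ^ 2 / 2 * (den - eta ^ 2 * c2 + 2 * eta * sn) + e1).
  pose h y := shift_num d x y (psi y) - shift_num_main d x y (psi y).
  have ch y : continuous h y.
    by apply: continuous_Rminus;
      [exact: continuous_shift_num | exact: continuous_shift_num_main].
  have cWh y : continuous (fun y => W y * h y) y by exact: continuous_Rmult.
  have cWm y : continuous (fun y => W y * shift_num_main d x y (psi y)) y.
    by apply: continuous_Rmult => //; exact: continuous_shift_num_main.
  pose t1 := RInt (fun y => W y * h y) 0 (tau * x).
  pose t2 := RInt (fun y => W y * shift_num d x y (psi y)) (tau * x) PI.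
  exists (t1 / a + t2 / a).
  have main : RInt (fun y => W y * shift_num_main d x y (psi y)) 0 (tau * x) =
      a * (d ^ 2 * x ^ 2 / 2 * (den - eta ^ 2 * c2 + 2 * eta * sn)).
    rewrite -aS RInt_rescale //; congr Rmult.
    have cE s : continuous (fun s => exp (Ls s)) s by exact: continuous_exp_comp.
    have cEc s : continuous (fun s => exp (Ls s) * cos (ps s)) s.
      by apply: continuous_Rmult => //; exact: continuous_cos_comp.
    have cEc2 s : continuous (fun s => s ^ 2 * (exp (Ls s) * cos (ps s))) s.
      apply: continuous_Rmult => //.
      by apply: (ex_derive_continuous (fun s => s ^ 2)); auto_derive.
    have cEs s : continuous (fun s => exp (Ls s) * (s * sin (ps s))) s.
      apply: continuous_Rmult => //.
      apply: continuous_Rmult; last exact: continuous_sin_comp.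
      exact: continuous_id.
    have i1 := RInt_correct _ _ _ (exI _ 0 S cEc).
    have i2 := is_RInt_scal _ _ _ (eta ^ 2) _ (RInt_correct _ _ _ (exI _ 0 S cEc2)).
    have i3 := is_RInt_scal _ _ _ (2 * eta) _ (RInt_correct _ _ _ (exI _ 0 S cEs)).
    have i := is_RInt_scal _ _ _ (d ^ 2 * x ^ 2 / 2) _
      (is_RInt_plus _ _ _ _ _ _ (is_RInt_minus _ _ _ _ _ _ i1 i2) i3).
    apply: is_RInt_unique; apply: is_RInt_ext i => s _.
    rewrite /minus /plus /opp /scal /= /mult /= /shift_num_main -/(ps s).
    rewrite /W -/(Ls s) /a; field.
  have t1b : Rabs (t1 / a) <= KN * K1 * u.
    rewrite Rabs_div ?(Rabs_pos_eq a); [|lra|lra].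
    apply: (proj2 (Rle_div_l _ _ _ a0)).
    apply: Rle_trans (Rabs_RInt_mult_le W h 0 (tau * x) (KN * x ^ 4) _ cW ch W0 _) _; first lra.
      by move=> y hy; apply: Rabs_shift_num_sub_le => //; lra.
    rewrite -aS RInt_rescale //.
    have hK' : RInt (fun s => W (a * s)) 0 S <= K1 by apply: Rle_trans (Rle_abs _) hK.
    have x40 : 0 <= x ^ 4 by apply: pow_le; lra.
    have m1 : a * RInt (fun s => W (a * s)) 0 S <= a * K1 by apply: Rmult_le_compat_l; lra.
    have m2 : KN * x ^ 4 * (a * RInt (fun s => W (a * s)) 0 S) <= KN * x ^ 4 * (a * K1).
      by apply: Rmult_le_compat_l => //; exact: Rmult_le_pos.
    have m3 : (KN * K1 * a) * x ^ 4 <= (KN * K1 * a) * u.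
      by apply: Rmult_le_compat_l => //; apply: Rmult_le_pos; [exact: Rmult_le_pos | lra].
    lra.
  have t2b : Rabs (t2 / a) <= 4 * K2 * E * u.
    rewrite Rabs_div ?(Rabs_pos_eq a); [|lra|lra].
    apply: (proj2 (Rle_div_l _ _ _ a0)).
    have := minor_int (fun y => shift_num d x y (psi y)) E cWnum _ _; rewrite -/t2 => b.
    apply: Rle_trans (b _ _) _; [| lra | lra].
    by move=> y; apply: Rabs_shift_num_le => //; lra.
  split; first by apply: Rle_trans (Rabs_triang _ _) _; lra.
  rewrite /NUM -(RInt_Chasles _ 0 (tau * x) PI); [|exact: exI|exact: exI].
  have -> : RInt (fun y => W y * shift_num d x y (psi y)) 0 (tau * x) =
     RInt (fun y => W y * shift_num_main d x y (psi y)) 0 (tau * x) + t1.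
    apply: is_RInt_unique.
    have i1 := RInt_correct _ _ _ (exI _ 0 (tau * x) cWm).
    have i2 := RInt_correct _ _ _ (exI _ 0 (tau * x) cWh).
    apply: is_RInt_ext (is_RInt_plus _ _ _ _ _ _ i1 i2) => y _.
    by rewrite /plus /= /h; ring.
  by rewrite main -/t2 /plus /=; field; lra.
have avgE : shift_average n = 1 + NUM / DEN.
  rewrite /shift_average !(power_partitions_fourier k x M) //; try (rewrite /M; lia).
  apply: (fourier_coef_shift_average k x M n delta x0).
  rewrite /fourier_coef => e; apply: DEN0.
  have g0 := exp_pos (IZR n * x); have g1 : 0 < gen_product k x M by exact: exp_pos.
  have : gen_product k x M * exp (IZR n * x) / PI <> 0.
    by apply: Rgt_not_eq; apply: Rdiv_lt_0_compat; [exact: Rmult_lt_0_compat | lra].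
  by case: (Rmult_integral _ _ e) => // h; case.
rewrite avgE NUME DENE.
set T := den - eta ^ 2 * c2 + 2 * eta * sn in hT *.
have e4 : eta ^ 4 = eps ^ 2 by rewrite -ee; ring.
rewrite betaE e4 ee in hT.
rewrite -/x.
have dd0 : 0 < den + d1 by lra.
have -> : 1 + a * (d ^ 2 * x ^ 2 / 2 * T + e1) / (a * (den + d1)) -
   (1 + d ^ 2 / 2 * x ^ 2 * (1 - eps * beta)) =
   (d ^ 2 / 2 * x ^ 2 * (T - den * (1 - eps * beta)) +
    (e1 + - (d ^ 2 / 2 * x ^ 2 * (1 - eps * beta) * d1))) / (den + d1) by field; lra.
rewrite Rabs_div ?(Rabs_pos_eq (den + d1)); [|lra|lra].
have d2 := pow2_ge_0 d; have xx := pow2_ge_0 x.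
have b1 : Rabs (d ^ 2 / 2 * x ^ 2 * (T - den * (1 - eps * beta))) <= d ^ 2 / 2 * K1 * u.
  have -> : d ^ 2 / 2 * K1 * u = d ^ 2 / 2 * x ^ 2 * (K1 * eps ^ 2) by rewrite -x2; ring.
  by apply: Rabs_mul_le => //; rewrite Rabs_pos_eq; [lra | apply: Rmult_le_pos; lra].
have b2 : Rabs (d ^ 2 / 2 * x ^ 2 * (1 - eps * beta) * d1) <= d ^ 2 / 2 * (1 + Rabs beta) * (4 * K2 * u).
  apply: Rabs_mul_le => //.
  rewrite Rmult_assoc; apply: Rabs_mul_le; first by rewrite Rabs_pos_eq; lra.
  rewrite -[X in _ <= X]Rmult_1_l; apply: Rabs_mul_le.
    rewrite Rabs_pos_eq // -(pow1 2); apply: pow_incr; lra.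
  apply: Rle_trans (Rabs_triang _ _) _; rewrite Rabs_R1 Rabs_Ropp.
  apply: Rplus_le_compat_l; rewrite -[X in _ <= X]Rmult_1_l.
  by apply: Rabs_mul_le; [rewrite Rabs_pos_eq; lra | lra].
apply: (proj2 (Rle_div_l _ _ _ dd0)).
apply: Rle_trans (Rabs_triang _ _) _.
have b3 := Rabs_triang e1 (- (d ^ 2 / 2 * x ^ 2 * (1 - eps * beta) * d1)).
rewrite Rabs_Ropp in b3.
set Q := d ^ 2 / 2 * K1 + (KN * K1 + 4 * K2 * E) + d ^ 2 / 2 * (1 + Rabs beta) * (4 * K2).
have Q0 : 0 <= Q * u.
  have -> : Q * u = d ^ 2 / 2 * K1 * u + (KN * K1 + 4 * K2 * E) * u +
    d ^ 2 / 2 * (1 + Rabs beta) * (4 * K2 * u).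
    by rewrite /Q; ring.
  have := Rabs_pos e1.
  have := Rabs_pos (d ^ 2 / 2 * x ^ 2 * (T - den * (1 - eps * beta))).
  have := Rabs_pos (d ^ 2 / 2 * x ^ 2 * (1 - eps * beta) * d1); lra.
apply: Rle_trans (_ : Q * u <= _); first by rewrite /Q; lra.
have -> : K * eps ^ (2 * k + 2)%coq_nat * (den + d1) = Q * u * ((den + d1) * (2 / z)).
  by rewrite /K -/Q -/u; ring.
rewrite -{1}(Rmult_1_r (Q * u)); apply: Rmult_le_compat_l => //.
have -> : 1 = z / 2 * (2 / z) by field; lra.
by apply: Rmult_le_compat_r => //; apply: Rlt_le; apply: Rdiv_lt_0_compat; lra.
Qed.

End Expansion.

(** The derivative p t^(-p-1) is at most p t^(-2), as p >= 1, and t stays above n / 2; hence the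
    factor 4. *)
Lemma inv_Rpower_shift (h p : R) : 1 <= p -> exists K N, forall n, N <= n ->
  Rabs (/ Rpower (n + h) p - / Rpower n p) <= K * (1 / n ^ 2).
Proof.
move=> p1; exists (4 * p * Rabs h), (2 + 2 * Rabs h) => n hn.
have h0 := Rabs_pos h.
have hb : - Rabs h <= h <= Rabs h by apply/Rabs_le_between; lra.
have n0 : 2 <= n by lra.
rewrite -!Rpower_Ropp.
have range t : Rmin n (n + h) <= t <= Rmax n (n + h) -> n / 2 <= t.
  by rewrite /Rmin; case: Rle_dec => ? [? _]; lra.
have e : 4 * p * Rabs h * (1 / n ^ 2) = (4 * p * (1 / n ^ 2)) * Rabs (n + h - n).
  by rewrite (_ : n + h - n = h); ring.
rewrite e.
apply: (Rabs_sub_le_of_derive (fun t => Rpower t (- p)) (fun t => - p * Rpower t (- p - 1))).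
  move=> t /range ht; apply/is_derive_Reals; apply: derivable_pt_lim_power; lra.
move=> t /range ht.
have t0 : 1 <= t by lra.
have le : Rpower t (- p - 1) <= / t ^ 2.
  have -> : / t ^ 2 = Rpower t (- INR 2) by rewrite Rpower_Ropp Rpower_pow //; lra.
  by apply: Rle_Rpower => //; rewrite /=; lra.
have p0 : 0 < Rpower t (- p - 1) by exact: exp_pos.
rewrite Rabs_mult Rabs_Ropp (Rabs_pos_eq p) ?(Rabs_pos_eq (Rpower _ _)); [|lra|lra].
apply: Rle_trans (_ : p * (/ t ^ 2) <= _); first by apply: Rmult_le_compat_l; lra.
have -> : 4 * p * (1 / n ^ 2) = p * / (n / 2) ^ 2 by field; lra.
apply: Rmult_le_compat_l; first lra.
apply: Rinv_le_contravar; first by apply: pow_lt; lra.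
by apply: pow_incr; lra.
Qed.

Lemma shift_average_asymptotics_nonneg (k : nat) (delta : Z) (hk : (1 <= k)%N) : (0 <= delta)%Z ->
  exists (K : R) (N : Z), forall n : Z, (N <= n)%Z ->
    Rabs
      (shift_average k delta n
       - (1
          + (1 / 2 * a_ k ^ 2 * IZR delta ^ 2)
              / Rpower (IZR n + h_ k) (2 - 2 / (INR k + 1))
          - ((2 - 3 / (2 * (INR k + 1))) * a_ k * IZR delta ^ 2)
              / Rpower (IZR n + h_ k) (2 - 1 / (INR k + 1))))
    <= K * (1 / IZR n ^ 2).
Proof.
move=> delta0; have hk' : le 1 k by apply/leP.
have k1 : 1 <= INR k by apply: (le_INR 1).
have [c0 _] := c_integral k hk'.
have [K0 [eps0 [eps01 main]]] := shift_average_expansion k delta hk' delta0.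
(* Makes both exponents at least 1; the first one equals 1 when k = 1. *)
have half : 1 / (INR k + 1) <= 1 / 2.
  by apply: (proj2 (Rle_div_l 1 (1 / 2) (INR k + 1) ltac:(lra))); lra.
have [K1 [N1 sh1]] := inv_Rpower_shift (h_ k) (2 - 2 / (INR k + 1)) ltac:(lra).
have [K2 [N2 sh2]] := inv_Rpower_shift (h_ k) (2 - 1 / (INR k + 1)) ltac:(lra).
set c := c_ k in c0 main.
set m1 := 1 / 2 * a_ k ^ 2 * IZR delta ^ 2.
set m2 := (2 - 3 / (2 * (INR k + 1))) * a_ k * IZR delta ^ 2.
exists (K0 * c ^ 2 + Rabs m1 * K1 + Rabs m2 * K2).
have ek0 : 0 < eps0 ^ S k by apply: pow_lt; lra.
have q0 : 0 < c / eps0 ^ S k by apply: Rdiv_lt_0_compat.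
pose bound := Rabs N1 + Rabs N2 + c / eps0 ^ S k + 1.
exists (up bound) => n nb.
have nlarge : bound <= IZR n by have [h _] := archimed bound; have := IZR_le _ _ nb; lra.
set r := IZR n in nlarge *.
have r1 : 1 <= r /\ N1 <= r /\ N2 <= r /\ c / eps0 ^ S k <= r.
  rewrite /bound in nlarge.
  have := Rabs_pos N1; have := Rabs_pos N2; have := Rle_abs N1; have := Rle_abs N2.
  by repeat split; lra.
have [r0 [rN1 [rN2 rc]]] := r1.
have cr0 : 0 < c / r by apply: Rdiv_lt_0_compat; lra.
(* The solution of n = c_k / eps^(k+1). *)
pose eps := root (S k) (c / r).
have eps_pos : 0 < eps by exact: root_pos.
have epsk : eps ^ S k = c / r by apply: root_pow => //; lia.
have eps_le : eps <= eps0.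
  apply: (pow_le_reg (S k)); [lia | lra | lra |].
  rewrite epsk; apply: (proj2 (Rle_div_l c (eps0 ^ S k) r ltac:(lra))).
  have := proj1 (Rle_div_l _ _ _ ek0) rc; lra.
have nE : r = c / eps ^ S k by rewrite epsk; field; lra.
have ex := main eps n (conj eps_pos eps_le) nE.
pose q := INR k / (INR k + 1).
have rq0 : 0 < Rpower r q by exact: exp_pos.
have aE : a_ k = eps ^ k * Rpower r q.
  have -> : eps ^ k = Rpower (c / r) q.
    rewrite -Rpower_pow // /eps /root Rpower_mult S_INR; congr Rpower.
    by rewrite /q; field; lra.
  rewrite Rpower_mult_distr; [|lra|lra].
  by rewrite (_ : c / r * r = c) //; field; lra.
have p1E : Rpower r (2 - 2 / (INR k + 1)) = Rpower r q ^ 2.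
  rewrite -Rpower_pow // Rpower_mult; congr Rpower.
  by rewrite /q /=; field; lra.
have p2E : Rpower r (2 - 1 / (INR k + 1)) = Rpower r q * r.
  rewrite -{3}(Rpower_1 r); last lra.
  by rewrite -Rpower_plus; congr Rpower; rewrite /q; field; lra.
have s1 := sh1 r rN1; have s2 := sh2 r rN2.
rewrite p1E in s1; rewrite p2E in s2.
set P1 := Rpower (r + h_ k) _ in s1 *; set P2 := Rpower (r + h_ k) _ in s2 *.
have e2 : eps ^ (2 * k + 2)%coq_nat = c ^ 2 * (1 / r ^ 2).
  have -> : (2 * k + 2 = S k * 2)%coq_nat by lia.
  by rewrite pow_mult epsk; field; lra.
rewrite e2 in ex.
(* Here x = a_k / n^(k/(k+1)) and x eps = c_k / n. Half of c_k [corr_const] is (4k + 1) / (2 (k +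
   1)) = 2 - 3 / (2 (k + 1)), the coefficient in the theorem. *)
have approx : IZR delta ^ 2 / 2 * (eps ^ k) ^ 2 * (1 - eps * corr_const k) =
   m1 * / Rpower r q ^ 2 - m2 * / (Rpower r q * r).
  have b : corr_const k = (4 * INR k + 1) / ((INR k + 1) * c).
    by rewrite /corr_const /skew_const /var_const -/c; field; repeat split; lra.
  have e : eps ^ k * eps = c / r by rewrite -epsk /=; ring.
  transitivity (IZR delta ^ 2 / 2 * (eps ^ k) ^ 2 -
     IZR delta ^ 2 / 2 * eps ^ k * (eps ^ k * eps) * corr_const k); first by ring.
  by rewrite e b /m1 /m2 aE; field; repeat split; lra.
rewrite approx in ex.
have -> : shift_average k delta n - (1 + m1 / P1 - m2 / P2) =
  (shift_average k delta n - (1 + (m1 * / Rpower r q ^ 2 - m2 * / (Rpower r q * r)))) +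
  (- (m1 * (/ P1 - / Rpower r q ^ 2)) + m2 * (/ P2 - / (Rpower r q * r))).
  by rewrite /Rdiv; ring.
apply: Rle_trans (Rabs_triang _ _) _.
have t := Rabs_triang (- (m1 * (/ P1 - / Rpower r q ^ 2))) (m2 * (/ P2 - / (Rpower r q * r))).
rewrite Rabs_Ropp in t.
have t1 := Rabs_mul_le _ _ _ _ (Rle_refl (Rabs m1)) s1.
have t2 := Rabs_mul_le _ _ _ _ (Rle_refl (Rabs m2)) s2.
have -> : (K0 * c ^ 2 + Rabs m1 * K1 + Rabs m2 * K2) * (1 / r ^ 2) =
  K0 * (c ^ 2 * (1 / r ^ 2)) + Rabs m1 * (K1 * (1 / r ^ 2)) + Rabs m2 * (K2 * (1 / r ^ 2)).
  by ring.
lra.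
Qed.

Lemma shift_average_opp k delta n : shift_average k (- delta) n = shift_average k delta n.
Proof.
by rewrite /shift_average Z.sub_opp_r -Z.sub_opp_r Z.opp_involutive Rplus_comm.
Qed.

Theorem corollary5p6 (k : nat) (delta : Z) (hk : (1 <= k)%N) :
  exists (K : R) (N : Z), forall n : Z, (N <= n)%Z ->
    Rabs
      (1 / 2 *
         (INR (power_partitions k (n + delta)) / INR (power_partitions k n) +
          INR (power_partitions k (n - delta)) / INR (power_partitions k n))
       - (1
          + (1 / 2 * a_ k ^ 2 * IZR delta ^ 2)
              / Rpower (IZR n + h_ k) (2 - 2 / (INR k + 1))
          - ((2 - 3 / (2 * (INR k + 1))) * a_ k * IZR delta ^ 2)
              / Rpower (IZR n + h_ k) (2 - 1 / (INR k + 1))))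
    <= K * (1 / IZR n ^ 2).
Proof.
case: (Z.le_gt_cases 0 delta) => hd; first exact: shift_average_asymptotics_nonneg.
have [K [N h]] := shift_average_asymptotics_nonneg k (- delta)%Z hk ltac:(lia).
exists K, N => n nN; have := h n nN; rewrite shift_average_opp opp_IZR.
by have -> : (- IZR delta) ^ 2 = IZR delta ^ 2 by ring.
Qed.
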